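(* Let $\lambda\ge 0$, $p_0=\frac{2\lambda}{2\lambda+1}$, $p_0\le p\le 1$ (with $p>0$) and $0<q<\infty$. Let $w:[0,1)\to(0,\infty)$ be a weight function (Lebesgue integrable over $[0,1)$) such that $$\int_0^r\frac{w(s)}{(1-s)^q}\,ds\lesssim \frac{1}{(1-r)^q}\int_r^1w(s)\,ds,\qquad r\in(0,1).$$ Put $\alpha=\frac{q+2\lambda+1}{p}-2\lambda-2$. Let $(X,\|\cdot\|_X)$ be a Banach space, let $T$ be a linear operator from the space of $\lambda$-analytic polynomials into $X$, let $x_n=T\phi_n$ for $n\ge0$, and let $$F_{\lambda,\alpha}(z)=\sum_{n=0}^{\infty}\frac{\Gamma(\lambda+1)\Gamma(n+\lambda+\alpha+2)}{\Gamma(\lambda+\alpha+2)\Gamma(n+\lambda+1)}\,x_n\,\phi_n(z),\qquad z\in\mathbb{D}.$$ If $T$ has a bounded extension from $A^{p}_{\lambda,w}(\mathbb{D})$ to $X$, then $F_{\lambda,\alpha}$ is an $X$-valued $\lambda$-analytic function on $\mathbb{D}$ and satisfies $$\|F_{\lambda,\alpha}(z)\|_X^p\lesssim \frac{|1-z^{2}|^{2\lambda(1-p)}}{(1-|z|)^{(\alpha+2)p-1}}\int_{|z|^{1/2}}^1 w(s)\,ds,\qquad z\in\mathbb{D}.$$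
   Context: $\mathbb{D}$ is the open unit disk in $\mathbb{C}$. For $\lambda\ge0$ the Dunkl operator $D_{\bar z}$ is $D_{\bar z}f(z)=\partial_{\bar z}f-\lambda\frac{f(z)-f(\bar z)}{z-\bar z}$ (the quotient being understood as its limit on the real axis). A $C^2$ function $f$ on $\mathbb{D}$ is $\lambda$-analytic if $D_{\bar z}f=0$. Equivalently, $f(z)=\sum_{n\ge0}c_n\phi_n(z)$ for $|z|<1$, where $$\phi_n(z)=\phi_n^{\lambda}(z)=\epsilon_n\sum_{j=0}^{n}\frac{(\lambda)_j(\lambda+1)_{n-j}}{j!(n-j)!}\bar z^{j}z^{n-j},\qquad \epsilon_n=\sqrt{n!/(2\lambda+1)_n},$$ and $(a)_j$ is the Pochhammer symbol. A $\lambda$-analytic polynomial is a finite linear combination of the $\phi_n$, $n\ge0$. Let $d\sigma_\lambda(z)=c_\lambda|y|^{2\lambda}\,dx\,dy$ ($z=x+iy$), $c_\lambda=\Gamma(\lambda+2)/(\Gamma(\lambda+1/2)\Gamma(1/2))$. For a weight $w$, i.e. a Lebesgue integrable function $w:[0,1)\to(0,\infty)$, and $0<p<\infty$, the weighted $\lambda$-Bergman space $A^p_{\lambda,w}(\mathbb{D})$ consists of the $\lambda$-analytic functions $f$ on $\mathbb{D}$ with $\|f\|_{A^p_{\lambda,w}}=\left(\int_{\mathbb{D}}|f(z)|^pw(|z|)\,d\sigma_\lambda(z)\right)^{1/p}<\infty$. ''Bounded'' means $\|Tf\|_X\le C\|f\|_{A^p_{\lambda,w}}$. ''$F_{\lambda,\alpha}$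 is an $X$-valued $\lambda$-analytic function'' means that the series defining it converges in $X$, locally uniformly in $z\in\mathbb{D}$. $\mathcal{X}\lesssim\mathcal{Y}$ means $\mathcal{X}\le c\,\mathcal{Y}$ with a constant $c>0$ independent of the variables ($r$, $z$, etc.). *)

(* Defs.v *)
From HB Require Import structures.
From mathcomp Require Import all_boot all_order all_algebra.
From mathcomp Require Import complex.
From mathcomp Require Import all_classical all_reals all_analysis.

Set Implicit Arguments.
Unset Strict Implicit.
Unset Printing Implicit Defensive.
Import Order.TTheory GRing.Theory Num.Theory.
Import numFieldNormedType.Exports.
Local Open Scope classical_set_scope.
Local Open Scope ring_scope.
Local Open Scope complex_scope.

(** In a normed space over [R[i]] the norm takes its values in [R[i]]; [rnorm]
    is the same norm as an element of [R].  It is used both for the modulus of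
    a complex number and for the norm of a Banach space over [R[i]]. *)
Definition rnorm (R : realType) (V : normedZmodType R[i]) (v : V) : R :=
  complex.Re `|v|.

Definition disc (R : realType) : set R[i] := [set z | rnorm z < 1].

Definition toC (R : realType) (xy : R * R) : R[i] := xy.1 +i* xy.2.
Definition ofC (R : realType) (z : R[i]) : R * R :=
  (complex.Re z, complex.Im z).

Definition disc2 (R : realType) : set (R * R) := [set xy | disc (toC xy)].

(** Euler's integral; it is only used at positive arguments, where it
    converges. *)
Definition Gamma (R : realType) (x : R) : R :=
  \int[lebesgue_measure]_(t in `]0%R, +oo[) (t `^ (x - 1) * expR (- t)).

Definition poch (R : realType) (a : R) (n : nat) : R :=
  \prod_(i < n) (a + i%:R).

Definition phi (R : realType) (lambda : R) (n : nat) (z : R[i]) : R[i] :=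
  (Num.sqrt (n`!%:R / poch (2 * lambda + 1) n))%:C *
  \sum_(j < n.+1)
    (poch lambda j * poch (lambda + 1) (n - j) / (j`!%:R * (n - j)`!%:R))%:C
    * (conjc z ^+ j * z ^+ (n - j)).

(** [u] has continuous partial derivatives up to order [k] on the open set [U]
    of the real plane. *)
Fixpoint Ck_on (R : realType) (k : nat) (U : set (R * R)) (u : R * R -> R)
    : Prop :=
  (forall xy, U xy -> {for xy, continuous u}) /\
  (if k is k'.+1 then
     forall v : R * R, v = (1, 0) \/ v = (0, 1) ->
       (forall xy, U xy -> derivable u xy v) /\
       Ck_on k' U (fun xy => 'D_v u xy)
   else True).

(** Derivative in the real direction [v], taken in the underlying real plane. *)
Definition rderive (R : realType) (v : R * R) (f : R[i] -> R[i]) (z : R[i])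
    : R[i] :=
  'D_v (fun xy : R * R => complex.Re (f (toC xy)) : R) (ofC z) +i*
  'D_v (fun xy : R * R => complex.Im (f (toC xy)) : R) (ofC z).

Definition dzbar (R : realType) (f : R[i] -> R[i]) (z : R[i]) : R[i] :=
  2^-1 * (rderive (1, 0) f z + 'i * rderive (0, 1) f z).

(** The quotient (f(z) - f(conj z)) / (z - conj z); on the real axis, its limit
    along nonreal points.  ([R[i]^o] is [R[i]] with the topology of its
    norm.) *)
Definition dunkl_quotient (R : realType) (f : R[i] -> R[i]) (z : R[i]) : R[i] :=
  let quot (u : R[i]^o) : R[i]^o := (f u - f (conjc u)) / (u - conjc u) in
  if complex.Im z == 0 then
    lim (quot u @[u --> within [set u : R[i]^o | complex.Im u != 0]
                               (nbhs (z : R[i]^o))])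
  else quot z.

Definition dunkl_zbar (R : realType) (lambda : R) (f : R[i] -> R[i])
    (z : R[i]) : R[i] :=
  dzbar f z - lambda%:C * dunkl_quotient f z.

(** Functions on the disc are represented by total functions on [R[i]], of
    which only the values on the disc matter. *)
Definition lambda_analytic (R : realType) (lambda : R) (f : R[i] -> R[i])
    : Prop :=
  [/\ Ck_on 2 (@disc2 R) (fun xy => complex.Re (f (toC xy))),
      Ck_on 2 (@disc2 R) (fun xy => complex.Im (f (toC xy)))
    & forall z, disc z -> dunkl_zbar lambda f z = 0].

Definition lambda_analytic_poly (R : realType) (lambda : R)
    : set (R[i] -> R[i]) :=
  [set f | exists (N : nat) (c : nat -> R[i]),
      f = (fun z => \sum_(n < N) c n * phi lambda n z)].

(** [lebesgue_measure] lives on the Borel sets; its completion is the measure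
    for which "integrable" allows all Lebesgue measurable functions. *)
Definition is_weight (R : realType) (w : R -> R) : Prop :=
  (forall s, 0 <= s < 1 -> 0 < w s) /\
  (@completed_lebesgue_measure R).-integrable `[0%R, 1%R[ (EFin \o w).

(** The density of sigma_lambda with respect to dx dy. *)
Definition sigma_density (R : realType) (lambda : R) (xy : R * R) : R :=
  Gamma (lambda + 2) / (Gamma (lambda + 2^-1) * Gamma 2^-1)
  * `|xy.2| `^ (2 * lambda).

(** The integrand is nonnegative on the disc, and the library integral of a
    nonnegative function is the supremum of the integrals of the Borel simple
    functions below it.  For a Lebesgue measurable integrand this is its
    Lebesgue integral, so the plane measure need not be completed here. *)
Definition bergman_norm (R : realType) (lambda : R) (w : R -> R) (p : R)
    (f : R[i] -> R[i]) : \bar R :=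
  ((\int[(lebesgue_measure \x lebesgue_measure)%E]_(xy in @disc2 R)
     (rnorm (f (toC xy)) `^ p * w (rnorm (toC xy))
      * sigma_density lambda xy)%:E) `^ p^-1)%E.

Definition bergman (R : realType) (lambda : R) (w : R -> R) (p : R)
    : set (R[i] -> R[i]) :=
  [set f | lambda_analytic lambda f /\ (bergman_norm lambda w p f < +oo)%E].

Definition linear_on (R : realType) (X : completeNormedModType R[i])
    (P : set (R[i] -> R[i])) (T : (R[i] -> R[i]) -> X) : Prop :=
  forall (a : R[i]) (f g : R[i] -> R[i]), P f -> P g ->
    T (fun z => a * f z + g z) = a *: T f + T g.

(** The bound makes [S f] depend only on the restriction of [f] to the disc. *)
Definition has_bounded_extension (R : realType) (lambda : R) (w : R -> R)
    (p : R) (X : completeNormedModType R[i]) (T : (R[i] -> R[i]) -> X)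
    : Prop :=
  exists S : (R[i] -> R[i]) -> X,
    [/\ linear_on (bergman lambda w p) S,
        forall f, lambda_analytic_poly lambda f -> S f = T f
      & exists C : R, forall f, bergman lambda w p f ->
          ((rnorm (S f))%:E <= C%:E * bergman_norm lambda w p f)%E].

Definition phi_partial (R : realType) (lambda : R)
    (X : completeNormedModType R[i]) (a : nat -> X) (N : nat) (z : R[i]) : X :=
  \sum_(n < N) phi lambda n z *: a n.

Definition phi_sum (R : realType) (lambda : R)
    (X : completeNormedModType R[i]) (a : nat -> X) (z : R[i]) : X :=
  lim (phi_partial lambda a N z @[N --> \oo]).

(** Locally uniform convergence of sum_n phi_n(z) a_n on the disc. *)
Definition vector_lambda_analytic (R : realType) (lambda : R)
    (X : completeNormedModType R[i]) (a : nat -> X) : Prop :=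
  forall z0 : R[i], disc z0 -> exists2 d : R, 0 < d &
    {uniform [set z | disc z /\ rnorm (z - z0) < d],
      phi_partial lambda a @ \oo --> phi_sum lambda a}.

Definition Fcoef (R : realType) (lambda alpha : R)
    (X : completeNormedModType R[i]) (T : (R[i] -> R[i]) -> X) (n : nat) : X :=
  (Gamma (lambda + 1) * Gamma (n%:R + lambda + alpha + 2)
   / (Gamma (lambda + alpha + 2) * Gamma (n%:R + lambda + 1)))%:C
  *: T (phi lambda n).

(* Main.v *)
Require Import Defs.
From HB Require Import structures.
From mathcomp Require Import all_boot all_order all_algebra.
From mathcomp Require Import complex ring lra zify.
From mathcomp Require Import all_classical all_reals all_analysis measurable_realfun.

Set Implicit Arguments.
Unset Strict Implicit.
Unset Printing Implicit Defensive.
Import Order.TTheory GRing.Theory Num.Theory.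
Import numFieldNormedType.Exports.
Local Open Scope classical_set_scope.
Local Open Scope ring_scope.
Local Open Scope complex_scope.

(** By linearity the [N]-th partial sum of [F] at [z] is the value of [T] at the
    partial sum [K_N(z, .)] of the kernel
    [K(z, v) = sum_n (lambda+alpha+2)_n / (lambda+1)_n phi_n(z) phi_n(v)], so it
    suffices to bound the Bergman norm of [K_N(z, .)].

    Let [M] and [m] be the larger and the smaller of [|1 - z v|] and
    [|1 - z conj v|].  Then [|K(z, v)| <= C M^(-2 lambda) m^(-alpha-2)]: for the
    kernel without coefficients, the increments of the two generating functions
    built on [phi_n(z) phi_n(v) t^n] and [phi_n(z) conj phi_n(v) t^n] solve a real
    linear system of differential equations in [t] with explicit monotone
    quantities; recurrences raise the order of the coefficients by integers, and a
    Beta average brings it down to the real order [alpha + 1].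

    As [|Im v| <= 2 M] and [M <= |1 - z^2| + m], the integrand is at most a constant
    times [|1 - z^2|^kappa m^(-q-1-kappa) + m^(-q-1)], where
    [kappa = 2 lambda (1 - p)].  Integrating over circles turns [m^(-N)] into
    [(1 - |z| s)^(1 - N)], and the hypothesis on [w] is applied at [sqrt |z|]. *)

(** * Moduli and norms *)

(** Two facts make real differential equations available: the increment
    [kap z w n.+1 - z * w * kap z w n] is a real number, and the recurrences couple only the pair
    [w], [conjc w]. So each complex generating function is a real one divided by [1 - t z w] or
    [1 - t z conj w], and two real unknowns suffice. The recurrences shift the order of the
    coefficients by integers only, hence the detour to an integer order above the real one.

    Everything is estimated for truncated kernels. They are polynomials, on which [T] and its
    extension agree, so neither membership of the full kernel in the Bergman space nor an exchange
    of the extension with an infinite sum has to be shown. The price is the error [tail], which is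
    not uniform in [z] but tends to 0 for fixed [z].

    The value of [alpha] gives [(alpha + 2) p = q + 1 + kappa]: the density turns [M^(-2 lambda p)]
    into [M^kappa], and the circle integral removes one power of [m], which leaves the exponents
    [q + kappa] and [q], the range in which the condition on [w] is effective. *)

Section Rnorm.
Variables (R : realType) (V : normedZmodType R[i]).
Implicit Types (v u : V).

Lemma rnormE v : (rnorm v)%:C = `|v|.
Proof.
rewrite /rnorm; have := normr_ge0 v; case: (`|v|) => a b.
by rewrite lecE /= => /andP[/eqP -> _].
Qed.

Lemma rnorm_ge0 v : 0 <= rnorm v.
Proof. by rewrite -ler0c rnormE. Qed.

Lemma rnorm0 : rnorm (0 : V) = 0.
Proof. by rewrite /rnorm normr0. Qed.

Lemma rnormN v : rnorm (- v) = rnorm v.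
Proof. by rewrite /rnorm normrN. Qed.

Lemma rnormD v u : rnorm (v + u) <= rnorm v + rnorm u.
Proof. by rewrite -lecR rmorphD /= !rnormE ler_normD. Qed.

Lemma rnorm_eq0 v : (rnorm v == 0) = (v == 0).
Proof.
rewrite -(inj_eq (@complexI R)) rnormE.
by rewrite (_ : 0%:C = 0) // normr_eq0.
Qed.

Lemma rnorm_sum (I : Type) (r : seq I) (P : pred I) (F : I -> V) :
  rnorm (\sum_(i <- r | P i) F i) <= \sum_(i <- r | P i) rnorm (F i).
Proof.
elim/big_ind2 : _ => [|x1 x2 y1 y2 h1 h2|//]; first by rewrite rnorm0.
by rewrite (le_trans (rnormD _ _)) // lerD.
Qed.

End Rnorm.

Section ComplexModulus.
Variable R : realType.
Implicit Types (z w : R[i]) (x y : R).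

Lemma rnormM z w : rnorm (z * w) = rnorm z * rnorm w.
Proof. by apply: (@complexI R); rewrite rmorphM /= !rnormE normrM. Qed.

Lemma rnorm1 : rnorm (1 : R[i]) = 1.
Proof. by apply: (@complexI R); rewrite rnormE normr1. Qed.

Lemma rnormX z n : rnorm (z ^+ n) = rnorm z ^+ n.
Proof. by elim: n => [|n IH]; rewrite ?expr0 ?rnorm1 // !exprS rnormM IH. Qed.

Lemma rnorm_conj z : rnorm (conjc z) = rnorm z.
Proof. by rewrite /rnorm normcJ. Qed.

Lemma rnormR x : rnorm x%:C = `|x|.
Proof. by rewrite /rnorm normc_def /= expr0n addr0 sqrtr_sqr. Qed.

Lemma sqr_rnorm z : rnorm z ^+ 2 = complex.Re z ^+ 2 + complex.Im z ^+ 2.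
Proof. by rewrite /rnorm normc_def /= sqr_sqrtr // addr_ge0 // sqr_ge0. Qed.

Lemma sqr_rnormE z : (rnorm z ^+ 2)%:C = z * conjc z.
Proof. by rewrite rmorphXn /= rnormE sqr_normc. Qed.

Lemma Re_le_rnorm z : `|complex.Re z| <= rnorm z.
Proof.
rewrite -(@ler_pXn2r _ 2) ?nnegrE ?rnorm_ge0 // sqr_rnorm real_normK ?num_real //.
by rewrite lerDl sqr_ge0.
Qed.

Lemma Im_le_rnorm z : `|complex.Im z| <= rnorm z.
Proof.
rewrite -(@ler_pXn2r _ 2) ?nnegrE ?rnorm_ge0 // sqr_rnorm real_normK ?num_real //.
by rewrite lerDr sqr_ge0.
Qed.

Lemma rnorm_le_ReIm z : rnorm z <= `|complex.Re z| + `|complex.Im z|.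
Proof.
rewrite -(@ler_pXn2r _ 2) ?nnegrE ?rnorm_ge0 // ?addr_ge0 // sqr_rnorm sqrrD.
rewrite !real_normK ?num_real //.
have : 0 <= `|complex.Re z| * `|complex.Im z| by rewrite mulr_ge0.
lra.
Qed.

Lemma rnormZ (V : normedModType R[i]) z (v : V) : rnorm (z *: v) = rnorm z * rnorm v.
Proof. by apply: (@complexI R); rewrite rmorphM /= !rnormE normrZ. Qed.

Lemma ReD z w : complex.Re (z + w) = complex.Re z + complex.Re w.
Proof. by case: z w => [? ?] []. Qed.

Lemma ImD z w : complex.Im (z + w) = complex.Im z + complex.Im w.
Proof. by case: z w => [? ?] []. Qed.

Lemma ReN z : complex.Re (- z) = - complex.Re z.
Proof. by case: z. Qed.

Lemma ImN z : complex.Im (- z) = - complex.Im z.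
Proof. by case: z. Qed.

Lemma ReM z w : complex.Re (z * w) =
  complex.Re z * complex.Re w - complex.Im z * complex.Im w.
Proof. by case: z w => [? ?] []. Qed.

Lemma ImM z w : complex.Im (z * w) =
  complex.Re z * complex.Im w + complex.Im z * complex.Re w.
Proof. by case: z w => [? ?] []. Qed.

Lemma ReZ x z : complex.Re (x%:C * z) = x * complex.Re z.
Proof. by rewrite ReM /= mul0r subr0. Qed.

Lemma ImZ x z : complex.Im (x%:C * z) = x * complex.Im z.
Proof. by rewrite ImM /= mul0r addr0. Qed.

Lemma Re_conj z : complex.Re (conjc z) = complex.Re z.
Proof. by case: z. Qed.

Lemma Im_conj z : complex.Im (conjc z) = - complex.Im z.
Proof. by case: z. Qed.

Lemma complex_ext z w : complex.Re z = complex.Re w -> complex.Im z = complex.Im w -> z = w.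
Proof. by case: z w => [? ?] [? ?] /= -> ->. Qed.

Lemma conjcD z w : conjc (z + w) = conjc z + conjc w.
Proof. exact: (rmorphD (@conjc R)). Qed.

Lemma conjcM z w : conjc (z * w) = conjc z * conjc w.
Proof. exact: (rmorphM (@conjc R)). Qed.

Lemma conjcX z n : conjc (z ^+ n) = (conjc z) ^+ n.
Proof. exact: (rmorphXn (@conjc R)). Qed.

Lemma conjc_sum (I : Type) (r : seq I) (P : pred I) (F : I -> R[i]) :
  conjc (\sum_(i <- r | P i) F i) = \sum_(i <- r | P i) conjc (F i).
Proof. by apply: (big_morph (@conjc R) conjcD); rewrite conjc0. Qed.

Lemma rcD x y : (x + y)%:C = x%:C + y%:C :> R[i].
Proof. exact: (rmorphD (real_complex R)). Qed.

Lemma rcM x y : (x * y)%:C = x%:C * y%:C :> R[i].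
Proof. exact: (rmorphM (real_complex R)). Qed.

Lemma rcX x n : (x ^+ n)%:C = x%:C ^+ n :> R[i].
Proof. exact: (rmorphXn (real_complex R)). Qed.

Lemma rc_nat n : n%:R%:C = n%:R :> R[i].
Proof. exact: (rmorph_nat (real_complex R)). Qed.

End ComplexModulus.

(** * Recurrences for the functions [phi_n] and their products *)

Section Pochhammer.
Variable R : realType.
Implicit Types a b : R.

Lemma poch0 a : poch a 0 = 1.
Proof. by rewrite /poch big_ord0. Qed.

Lemma pochS a n : poch a n.+1 = poch a n * (a + n%:R).
Proof. by rewrite /poch big_ord_recr. Qed.

Lemma pochSl a n : poch a n.+1 = a * poch (a + 1) n.
Proof.
rewrite /poch big_ord_recl addr0; congr (_ * _).
by apply: eq_bigr => i _; rewrite /bump /= natrD addrA.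
Qed.

Lemma poch_gt0 a n : 0 < a -> 0 < poch a n.
Proof. by move=> a0; apply: prodr_gt0 => i _; rewrite ltr_wpDr. Qed.

Lemma poch_ge0 a n : 0 <= a -> 0 <= poch a n.
Proof. by move=> a0; apply: prodr_ge0 => i _; rewrite addr_ge0. Qed.

End Pochhammer.

Section PhiRecurrence.
Variables (R : realType) (lambda : R).
Hypothesis lambda_ge0 : 0 <= lambda.
Implicit Types (z : R[i]) (n j : nat).

Definition phi_coef n j : R :=
  poch lambda j * poch (lambda + 1) (n - j) / (j`!%:R * (n - j)`!%:R).

(** [phi lambda n] without its factor epsilon_n; [phiE] puts the square root back. *)
Definition Phi n z : R[i] :=
  \sum_(j < n.+1) (phi_coef n j)%:C * ((conjc z) ^+ j * z ^+ (n - j)).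

Lemma factr_neq0 n : (n`!%:R : R) != 0.
Proof. by rewrite pnatr_eq0 -lt0n fact_gt0. Qed.

(** Comparison of coefficients for [PhiS]: the monomial [conj z ^ j z ^ (n + 1 - j)] comes from
    index [j] of [z * Phi n z] and from index [n + 1 - j] of [conj z * conj (Phi n z)]. At the two
    ends only one of them contributes. *)
Lemma phi_coefS0 n :
  n.+1%:R * phi_coef n.+1 0 = (n.+1%:R + lambda) * phi_coef n 0.
Proof.
rewrite /phi_coef !subn0 pochS poch0 factS natrM -!natr1.
have h1 := factr_neq0 n; have h2 : (n%:R + 1 : R) != 0 by rewrite natr1 pnatr_eq0.
by field; rewrite h1 h2.
Qed.

Lemma phi_coefSS n :
  n.+1%:R * phi_coef n.+1 n.+1 = lambda * phi_coef n 0.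
Proof.
rewrite /phi_coef !subn0 subnn pochSl !poch0 factS natrM -!natr1.
have h1 := factr_neq0 n; have h2 : (n%:R + 1 : R) != 0 by rewrite natr1 pnatr_eq0.
by field; rewrite h1 h2.
Qed.

Lemma phi_coefS n j : (j < n)%N ->
  n.+1%:R * phi_coef n.+1 j.+1 =
  (n.+1%:R + lambda) * phi_coef n j.+1 + lambda * phi_coef n (n - j).
Proof.
move=> jn; rewrite /phi_coef.
have [k ->] : exists k, n = (j + k).+1 by exists (n - j.+1)%N; rewrite -addSn subnKC.
rewrite (_ : ((j + k).+2 - j.+1 = k.+1)%N); last by lia.
rewrite (_ : ((j + k).+1 - j.+1 = k)%N); last by lia.
rewrite (_ : ((j + k).+1 - j = k.+1)%N); last by lia.
rewrite (_ : ((j + k).+1 - k.+1 = j)%N); last by lia.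
rewrite !pochSl -(pochSl (lambda + 1)) pochS !factS !natrM -!natr1 natrD.
have h1 := factr_neq0 j; have h2 := factr_neq0 k.
have h3 : (j%:R + 1 : R) != 0 by rewrite natr1 pnatr_eq0.
have h4 : (k%:R + 1 : R) != 0 by rewrite natr1 pnatr_eq0.
by field; rewrite h1 h2 h3 h4.
Qed.

Lemma conj_Phi n z :
  conjc (Phi n z) = \sum_(j < n.+1) (phi_coef n j)%:C * (z ^+ j * (conjc z) ^+ (n - j)).
Proof.
rewrite /Phi conjc_sum; apply: eq_bigr => j _.
by rewrite !conjcM conjc_real !conjcX conjcK.
Qed.

Lemma PhiJ n z : Phi n (conjc z) = conjc (Phi n z).
Proof. by rewrite conj_Phi /Phi; apply: eq_bigr => j _; rewrite conjcK. Qed.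

Lemma Phi0 z : Phi 0 z = 1.
Proof.
rewrite /Phi big_ord_recl big_ord0 /phi_coef subnn !poch0 /= fact0 !mulr1.
by rewrite divr1 addr0.
Qed.

(* This first-order recurrence is the Dunkl-adapted form of [z ^+ n.+1 = z * z ^+ n]. *)
Lemma PhiS n z : n.+1%:R * Phi n.+1 z =
  (n.+1%:R + lambda)%:C * (z * Phi n z) + lambda%:C * (conjc z * conjc (Phi n z)).
Proof.
rewrite conj_Phi (reindex_inj rev_ord_inj) /= /Phi.
(* [f1] and [f2] are the two coefficient families on the common range [j <= n + 1], set to 0 where a
   sum has no term: [j = n + 1] for the first, [j = 0] for the second. *)
pose f1 j := if (j <= n)%N then (n.+1%:R + lambda) * phi_coef n j else 0.
pose f2 j := if (j > 0)%N then lambda * phi_coef n (n - j.-1) else 0.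
transitivity (\sum_(j < n.+2) (f1 j + f2 j)%:C * ((conjc z) ^+ j * z ^+ (n.+1 - j))).
  rewrite mulr_sumr; apply: eq_bigr => -[j jn] _ /=.
  rewrite mulrA; congr (_ * _); rewrite -rc_nat -rcM.
  congr (_ %:C); rewrite /f1 /f2; case: j jn => [_|j].
    by rewrite leq0n ltnn addr0 phi_coefS0.
  rewrite ltnS ltnS leq_eqVlt /= => /predU1P[->|jn].
    by rewrite ltnn add0r subnn phi_coefSS.
  by rewrite jn phi_coefS.
under [LHS]eq_bigr do rewrite rcD mulrDl.
rewrite big_split /=; congr (_ + _).
  rewrite big_ord_recr /= {2}/f1 ltnn mul0r addr0 !mulr_sumr.
  apply: eq_bigr => -[j jn] _ /=; rewrite /f1 -ltnS jn rcM /= -!mulrA; congr (_ * _).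
  by rewrite subSn // exprS; ring.
rewrite big_ord_recl /= {1}/f2 ltnn mul0r add0r !mulr_sumr.
apply: eq_bigr => -[j jn] _; rewrite /f2 /bump /= add1n subSS rcM /= -!mulrA.
by rewrite add0n subKn // exprS; ring.
Qed.

(** [gam n] is epsilon_n to the power -2, and also the value [Phi n 1], so the bound of [Phi_le] is
    attained. *)
Definition gam n : R := poch (2 * lambda + 1) n / n`!%:R.

Lemma gam0 : gam 0 = 1.
Proof. by rewrite /gam poch0 fact0 divr1. Qed.

Lemma gamS n : n.+1%:R * gam n.+1 = (n.+1%:R + 2 * lambda) * gam n.
Proof.
rewrite /gam pochS factS natrM -!natr1.
have h1 := factr_neq0 n; have h2 : (n%:R + 1 : R) != 0 by rewrite natr1 pnatr_eq0.
by field; rewrite h1 h2.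
Qed.

Lemma gam_gt0 n : 0 < gam n.
Proof. by rewrite divr_gt0 ?poch_gt0 ?ltr0n ?fact_gt0 // ltr_wpDl // mulr_ge0. Qed.

Lemma Phi_le n z : rnorm (Phi n z) <= gam n * rnorm z ^+ n.
Proof.
elim: n => [|n IH]; first by rewrite Phi0 rnorm1 gam0 expr0 mulr1.
rewrite -(@ler_pM2l _ n.+1%:R) ?ltr0n // mulrA gamS.
have <- : rnorm (n.+1%:R * Phi n.+1 z) = n.+1%:R * rnorm (Phi n.+1 z).
  by rewrite rnormM -rc_nat rnormR ger0_norm.
rewrite PhiS (le_trans (rnormD _ _)) // !rnormM !rnormR !rnorm_conj.
rewrite !ger0_norm ?addr_ge0 // exprS.
rewrite -mulrDl -!mulrA (_ : _ + lambda + lambda = n.+1%:R + 2 * lambda); last by ring.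
rewrite ler_wpM2l ?addr_ge0 ?mulr_ge0 //.
have := ler_wpM2l (rnorm_ge0 z) IH; rewrite /gam; lra.
Qed.

Lemma phiE n z : phi lambda n z = (Num.sqrt (gam n)^-1)%:C * Phi n z.
Proof. by rewrite /phi /gam invf_div. Qed.

End PhiRecurrence.

(** * The products phi_n(z) phi_n(w) *)

Section ProductRecurrence.
Variables (R : realType) (lambda : R).
Hypothesis lambda_ge0 : 0 <= lambda.
Implicit Types (z w : R[i]) (n : nat).

Local Notation Phi := (Phi lambda).
Local Notation gam := (gam lambda).

(* [phi n z * phi n w], in which no square root occurs *)
Definition kap z w n : R[i] := (gam n)^-1%:C * (Phi n z * Phi n w).

Lemma kapE z w n : phi lambda n z * phi lambda n w = kap z w n.
Proof.
rewrite !phiE // /kap mulrACA -rcM -expr2 sqr_sqrtr //.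
by rewrite invr_ge0 ltW // gam_gt0.
Qed.

Lemma kap0 z w : kap z w 0 = 1.
Proof. by rewrite /kap !Phi0 gam0 invr1 !mulr1. Qed.

Lemma kap_le z w n : rnorm (kap z w n) <= gam n * rnorm (z * w) ^+ n.
Proof.
have g0 := gam_gt0 lambda_ge0 n.
rewrite /kap !rnormM rnormR ger0_norm ?invr_ge0 ?(ltW g0) //.
rewrite mulrC ler_pdivrMr // exprMn.
have := ler_pM (rnorm_ge0 _) (rnorm_ge0 _) (Phi_le lambda_ge0 n z) (Phi_le lambda_ge0 n w).
by move=> /le_trans; apply; rewrite mulrACA [leRHS]mulrAC.
Qed.

(** Multiply [PhiS] at [z] and at [w]: the two pure products give [z w kap] and its conjugate, the
    two mixed ones combine to a real part at [conj w]. By [gamS], [(n+1) (n+1+2 lambda) / gam (n+1)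
    = (n+1)^2 / gam n]. *)
Lemma kapS z w n : (n.+1%:R * (n.+1%:R + 2 * lambda))%:C * kap z w n.+1 =
  ((n.+1%:R + lambda) ^+ 2)%:C * (z * w * kap z w n)
  + (2 * (n.+1%:R + lambda) * lambda * complex.Re (z * conjc w * kap z (conjc w) n))%:C
  + (lambda ^+ 2)%:C * conjc (z * w * kap z w n).
Proof.
have hz := PhiS lambda_ge0 n z; have hw := PhiS lambda_ge0 n w.
have hg := gamS lambda n; have g0 := gam_gt0 lambda_ge0 n.
have g1 := gam_gt0 lambda_ge0 n.+1.
have hg' : (n.+1%:R * (n.+1%:R + 2 * lambda)) * (gam n.+1)^-1 = (n.+1%:R) ^+ 2 * (gam n)^-1.
  apply: (@mulIf _ (gam n.+1)); first by rewrite gt_eqF.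
  rewrite mulfVK ?gt_eqF // mulrAC expr2 -[_ * _ * gam n.+1]mulrA hg mulrA mulfK ?gt_eqF //.
rewrite {1}/kap mulrA -rcM hg' [(_ / gam n)%:C]rcM.
have -> : (n.+1%:R ^+ 2)%:C * (gam n)^-1%:C * (Phi n.+1 z * Phi n.+1 w) =
  (gam n)^-1%:C * ((n.+1%:R * Phi n.+1 z) * (n.+1%:R * Phi n.+1 w)).
  by rewrite rcX rc_nat; ring.
have -> : (2 * (n.+1%:R + lambda) * lambda * complex.Re (z * conjc w * kap z (conjc w) n))%:C
  = ((n.+1%:R + lambda) * lambda)%:C * (z * conjc w * kap z (conjc w) n
      + conjc (z * conjc w * kap z (conjc w) n)).
  by rewrite addcJ -rc_nat -!rcM; congr (_ %:C); ring.
rewrite hz hw /kap !conjcM PhiJ !conjcK !conjc_real !rcX [((_ + _) * _)%:C]rcM.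
ring.
Qed.

(** With [m = n + 1], [(m + lambda)^2 - m (m + 2 lambda) = lambda^2]; so once [z w kap] is
    subtracted in [kapS], its remaining coefficient equals that of its conjugate and the imaginary
    parts cancel. *)
Lemma kap_diff_real z w n : kap z w n.+1 - z * w * kap z w n =
  (2 * lambda * (lambda * complex.Re (z * w * kap z w n)
    + (n.+1%:R + lambda) * complex.Re (z * conjc w * kap z (conjc w) n))
   / (n.+1%:R * (n.+1%:R + 2 * lambda)))%:C.
Proof.
have m0 : (0 : R) < n.+1%:R by rewrite ltr0n.
set D := n.+1%:R * (n.+1%:R + 2 * lambda).
have D0 : D != 0 by rewrite mulf_neq0 ?gt_eqF // ltr_wpDr // mulr_ge0.
have D0' : D%:C != 0 by rewrite eq_complex /= eqxx andbT.
apply: (mulfI D0'); rewrite mulrBr kapS -[RHS]rcM [D * _]mulrC mulfVK //.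
apply: complex_ext.
  by rewrite !(ReD, ReN, ReZ, Re_conj) /= /D; ring.
by rewrite !(ImD, ImN, ImZ, Im_conj) /= /D; ring.
Qed.

(** The value 1 at index 0 is the increment from a fictitious [kap z w (-1) = 0]; with it the
    generating function of [kap_step] is [1 - t z w] times that of [kap]. *)
Definition kap_step z w n : R :=
  if n is m.+1 then complex.Re (kap z w m.+1 - z * w * kap z w m) else 1.

Lemma kap_stepE z w n : kap z w n.+1 = z * w * kap z w n + (kap_step z w n.+1)%:C.
Proof. by rewrite /kap_step kap_diff_real /= -kap_diff_real subrKC. Qed.

(** On generating functions the factor [n + lambda] becomes [t d/dt + lambda]; this relation between
    the increments at [w] and at [conj w] is the source of [genq_ode]. *)
Lemma kap_step_rec z w n : (n%:R + lambda) * kap_step z w n =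
  lambda * (kap_step z (conjc w) n
    + 2 * if n is m.+1 then complex.Re (z * conjc w * kap z (conjc w) m) else 0).
Proof.
case: n => [|n]; first by rewrite /= !mulr0 !addr0 add0r mulr1.
rewrite /kap_step !kap_diff_real /= conjcK.
move: (complex.Re _) (complex.Re _) => a b.
have m0 : (0 : R) < n.+1%:R by rewrite ltr0n.
move: (n.+1%:R) m0 => m m0.
have h1 : m != 0 by rewrite gt_eqF.
have h2 : m + 2 * lambda != 0 by rewrite gt_eqF // ltr_wpDr // mulr_ge0.
by field; rewrite h1 h2.
Qed.

(** The same relation written out in terms of [kap], the form that is summed against arbitrary
    coefficients in [genW_step]. *)
Lemma kap_rec z w n : (n.+1%:R + lambda)%:C * (kap z w n.+1 - z * w * kap z w n) =
  lambda%:C * (kap z (conjc w) n.+1 + conjc (z * conjc w * kap z (conjc w) n)).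
Proof.
rewrite kap_stepE addrAC subrr add0r -rcM kap_step_rec /=.
rewrite kap_stepE rcM; congr (_ * _).
by rewrite addrAC subrr add0r rcD [RHS]addrAC addcJ addrC rcM rc_nat.
Qed.

End ProductRecurrence.

(** * Series of slow growth *)

Section AbsolutelySummable.
Variable R : realType.
Implicit Types (u v : nat -> R[i]) (b : nat -> R) (c : R[i]).

Definition summable u : Prop := cvgn (series (fun n => rnorm (u n))).

Definition rsum b : R := limn (series b).

Definition csum u : R[i] :=
  rsum (fun n => complex.Re (u n)) +i* rsum (fun n => complex.Im (u n)).

Lemma cvg_series_dominated b (f : nat -> R) :
  (forall n, `|f n| <= b n) -> cvgn (series b) -> cvgn (series f).
Proof.
move=> fb cb; apply: normed_cvg.
apply: (@series_le_cvg _ _ b) cb => // n; first exact: normr_ge0.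
exact: le_trans (fb n).
Qed.

Lemma summable_dominated b u :
  (forall n, rnorm (u n) <= b n) -> cvgn (series b) -> summable u.
Proof.
move=> ub; apply: cvg_series_dominated => n; by rewrite ger0_norm ?rnorm_ge0.
Qed.

Lemma summable_Re u : summable u -> cvgn (series (fun n => complex.Re (u n))).
Proof. by apply: cvg_series_dominated => n; exact: Re_le_rnorm. Qed.

Lemma summable_Im u : summable u -> cvgn (series (fun n => complex.Im (u n))).
Proof. by apply: cvg_series_dominated => n; exact: Im_le_rnorm. Qed.

Lemma rsumD (f g : nat -> R) : cvgn (series f) -> cvgn (series g) ->
  rsum (fun n => f n + g n) = rsum f + rsum g.
Proof. exact: lim_seriesD. Qed.

Lemma rsumZ (k : R) (f : nat -> R) : cvgn (series f) ->
  rsum (fun n => k * f n) = k * rsum f.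
Proof. exact: lim_seriesZ. Qed.

Lemma cvg_seriesZ (k : R) (f : nat -> R) : cvgn (series f) ->
  cvgn (series (fun n => k * f n)).
Proof. exact: is_cvg_seriesZ. Qed.

Lemma cvg_seriesD (f g : nat -> R) : cvgn (series f) -> cvgn (series g) ->
  cvgn (series (fun n => f n + g n)).
Proof. exact: is_cvg_seriesD. Qed.

Lemma le_rsum (f g : nat -> R) : cvgn (series f) -> cvgn (series g) ->
  (forall n, f n <= g n) -> rsum f <= rsum g.
Proof. exact: lim_series_le. Qed.

Lemma seriesS (f : nat -> R) n : series f n.+1 = f 0%N + series (fun n => f n.+1) n.
Proof. by rewrite /series /= big_nat_recl. Qed.

Lemma cvg_series_shift (f : nat -> R) : cvgn (series f) ->
  series (fun n => f n.+1) @ \oo --> rsum f - f 0%N.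
Proof.
move=> cf; have -> : series (fun n => f n.+1) = (fun n => series f n.+1 - f 0%N).
  by apply/funext => n; rewrite seriesS addrC addKr.
by apply: cvgB; [rewrite (cvg_shiftS (series f))|exact: cvg_cst].
Qed.

Lemma cvg_seriesS (f : nat -> R) :
  cvgn (series f) -> cvgn (series (fun n => f n.+1)).
Proof. by move=> /cvg_series_shift; exact: cvgP. Qed.

Lemma rsumS (f : nat -> R) : cvgn (series f) ->
  rsum f = f 0%N + rsum (fun n => f n.+1).
Proof. move=> /cvg_series_shift h.
by rewrite [X in _ + X](cvg_lim _ h) // addrC subrK. Qed.

Lemma summableS u : summable u -> summable (fun n => u n.+1).
Proof. exact: cvg_seriesS. Qed.

Lemma summableD u v : summable u -> summable v -> summable (fun n => u n + v n).
Proof.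
move=> su sv; apply: summable_dominated (cvg_seriesD su sv) => n.
exact: rnormD.
Qed.

Lemma summableZ c u : summable u -> summable (fun n => c * u n).
Proof.
move=> su; apply: summable_dominated (cvg_seriesZ (k := rnorm c) su) => n.
by rewrite rnormM.
Qed.

Lemma summable_conj u : summable u -> summable (fun n => conjc (u n)).
Proof. by apply: summable_dominated => n; rewrite rnorm_conj. Qed.

Lemma csumD u v : summable u -> summable v ->
  csum (fun n => u n + v n) = csum u + csum v.
Proof.
move=> su sv; apply: complex_ext; rewrite /csum /=.
  rewrite -rsumD; [|exact: summable_Re..].
  by congr rsum; apply/funext => n; rewrite ReD.
rewrite -rsumD; [|exact: summable_Im..].
by congr rsum; apply/funext => n; rewrite ImD.
Qed.

Lemma rsumB (f g : nat -> R) : cvgn (series f) -> cvgn (series g) ->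
  rsum (fun n => f n - g n) = rsum f - rsum g.
Proof. exact: lim_seriesB. Qed.

Lemma csumZ c u : summable u -> csum (fun n => c * u n) = c * csum u.
Proof.
move=> su; have sr := summable_Re su; have si := summable_Im su.
apply: complex_ext; [rewrite ReM|rewrite ImM]; rewrite /csum /=.
  rewrite -(rsumZ _ sr) -(rsumZ _ si) -rsumB; [|exact: cvg_seriesZ..].
  by congr rsum; apply/funext => n; rewrite ReM.
rewrite -(rsumZ _ sr) -(rsumZ _ si) -rsumD; [|exact: cvg_seriesZ..].
by congr rsum; apply/funext => n; rewrite ImM.
Qed.

Lemma csum_conj u : summable u -> csum (fun n => conjc (u n)) = conjc (csum u).
Proof.
move=> su; have si := summable_Im su.
apply: complex_ext; [rewrite Re_conj|rewrite Im_conj]; rewrite /csum /=.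
  by congr rsum; apply/funext => n; rewrite Re_conj.
rewrite -mulN1r -rsumZ //.
by congr rsum; apply/funext => n; rewrite Im_conj mulN1r.
Qed.

Lemma csumS u : summable u -> csum u = u 0%N + csum (fun n => u n.+1).
Proof.
move=> su; apply: complex_ext; [rewrite ReD|rewrite ImD]; rewrite /csum /=.
- by rewrite (rsumS (summable_Re su)).
- by rewrite (rsumS (summable_Im su)).
Qed.

Lemma csum_split u N : summable u ->
  csum u = \sum_(n < N) u n + csum (fun n => u (n + N)%N).
Proof.
move=> su; elim: N => [|N IH].
  by rewrite big_ord0 add0r; congr csum; apply/funext => n; rewrite addn0.
have sN M : summable (fun n => u (n + M)%N).
  elim: M => [|M sM]; first by under eq_fun do rewrite addn0.
  by have := summableS sM; congr summable; apply/funext => n; rewrite addnS.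
rewrite IH big_ord_recr /= -addrA; congr (_ + _); rewrite csumS // add0n.
by congr (_ + csum _); apply/funext => n; rewrite addnS.
Qed.

Lemma rsum_ge0 b : (forall n, 0 <= b n) -> cvgn (series b) -> 0 <= rsum b.
Proof.
move=> b0 cb; have -> : 0 = rsum (fun=> 0 : R).
  rewrite /rsum (_ : series _ = cst 0) ?lim_cst //.
  by apply/funext => n; rewrite /series /= big1.
apply: le_rsum => //; rewrite (_ : series _ = cst 0); first exact: is_cvg_cst.
by apply/funext => n; rewrite /series /= big1.
Qed.

Lemma le_norm_rsum (f : nat -> R) b : (forall n, `|f n| <= b n) ->
  cvgn (series b) -> `|rsum f| <= rsum b.
Proof.
move=> fb cb; have cf := cvg_series_dominated fb cb.
have cg : cvgn (series (fun n => -1 * b n)) by exact: cvg_seriesZ.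
rewrite ler_norml -mulN1r -(rsumZ _ cb); apply/andP; split.
  apply: (le_rsum cg cf) => n.
  by have := fb n; rewrite ler_norml mulN1r => /andP[].
apply: (le_rsum cf cb) => n.
by have := fb n; rewrite ler_norml => /andP[].
Qed.

Lemma rnorm_csum_le u b : (forall n, rnorm (u n) <= b n) ->
  cvgn (series b) -> rnorm (csum u) <= 2 * rsum b.
Proof.
move=> ub cb; rewrite (le_trans (rnorm_le_ReIm _)) //= mulrDl mul1r.
by apply: lerD; apply: le_norm_rsum => // n;
  rewrite (le_trans _ (ub n)) // (Re_le_rnorm, Im_le_rnorm).
Qed.

Lemma rsum_tail b : cvgn (series b) ->
  (fun N => rsum (fun n => b (n + N)%N)) @ \oo --> 0.
Proof.
move=> cb.
have cbN N : cvgn (series (fun n => b (n + N)%N)).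
  elim: N => [|M sM]; first by under eq_fun do rewrite addn0.
  by have := cvg_seriesS sM; congr (cvgn (series _)); apply/funext => n; rewrite addnS.
have -> : (fun N => rsum (fun n => b (n + N)%N)) = (fun N => rsum b - series b N).
  apply/funext => N; elim: N => [|N IH].
    rewrite /series /= big_geq // subr0.
    by congr rsum; apply/funext => n; rewrite addn0.
  rewrite seriesSr opprD addrA -IH [X in _ = X - _]rsumS // add0n addrAC subrr add0r.
  by congr rsum; apply/funext => n; rewrite addnS.
by rewrite -(subrr (rsum b)); apply: cvgB; [exact: cvg_cst|].
Qed.

End AbsolutelySummable.

(** * Sequences of polynomial growth *)

Section SlowGrowth.
Variable R : realType.
Implicit Types (g h : nat -> R) (L rho : R).

(** A ratio condition that implies at most polynomial growth; unlike a bound by a power of [n], it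
    can be read off quotients of Pochhammer symbols and passes directly to products and shifts. *)
Definition slow g : Prop := (forall n, 0 <= g n) /\
  exists2 L : R, 0 <= L & forall n, g n.+1 <= (1 + L / n.+1%:R) * g n.

Lemma slowM g h : slow g -> slow h -> slow (fun n => g n * h n).
Proof.
move=> [g0 [L L0 gL]] [h0 [K K0 hK]]; split=> [n|]; first by rewrite mulr_ge0.
exists (L + K + L * K); first by rewrite !addr_ge0 ?mulr_ge0.
move=> n; rewrite (le_trans (ler_pM _ _ (gL n) (hK n))) // mulrACA.
rewrite ler_wpM2r ?mulr_ge0 //.
have m0 : (0 : R) < n.+1%:R by rewrite ltr0n.
have m1 : (n.+1%:R : R)^-1 <= 1 by rewrite invf_le1 // ler1n.
have m2 : (0 : R) < n.+1%:R^-1 by rewrite invr_gt0.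
move: (n.+1%:R^-1) m1 m2 => m m1 m2.
have : L * K * (m * m) <= L * K * m.
  by rewrite ler_wpM2l ?mulr_ge0 // ger_pMr.
lra.
Qed.

(** Consecutive terms [g n * rho ^+ n] have ratio at most [rho (1 + L / (n+1))], hence at most
    [eta], the midpoint of [rho] and 1, from the index [N] on; [C] sums the finitely many earlier
    quotients. *)
Lemma slow_geometric g rho : slow g -> 0 <= rho < 1 ->
  exists2 C : R, 0 <= C &
  exists2 eta : R, 0 <= eta < 1 & forall n, g n * rho ^+ n <= C * eta ^+ n.
Proof.
move=> [g0 [L L0 gL]] /andP[r0 r1].
set eta := (1 + rho) / 2; have eta0 : 0 < eta by rewrite /eta; lra.
pose N := (Num.bound (L * rho / (eta - rho))).
have er : 0 < eta - rho by rewrite /eta; lra.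
have hN : L * rho / (eta - rho) < N%:R.
  by rewrite /N archi_boundP // divr_ge0 ?mulr_ge0 // ltW.
pose C := \sum_(n < N.+1) g n * rho ^+ n / eta ^+ n.
exists C; first by apply: sumr_ge0 => i _; rewrite divr_ge0 ?mulr_ge0 ?exprn_ge0 // ltW.
exists eta; first by rewrite /eta; lra.
move=> n; rewrite -ler_pdivrMr ?exprn_gt0 //.
case: (leqP n N) => [nN|].
  rewrite /C (bigD1 (inord n)) //= inordK // lerDl.
  by apply: sumr_ge0 => i _; rewrite divr_ge0 ?mulr_ge0 ?exprn_ge0 // ltW.
have step m : (N <= m)%N -> g m.+1 * rho ^+ m.+1 / eta ^+ m.+1 <= g m * rho ^+ m / eta ^+ m.
  move=> Nm; rewrite ler_pdivrMr ?exprn_gt0 // exprS [_ ^+ m.+1 in leRHS]exprS.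
  have em : eta ^+ m != 0 by rewrite expf_neq0 // gt_eqF.
  rewrite [leRHS](_ : _ = eta * g m * rho ^+ m); last by field.
  rewrite mulrA ler_wpM2r ?exprn_ge0 // mulrC.
  rewrite (le_trans (ler_wpM2l r0 (gL m))) // mulrA ler_wpM2r //.
  have m0 : (0 : R) < m.+1%:R by rewrite ltr0n.
  rewrite mulrDr mulr1 -lerBrDl mulrA ler_pdivrMr // (mulrC rho).
  by rewrite -ler_pdivrMl // [leLHS]mulrC (le_trans (ltW hN)) // ler_nat ltnW // ltnS.
move=> Nn; have [k ->] : exists k, n = (k + N)%N by exists (n - N)%N; rewrite subnK // ltnW.
elim: k => [|k IH].
  rewrite add0n /C big_ord_recr /= lerDr.
  by apply: sumr_ge0 => i _; rewrite divr_ge0 ?mulr_ge0 ?exprn_ge0 // ltW.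
by rewrite addSn (le_trans (step _ _)) // leq_addl.
Qed.

Lemma slow_cvg g rho : slow g -> 0 <= rho < 1 -> cvgn (series (fun n => g n * rho ^+ n)).
Proof.
move=> sg r01; have [C C0 [eta /andP[e0 e1] h]] := slow_geometric sg r01.
move: sg r01 => [g0 _] /andP[r0 _].
apply: (@series_le_cvg _ _ (geometric C eta)) => [n|n|n|].
- by rewrite mulr_ge0 // exprn_ge0.
- exact: geometric_ge0.
- exact: h.
- by apply: is_cvg_geometric_series; rewrite ger0_norm.
Qed.

Lemma slow_poch (a c : R) : 0 < a -> 0 <= c -> slow (fun n => poch (a + c) n / poch a n).
Proof.
move=> a0 c0; have ac : 0 < a + c by rewrite ltr_pwDl.
split=> [n|]; first by rewrite divr_ge0 ?poch_ge0 // ltW.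
(* The minimum enters through [min a 1 * (n + 1) <= a + n]. *)
exists (c / Num.min a 1); first by rewrite divr_ge0 // le_min !ltW.
move=> n; rewrite !pochS.
have an : 0 < a + n%:R by rewrite ltr_pwDl.
have pn := poch_gt0 n a0; have pc := poch_gt0 n ac.
rewrite invfM mulrACA mulrC (ler_wpM2r (divr_ge0 (ltW pc) (ltW pn))) //.
rewrite ler_pdivrMr // mulrDl mul1r.
set e := Num.min a 1.
have e0 : 0 < e by rewrite lt_min a0 ltr01.
suff h : 1 <= e^-1 / n.+1%:R * (a + n%:R).
  by rewrite addrAC lerD2l; have := ler_wpM2l c0 h; rewrite mulr1 -!mulrA.
rewrite -invfM mulrC ler_pdivlMr ?mulr_gt0 ?ltr0n // mul1r -natr1 mulrDr mulr1 addrC.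
rewrite lerD ?ge_min ?lexx // ler_piMl // ge_min lexx orbT //.
Qed.

Lemma slow_poch_shift (a : R) k : 0 < a -> slow (fun n => poch (a + n%:R) k).
Proof.
move=> a0; split=> [n|]; first by rewrite poch_ge0 // addr_ge0 // ltW.
exists (k%:R / Num.min a 1); first by rewrite divr_ge0 // le_min !ltW.
move=> n.
have an : 0 < a + n%:R by rewrite ltr_pwDl.
have p0 := poch_gt0 k an.
have e : (a + n%:R) * poch (a + n.+1%:R) k = poch (a + n%:R) k * (a + n%:R + k%:R).
  by rewrite -natr1 addrA -pochSl pochS.
rewrite -(ler_pM2l an) e mulrC mulrA ler_wpM2r ?(ltW p0) //.
set m := Num.min a 1.
have e0 : 0 < m by rewrite lt_min a0 ltr01.
suff h : 1 <= m^-1 / n.+1%:R * (a + n%:R).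
  by rewrite [leRHS]mulrC mulrDl mul1r lerD2l; have := ler_wpM2l (ler0n R k) h; rewrite mulr1 -!mulrA.
rewrite -invfM mulrC ler_pdivlMr ?mulr_gt0 ?ltr0n // mul1r -natr1 mulrDr mulr1 addrC.
rewrite lerD ?ge_min ?lexx // ler_piMl // ge_min lexx orbT //.
Qed.

Lemma slow_cst (c : R) : 0 <= c -> slow (fun=> c).
Proof. by move=> c0; split=> //; exists 0 => // n; rewrite mul0r addr0 mul1r. Qed.

Lemma slow_gam lambda : 0 <= lambda -> slow (gam lambda).
Proof.
move=> l0; have := @slow_poch 1 (2 * lambda) ltr01 (mulr_ge0 (ler0n _ 2) l0).
congr slow; apply/funext => n; rewrite /gam [1 + _]addrC; congr (_ / _).
elim: n => [|n IH]; first by rewrite poch0 fact0.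
by rewrite pochS IH factS natrM mulrC -natr1 addrC.
Qed.

End SlowGrowth.

Ltac nonneg := repeat first
  [ assumption | apply: ltW; assumption | exact: ler01 | exact: ler0n
  | exact: sqr_ge0 | apply: exprn_ge0 | rewrite invr_ge0
  | apply: mulr_ge0 | apply: addr_ge0 | exact: powR_ge0 | exact: expR_ge0 | exact: normr_ge0
  | exact: rnorm_ge0 | exact: sqrtr_ge0 ].

(** * Real differential equations for the generating functions *)

Section RealDerivatives.
Variable R : realType.
Implicit Types (f g W dW : R -> R) (x a b c s T df dg : R).

Local Notation isD f x df := (is_derive (x : R) (1 : R) (f : R -> R) (df : R)).

Lemma isD_M f g x df dg : isD f x df -> isD g x dg ->
  isD (fun t => f t * g t) x (df * g x + f x * dg).
Proof.
move=> hf hg; apply: is_derive_eq (is_deriveM hf hg) _.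
by rewrite /GRing.scale /= addrC mulrC [f x * _]mulrC addrC; ring.
Qed.

Lemma isD_D f g x df dg : isD f x df -> isD g x dg -> isD (fun t => f t + g t) x (df + dg).
Proof. by move=> hf hg; exact: is_deriveD. Qed.

Lemma isD_B f g x df dg : isD f x df -> isD g x dg -> isD (fun t => f t - g t) x (df - dg).
Proof. by move=> hf hg; exact: is_deriveB. Qed.

Lemma isD_cst (c : R) x : isD (fun=> c) x 0.
Proof. exact: is_derive_cst. Qed.

Lemma isD_id x : isD id x 1.
Proof. exact: is_derive_id. Qed.

Lemma isD_Z f x df c : isD f x df -> isD (fun t => c * f t) x (c * df).
Proof.
by move=> hf; apply: is_derive_eq (isD_M (isD_cst c x) hf) _; rewrite mul0r add0r.
Qed.

Lemma isD_comp f g x df dg : isD g (f x) dg -> isD f x df ->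
  isD (fun t => g (f t)) x (dg * df).
Proof. by move=> hg hf; apply: is_derive_eq (is_derive1_comp hg hf) _; rewrite mulrC. Qed.

Lemma isD_powR f x df a : 0 < f x -> isD f x df ->
  isD (fun t => f t `^ a) x (a * f x `^ a * df / f x).
Proof.
move=> f0 hf; apply: is_derive_eq (isD_comp (is_derive1_powR a f0) hf) _.
rewrite (@powRB _ (f x) a 1) ?powRr1 ?(ltW f0) ?(gt_eqF f0) ?implybT //.
by rewrite mulrA mulrAC.
Qed.

Lemma isD_ln f x df : 0 < f x -> isD f x df -> isD (fun t => ln (f t)) x (df / f x).
Proof.
move=> f0 hf; apply: is_derive_eq (isD_comp (is_derive1_ln f0) hf) _.
by rewrite mulrC.
Qed.

Lemma isD_expR f x df : isD f x df -> isD (fun t => expR (f t)) x (expR (f x) * df).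
Proof. by move=> hf; exact: isD_comp (is_derive_expR _) hf. Qed.

Lemma isD_cont f x df : isD f x df -> {for x, continuous f}.
Proof. by case=> hf _; apply: differentiable_continuous; exact/derivable1_diffP. Qed.

Lemma isD_within f (df : R -> R) a b : (forall x, a <= x <= b -> isD f x (df x)) ->
  {within `[a, b], continuous f}.
Proof.
move=> h; apply: continuous_in_subspaceT => x; rewrite inE /= in_itv /= => xab.
exact: isD_cont (h _ xab).
Qed.

Lemma isD_le f (df : R -> R) a b : a <= b ->
  (forall x, a <= x <= b -> isD f x (df x)) ->
  (forall x, a < x < b -> 0 <= df x) -> f a <= f b.
Proof.
move=> ab h d0.
have hin x : x \in `]a, b[ -> a <= x <= b by rewrite in_itv /= => /andP[/ltW -> /ltW ->].
apply: (@ger0_derive1_ndecr _ f a b) => //.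
- by move=> x /hin /h [].
- by move=> x xab; have [_ e] := h _ (hin _ xab); rewrite derive1E e d0 // -in_itv.
- exact: isD_within h.
Qed.

Lemma isD_ge f (df : R -> R) a b : a <= b ->
  (forall x, a <= x <= b -> isD f x (df x)) ->
  (forall x, a < x < b -> df x <= 0) -> f b <= f a.
Proof.
move=> ab h d0; rewrite -lerN2.
apply: (@isD_le (fun x => - f x) (fun x => - df x)) => // x xab.
  by have hx := h _ xab; exact: is_deriveN.
by rewrite oppr_ge0 d0.
Qed.

(** Both sides vanish at 0, and the difference has derivative [cosh (x / 2) - 1]. The right-hand
    side is [2 sinh (x / 2)]; this inequality closes the estimate in [KernelSystem_U]. *)
Lemma ler_expR_sinh x : 0 <= x -> x <= expR (x / 2) - expR (- (x / 2)).
Proof.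
move=> x0; rewrite -subr_ge0.
pose f t : R := expR (2^-1 * t) - expR (- 2^-1 * t) - t.
have hE (c : R) t : isD (fun t => expR (c * t)) t (expR (c * t) * (c * 1)).
  by apply: isD_expR; apply: isD_Z; exact: isD_id.
have -> : expR (x / 2) - expR (- (x / 2)) - x = f x by rewrite /f mulNr !(mulrC _ x).
have -> : 0 = f 0 by rewrite /f !mulr0 expR0 !subrr.
apply: (@isD_le f (fun t => expR (2^-1 * t) * (2^-1 * 1) - expR (- 2^-1 * t) * (- 2^-1 * 1) - 1)) => //.
move=> t _; rewrite mulNr expRN.
have e0 := expR_gt0 (2^-1 * t); move: (expR _) e0 => e e0.
suff : 2 <= e + e^-1 by lra.
rewrite -subr_ge0 (_ : _ - _ = (e - 1) ^+ 2 / e); last by field; rewrite gt_eqF.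
by rewrite divr_ge0 ?sqr_ge0 // ltW.
Qed.

(* The weight [t `^ c] compensates the regular singular point at 0. *)
Lemma singular_le W dW c s T : 0 < s <= T ->
  (forall t, 0 <= t <= T -> isD W t (dW t)) ->
  (forall t, 0 < t <= T -> 0 <= c * W t + t * dW t) ->
  s `^ c * W s <= T `^ c * W T.
Proof.
move=> /andP[s0 sT] dh h.
have d2 t : 0 < t <= T -> isD (fun u => u `^ c * W u) t
    ((c * t `^ c * 1 / t) * W t + t `^ c * dW t).
  move=> /andP[t0 tT]; apply: isD_M; last by apply: dh; rewrite ltW.
  exact: isD_powR t0 (isD_id t).
apply: (@isD_le (fun u => u `^ c * W u)
  (fun t => c * t `^ c * 1 / t * W t + t `^ c * dW t) s T sT) => t /andP[st tT].
  by apply: d2; rewrite (lt_le_trans s0 st).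
have t0 := lt_trans s0 st.
rewrite (_ : _ + _ = t `^ c / t * (c * W t + t * dW t)); last by field; rewrite gt_eqF.
by rewrite mulr_ge0 ?divr_ge0 ?powR_ge0 ?h ?t0 ?ltW.
Qed.

Lemma singular_near W (dW0 e : R) T : 0 < T -> isD W 0 dW0 -> 0 < e ->
  exists2 s : R, 0 < s <= Num.min T 1 & `|W 0 - W s| < e.
Proof.
move=> T0 dh e0; have cW := isD_cont dh.
move: cW => /cvgrPdist_lt/(_ _ e0)/nbhs_ballP[d /= d0 hd].
exists (Num.min (d / 2) (Num.min T 1)).
  by rewrite lt_min divr_gt0 //= lt_min T0 ltr01 ge_min lexx orbT.
apply: hd; rewrite /ball /= sub0r normrN gtr0_norm; last first.
  by rewrite lt_min divr_gt0 //= lt_min T0 ltr01.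
by rewrite gt_min; apply/orP; left; rewrite ltr_pdivrMr // ltr_pMr // ltr1n.
Qed.

(** At 0 the weighted function [t^c W] may lose the value of [W], so the comparison starts at a
    small [s] where continuity keeps [W s] positive. *)
Lemma singular_gt0 W dW c T : 0 <= T ->
  (forall t, 0 <= t <= T -> isD W t (dW t)) ->
  (forall t, 0 < t <= T -> 0 <= c * W t + t * dW t) ->
  0 < W 0 -> 0 < W T.
Proof.
rewrite le_eqVlt => /predU1P[<- //|T0] dh h W0.
have d0 : isD W 0 (dW 0) by apply: dh; rewrite lexx ltW.
have [s /andP[s0]] := singular_near T0 d0 W0.
rewrite le_min => /andP[sT _] /ltr_distlBl; rewrite subrr => Ws.
have := @singular_le W dW c s T _ dh h; rewrite s0 sT => /(_ isT).
have p0 : 0 < s `^ c * W s by rewrite mulr_gt0 ?powR_gt0.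
by move=> /(lt_le_trans p0); rewrite pmulr_rgt0 ?powR_gt0.
Qed.

(** With only [0 <= W 0], a nearby point may have [W s < 0]. If [W T < 0], choose [s] with
    [W s > T^c W T]; then [s <= 1] and [c >= 0] give [s^c W s >= W s > T^c W T], against
    monotonicity. *)
Lemma singular_ge0 W dW c T : 0 <= c -> 0 <= T ->
  (forall t, 0 <= t <= T -> isD W t (dW t)) ->
  (forall t, 0 < t <= T -> 0 <= c * W t + t * dW t) ->
  0 <= W 0 -> 0 <= W T.
Proof.
move=> c0; rewrite le_eqVlt => /predU1P[<- //|T0] dh h W0.
rewrite leNgt; apply/negP => WT.
have e0 : 0 < - (T `^ c * W T) by rewrite oppr_gt0 pmulr_rlt0 ?powR_gt0.
have d0 : isD W 0 (dW 0) by apply: dh; rewrite lexx ltW.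
have [s /andP[s0]] := singular_near T0 d0 e0.
rewrite le_min => /andP[sT s1] /ltr_distlBl hs.
have := @singular_le W dW c s T _ dh h; rewrite s0 sT => /(_ isT) hle.
have Ws : T `^ c * W T < W s by lra.
have : W s < 0.
  rewrite ltNge; apply/negP => Ws0.
  have : 0 <= s `^ c * W s by rewrite mulr_ge0 ?powR_ge0.
  lra.
move=> Wn; have : s `^ c * W s >= W s.
  rewrite -[leLHS]mul1r ler_wnM2r ?(ltW Wn) // -(powRr0 s) ger_powR ?s0 //.
lra.
Qed.

End RealDerivatives.

(* In the variable [sigma = (1 + d t^2) / t] and with [u = t^l U], [v = t^l V],
   the system reads [u' = - l v / b], [v' = - l u / a] where [a = D1 / t] and
   [b = D2 / t] differ by a constant; all the monotone quantities below are
   found in these variables. *)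
Section KernelSystem.
Variables (R : realType) (l c1 c2 d : R) (U V dU dV : R -> R).
Let D1 (t : R) : R := 1 - 2 * c1 * t + d * t ^+ 2.
Let D2 (t : R) : R := 1 - 2 * c2 * t + d * t ^+ 2.
Let e (t : R) : R := 1 - d * t ^+ 2.
Hypothesis l_ge0 : 0 <= l.
Hypothesis c21 : c2 <= c1.
Hypothesis d01 : 0 <= d < 1.
Hypothesis D1_gt0 : forall t, 0 <= t <= 1 -> 0 < D1 t.
Hypothesis U0 : U 0 = 1.
Hypothesis V0 : V 0 = 1.
Local Notation isD f x df := (is_derive (x : R) (1 : R) (f : R -> R) (df : R)).
Hypothesis dUE : forall t, 0 <= t <= 1 -> isD U t (dU t).
Hypothesis dVE : forall t, 0 <= t <= 1 -> isD V t (dV t).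
Hypothesis odeU : forall t, 0 <= t <= 1 -> t * dU t = - l * U t + l * (e t / D2 t) * V t.
Hypothesis odeV : forall t, 0 <= t <= 1 -> t * dV t = - l * V t + l * (e t / D1 t) * U t.

Lemma D12 t : 0 <= t <= 1 -> D1 t <= D2 t.
Proof.
move=> /andP[t0 t1]; rewrite /D1 /D2 lerD2r lerD2l lerN2 ler_wpM2r //.
by rewrite ler_wpM2l.
Qed.

Lemma D2_gt0 t : 0 <= t <= 1 -> 0 < D2 t.
Proof. by move=> t01; exact: lt_le_trans (D1_gt0 t01) (D12 t01). Qed.

Lemma e_gt0 t : 0 <= t <= 1 -> 0 < e t.
Proof.
move=> /andP[t0 t1]; rewrite subr_gt0; move: d01 => /andP[d0 d1].
by rewrite (le_lt_trans _ d1) // ler_piMr // exprn_ile1.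
Qed.

Let Dq c t : isD (fun s => 1 - 2 * c * s + d * s ^+ 2) t (- (2 * c) + d * (2 * t)).
Proof.
by apply: is_derive_eq; rewrite /GRing.scale /=; ring.
Qed.

(** [t (U V)' + 2 l U V = l e (V^2 / D2 + U^2 / D1)] is nonnegative before anything is known about
    the signs of [U] and [V]. *)
Lemma UV_gt0 t : 0 <= t <= 1 -> 0 < U t * V t.
Proof.
move=> /andP[t0 t1].
apply: (@singular_gt0 _ (fun t => U t * V t) (fun t => dU t * V t + U t * dV t) (2 * l)) => //.
- move=> s /andP[s0 st]; have s01 : 0 <= s <= 1 by rewrite s0 (le_trans st).
  exact: isD_M (dUE s01) (dVE s01).
- move=> s /andP[s0 st].
  have s01 : 0 <= s <= 1 by rewrite ltW // (le_trans st).
  have h1 := odeU s01; have h2 := odeV s01.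
  have E : s * (dU s * V s + U s * dV s) = (s * dU s) * V s + U s * (s * dV s) by ring.
  rewrite E h1 h2.
  rewrite (_ : _ + _ = l * e s * (V s ^+ 2 / D2 s + U s ^+ 2 / D1 s)); last by ring.
  have := e_gt0 s01; have := D1_gt0 s01; have := D2_gt0 s01 => d2 d1 e0.
  by nonneg.
- by rewrite U0 V0 mulr1 ltr01.
Qed.

(** A zero of [U], provided by the intermediate value theorem, would be a zero of [U V]. *)
Lemma U_gt0 t : 0 <= t <= 1 -> 0 < U t.
Proof.
move=> t01; rewrite ltNge; apply/negP => Ut.
have /andP[t0 t1] := t01.
have cU : {within `[0, t], continuous U}.
  apply: (@isD_within _ U dU) => s /andP[s0 st]; apply: dUE.
  by rewrite s0 (le_trans st).
have [|s] := @IVT R U 0 t 0 t0 cU.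
  by rewrite U0 ge_min Ut orbT le_max ler01.
rewrite in_itv /= => /andP[s0 st] Us.
have := @UV_gt0 s; rewrite s0 (le_trans st) // => /(_ isT).
by rewrite Us mul0r ltxx.
Qed.

Lemma V_gt0 t : 0 <= t <= 1 -> 0 < V t.
Proof. by move=> t01; rewrite -(pmulr_rgt0 _ (U_gt0 t01)) UV_gt0. Qed.

Let dD2 t := - (2 * c2) + d * (2 * t).
Let dD1 t := - (2 * c1) + d * (2 * t).
Let dP a t := a * D2 t `^ a * dD2 t / D2 t.

Let isP a t : 0 <= t <= 1 -> isD (fun s => D2 s `^ a) t (dP a t).
Proof. by move=> t01; exact: isD_powR (D2_gt0 t01) (Dq c2 t). Qed.

Let tdD2 t : t * dD2 t = D2 t - e t.
Proof. rewrite /dD2 /D2 /e; ring. Qed.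
Let tdD1 t : t * dD1 t = D1 t - e t.
Proof. rewrite /dD1 /D1 /e; ring. Qed.

(** In the variables above, [b^(-l) (v - u)] has the derivative [- l b^(-l) u (1/a - 1/b) <= 0] in
    [sigma]. As [sigma] decreases in [t], it grows with [t], and [V - U] vanishes at [t = 0]. *)
Lemma UV_le t : 0 <= t <= 1 -> U t <= V t.
Proof.
move=> t01; have /andP[t0 t1] := t01.
have p0 : 0 < D2 t `^ (- l) by rewrite powR_gt0 // D2_gt0.
rewrite -subr_ge0 -(pmulr_rge0 _ p0).
apply: (@singular_ge0 _ (fun t => D2 t `^ (- l) * (V t - U t))
  (fun t => dP (- l) t * (V t - U t) + D2 t `^ (- l) * (dV t - dU t)) (2 * l)) => //.
- by rewrite mulr_ge0.
- move=> s /andP[s0 st]; have s01 : 0 <= s <= 1 by rewrite s0 (le_trans st).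
  apply: isD_M; first exact: isP.
  exact: isD_B (dVE s01) (dUE s01).
- move=> s /andP[s0 st].
  have s01 : 0 <= s <= 1 by rewrite ltW // (le_trans st).
  have e0 := e_gt0 s01; have d1 := D1_gt0 s01; have d2 := D2_gt0 s01.
  have d12 := D12 s01; have u0 := U_gt0 s01.
  rewrite (_ : _ + _ = D2 s `^ (- l) * (l * e s * U s * ((D1 s)^-1 - (D2 s)^-1))); last first.
    rewrite /dP [s * (_ + _)]mulrDr.
    rewrite (_ : s * (- l * D2 s `^ (- l) * dD2 s / D2 s * (V s - U s)) =
       - l * D2 s `^ (- l) * (s * dD2 s) / D2 s * (V s - U s)); last by ring.
    rewrite (_ : s * (D2 s `^ (- l) * (dV s - dU s)) =
       D2 s `^ (- l) * (s * dV s - s * dU s)); last by ring.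
    rewrite tdD2 odeU // odeV //.
    by field; rewrite !gt_eqF.
  have q0 : 0 <= (D1 s)^-1 - (D2 s)^-1 by rewrite subr_ge0 lef_pV2.
  by nonneg.
- by rewrite U0 V0 subrr mulr0.
Qed.

Let ell t := ln (D2 t) - ln (D1 t).
Let dell t := dD2 t / D2 t - dD1 t / D1 t.
Let isell t : 0 <= t <= 1 -> isD ell t (dell t).
Proof.
move=> t01; apply: isD_B; apply: isD_ln.
- exact: D2_gt0.
- exact: Dq.
- exact: D1_gt0.
- exact: Dq.
Qed.

(** [X = b^l u] and [Z = b^l (v - u)]; in [sigma] they satisfy [X' = - l Z / b] and
    [Z' = 2 l Z / b - l X (1/a - 1/b)]. *)
Let X t := D2 t `^ l * U t.
Let dX t := dP l t * U t + D2 t `^ l * dU t.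
Let Z t := D2 t `^ l * (V t - U t).
Let dZ t := dP l t * (V t - U t) + D2 t `^ l * (dV t - dU t).
Let isX t : 0 <= t <= 1 -> isD X t (dX t).
Proof. by move=> t01; apply: isD_M; [exact: isP|exact: dUE]. Qed.
Let isZ t : 0 <= t <= 1 -> isD Z t (dZ t).
Proof. by move=> t01; apply: isD_M; [exact: isP|apply: isD_B; [exact: dVE|exact: dUE]]. Qed.

Let tdX t : 0 <= t <= 1 -> t * dX t = l * (e t / D2 t) * Z t.
Proof.
move=> t01; have d2 := D2_gt0 t01; rewrite /dX /Z mulrDr.
rewrite (_ : t * (dP l t * U t) = l * D2 t `^ l * (t * dD2 t) / D2 t * U t); last first.
  by rewrite /dP; ring.
rewrite (_ : t * (D2 t `^ l * dU t) = D2 t `^ l * (t * dU t)); last by ring.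
by rewrite tdD2 odeU //; field; rewrite gt_eqF.
Qed.

Let tdZ t : 0 <= t <= 1 ->
  t * dZ t = l * e t * (X t * ((D1 t)^-1 - (D2 t)^-1) - 2 * Z t / D2 t).
Proof.
move=> t01; have d2 := D2_gt0 t01; have d1 := D1_gt0 t01; rewrite /dZ /X /Z mulrDr.
rewrite (_ : t * (dP l t * (V t - U t)) = l * D2 t `^ l * (t * dD2 t) / D2 t * (V t - U t)); last first.
  by rewrite /dP; ring.
rewrite (_ : t * (D2 t `^ l * (dV t - dU t)) = D2 t `^ l * (t * dV t - t * dU t)); last by ring.
by rewrite tdD2 odeU // odeV //; field; rewrite !gt_eqF.
Qed.

Let tdell t : 0 <= t <= 1 -> t * dell t = e t * ((D1 t)^-1 - (D2 t)^-1).
Proof.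
move=> t01; have d2 := D2_gt0 t01; have d1 := D1_gt0 t01.
rewrite /dell mulrBr !mulrA tdD2 tdD1; field; rewrite !gt_eqF //.
Qed.

Let ell_ge0 t : 0 <= t <= 1 -> 0 <= ell t.
Proof. by move=> t01; rewrite subr_ge0 ler_ln ?posrE ?D1_gt0 ?D2_gt0 ?D12. Qed.

Let Z_ge0 t : 0 <= t <= 1 -> 0 <= Z t.
Proof. by move=> t01; rewrite mulr_ge0 ?powR_ge0 // subr_ge0 UV_le. Qed.

Let X_ge0 t : 0 <= t <= 1 -> 0 <= X t.
Proof. by move=> t01; rewrite mulr_ge0 ?powR_ge0 // ltW // U_gt0. Qed.

(** [ell = ln (b / a)] has the derivative [1/b - 1/a] in [sigma], so the terms in [X (1/a - 1/b)]
    cancel in [(l ell X - Z)']; what remains has a sign because [Z >= 0]. *)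
Let ZX t : 0 <= t <= 1 -> Z t <= l * ell t * X t.
Proof.
move=> t01; have /andP[t0 t1] := t01; rewrite -subr_ge0.
pose W t := l * ell t * X t - Z t.
have -> : 0 = W 0.
  rewrite /W /Z /ell /D1 /D2 U0 V0 subrr mulr0 subr0.
  by rewrite !(mulr0, addr0, subr0, expr0n) /= ?(mulr0, addr0, subr0) ln1 subr0 !mulr0 mul0r.
apply: (@isD_le _ W (fun t => l * dell t * X t + l * ell t * dX t - dZ t) 0 t t0).
  move=> s /andP[s0 st]; have s01 : 0 <= s <= 1 by rewrite s0 (le_trans st).
  apply: isD_B (isZ s01); apply: isD_M (isX s01).
  exact: isD_Z (isell s01).
move=> s /andP[s0 st]; have s01 : 0 <= s <= 1 by rewrite (ltW s0) (le_trans (ltW st)).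
rewrite -(pmulr_rge0 _ s0).
rewrite (_ : s * _ = l * (s * dell s) * X s + l * ell s * (s * dX s) - s * dZ s); last by ring.
have e0 := e_gt0 s01; have d2 := D2_gt0 s01.
rewrite tdell // tdX // tdZ //.
rewrite (_ : _ - _ = l * ell s * (l * (e s / D2 s) * Z s) + l * e s * (2 * Z s / D2 s)); last by ring.
have z0 := Z_ge0 s01; have el0 := ell_ge0 s01.
by nonneg.
Qed.

(** By [ZX] the logarithmic growth rate [t X' / X] is at most [l^2 e ell / D2]. The factor
    [exp (2 l^2 h)] with [h = exp (- ell / 2) = sqrt (D1 / D2)] decays at least as fast, which
    amounts to [ell <= 2 sinh (ell / 2)]. Since [h 0 = 1], the constant is [exp (2 l^2)], however
    small [D1] becomes. *)
Lemma KernelSystem_U t : 0 <= t <= 1 -> D2 t `^ l * U t <= expR (2 * l ^+ 2).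
Proof.
move=> t01; have /andP[t0 t1] := t01.
pose h t := expR (- 2^-1 * ell t).
pose G t := X t * expR (2 * l ^+ 2 * h t).
have h0 s : 0 < h s by exact: expR_gt0.
have <- : G 0 = expR (2 * l ^+ 2).
  rewrite /G /h /X /ell /D1 /D2 U0.
  rewrite !(mulr0, addr0, subr0, expr0n) /= ?(mulr0, addr0, subr0) ln1 subr0 !mulr0.
  by rewrite expR0 powR1 !mulr1 mul1r.
have : G t <= G 0.
  pose dh t := expR (- 2^-1 * ell t) * (- 2^-1 * dell t).
  apply: (@isD_ge _ G (fun t => dX t * expR (2 * l ^+ 2 * h t)
     + X t * (expR (2 * l ^+ 2 * h t) * (2 * l ^+ 2 * dh t))) 0 t t0).
    move=> s /andP[s0 st]; have s01 : 0 <= s <= 1 by rewrite s0 (le_trans st).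
    apply: isD_M (isX s01) _; apply: isD_expR; apply: isD_Z; apply: isD_expR.
    exact: isD_Z (isell s01).
  move=> s /andP[s0 st]; have s01 : 0 <= s <= 1 by rewrite (ltW s0) (le_trans (ltW st)).
  rewrite -(pmulr_rle0 _ s0).
  rewrite (_ : s * _ = expR (2 * l ^+ 2 * h s) *
    (s * dX s - l ^+ 2 * h s * X s * (s * dell s))); last by rewrite /dh -/(h s); field.
  rewrite pmulr_rle0 ?expR_gt0 // tdX // tdell // subr_le0.
  have e0 := e_gt0 s01; have d2 := D2_gt0 s01; have d1 := D1_gt0 s01.
  have x0 := X_ge0 s01.
  apply: (@le_trans _ _ (l * (e s / D2 s) * (l * ell s * X s))).
    by rewrite ler_wpM2l ?ZX //; nonneg.
  rewrite (_ : l * _ * _ = l ^+ 2 * X s * e s * (ell s / D2 s)); last by ring.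
  rewrite [leRHS](_ : _ = l ^+ 2 * X s * e s * (h s * ((D1 s)^-1 - (D2 s)^-1))); last by ring.
  apply: ler_wpM2l; first by nonneg.
  rewrite ler_pdivrMr //.
  rewrite (_ : _ * _ * D2 s = h s * (D2 s / D1 s - 1)); last by field; rewrite !gt_eqF.
  have el0 := ell_ge0 s01.
  have -> : D2 s / D1 s = expR (ell s / 2) * expR (ell s / 2).
    by rewrite -expRD -splitr /ell expRB !lnK ?posrE.
  rewrite /h mulNr expRN mulrC (mulrC 2^-1) mulrBl mul1r mulfK ?gt_eqF ?expR_gt0 //.
  by rewrite -expRN ler_expR_sinh.
apply: le_trans; rewrite /G ler_peMr ?X_ge0 // -expR0 ler_expR.
by rewrite !mulr_ge0 ?sqr_ge0 // ltW.
Qed.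

(** [D2^l V = X + Z <= (1 + l ell) X], and the logarithm is absorbed by
    [exp (ell / 2) = sqrt (D2 / D1)]. *)
Lemma KernelSystem_V t : 0 <= t <= 1 ->
  D2 t `^ l * V t <= expR (2 * l ^+ 2) * (1 + l) * Num.sqrt (D2 t / D1 t).
Proof.
move=> t01; have d2 := D2_gt0 t01; have d1 := D1_gt0 t01.
have -> : Num.sqrt (D2 t / D1 t) = expR (ell t / 2).
  have -> : D2 t / D1 t = expR (ell t / 2) ^+ 2.
    rewrite expr2 -expRD -splitr /ell expRB !lnK ?posrE //.
  by rewrite sqrtr_sqr ger0_norm // expR_ge0.
have -> : D2 t `^ l * V t = X t + Z t by rewrite /X /Z; ring.
have hU := KernelSystem_U t01; rewrite -/(X t) in hU.
apply: (@le_trans _ _ (X t * (1 + l * ell t))).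
  by rewrite mulrDr mulr1 lerD2l mulrC ZX.
rewrite -mulrA; apply: ler_pM => //; first exact: X_ge0.
  by rewrite addr_ge0 // mulr_ge0 // ell_ge0.
have el0 := ell_ge0 t01.
have h1 : 1 <= expR (ell t / 2) by rewrite -expR0 ler_expR divr_ge0.
have h2 : ell t <= expR (ell t / 2).
  by rewrite (le_trans (ler_expR_sinh el0)) // gerBl expR_ge0.
rewrite mulrDl mul1r lerD // ler_wpM2l //.
Qed.

End KernelSystem.

(** * Termwise differentiation of power series *)

Section PowerSeries.
Variable R : realType.
Implicit Types (c g : nat -> R) (rho t : R).

Lemma slowS g : slow g -> slow (fun n => g n.+1).
Proof.
move=> [g0 [L L0 gL]]; split=> //; exists L => // n.
rewrite (le_trans (gL _)) // ler_wpM2r // lerD2l ler_wpM2l //.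
by rewrite lef_pV2 ?posrE ?ltr0n // ler_nat.
Qed.

Lemma slow_succ : slow (fun n => n.+1%:R : R).
Proof.
have := @slow_poch_shift R 1 1 ltr01.
congr slow; apply/funext => n; by rewrite pochS poch0 mul1r addr0 nat1r.
Qed.

Lemma diffs_le c g rho : slow g -> 0 <= rho < 1 -> (forall n, `|c n| <= g n * rho ^+ n) ->
  forall n, `|pseries_diffs c n| <= n.+1%:R * g n.+1 * rho ^+ n.
Proof.
move=> [g0 _] /andP[r0 r1] cg n; rewrite /pseries_diffs normrM ger0_norm //.
rewrite -mulrA ler_wpM2l // (le_trans (cg _)) // ler_wpM2l //.
by rewrite exprS ler_piMl ?exprn_ge0 // ltW.
Qed.

Lemma cvg_slow_pseries c g rho K : slow g -> 0 <= rho -> 0 <= K -> rho * K < 1 ->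
  (forall n, `|c n| <= g n * rho ^+ n) -> cvgn (pseries c K).
Proof.
move=> sg r0 K0 rK cg; have rK0 : 0 <= rho * K < 1 by rewrite mulr_ge0.
apply: (cvg_series_dominated _ (slow_cvg sg rK0)) => n.
by rewrite normrM normrX (ger0_norm K0) exprMn mulrA ler_wpM2r ?exprn_ge0.
Qed.

Lemma pseries_derive c g rho t : slow g -> 0 <= rho < 1 ->
  (forall n, `|c n| <= g n * rho ^+ n) -> `|t| <= 1 ->
  is_derive t (1 : R) (fun x : R => rsum (fun n => c n * x ^+ n))
    (rsum (fun n => pseries_diffs c n * t ^+ n)).
Proof.
move=> sg r01 cg t1; have /andP[r0 r1] := r01.
(* [K] exceeds 1 while [rho K < 1]: the series and its first two formal derivatives converge at [K],
   hence beyond the interval of interest. *)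
pose K : R := 2 / (1 + rho).
have K1 : 1 < K by rewrite /K ltr_pdivlMr; lra.
have K0 : 0 <= K by rewrite ltW // (lt_trans ltr01).
have rK : rho * K < 1 by rewrite /K mulrA ltr_pdivrMr; lra.
have sg1 := slowM slow_succ (slowS sg).
have sg2 := slowM slow_succ (slowS sg1).
have cg1 := diffs_le sg r01 cg.
have cg2 := diffs_le sg1 r01 cg1.
apply: (@pseries_snd_diffs _ c K t).
- exact: cvg_slow_pseries sg r0 K0 rK cg.
- exact: cvg_slow_pseries sg1 r0 K0 rK cg1.
- exact: cvg_slow_pseries sg2 r0 K0 rK cg2.
- by rewrite (ger0_norm K0) (le_lt_trans t1).
Qed.

Lemma rsum_diffs c g rho t : slow g -> 0 <= rho < 1 ->
  (forall n, `|c n| <= g n * rho ^+ n) -> 0 <= t <= 1 ->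
  t * rsum (fun n => pseries_diffs c n * t ^+ n) = rsum (fun n => n%:R * c n * t ^+ n).
Proof.
move=> sg r01 cg /andP[t0 t1]; have /andP[r0 r1] := r01.
have sg1 := slowM slow_succ (slowS sg).
have cg1 := diffs_le sg r01 cg.
have rt : rho * t < 1 by rewrite (le_lt_trans _ r1) // ler_piMr.
have h1 := cvg_slow_pseries sg1 r0 t0 rt cg1.
have h2 : cvgn (series (fun n => n%:R * c n * t ^+ n)).
  apply: (@cvg_slow_pseries (fun n => n%:R * c n) _ rho t (slowM slow_succ sg)) => // n.
  by rewrite normrM ger0_norm // -mulrA ler_pM // ler_nat.
rewrite (rsumS h2) mul0r mul0r add0r -(rsumZ _ h1); congr rsum; apply/funext => n.
by rewrite /= /pseries_diffs exprS; ring.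
Qed.

Lemma csum_real (f : nat -> R) : csum (fun n => (f n)%:C) = (rsum f)%:C.
Proof.
apply: complex_ext => //=; rewrite /rsum (_ : series _ = cst 0) ?lim_cst //.
by apply/funext => n; rewrite /series /= big1.
Qed.

End PowerSeries.

(** * The two generating functions and their differential equations *)

Section GeneratingFunctions.
Variables (R : realType) (lambda : R).
Hypothesis lambda_ge0 : 0 <= lambda.
Implicit Types (z w : R[i]) (t : R) (n : nat).

Local Notation kap := (kap lambda).
Local Notation kap_step := (kap_step lambda).
Local Notation gam := (gam lambda).

Definition genK z w t : R[i] := csum (fun n => (t ^+ n)%:C * kap z w n).
(** The real numerator of [genK], which is [genq] divided by [1 - t z w] ([genK_genq]). *)
Definition genq z w t : R := rsum (fun n => kap_step z w n * t ^+ n).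

Lemma rnorm_mul_conj z w : rnorm (z * conjc w) = rnorm (z * w).
Proof. by rewrite !rnormM rnorm_conj. Qed.

Lemma gam_le n : gam n <= gam n.+1.
Proof.
have g0 := ltW (gam_gt0 lambda_ge0 n).
by rewrite -(ler_pM2l (ltr0Sn R n)) gamS ler_wpM2r // lerDl mulr_ge0.
Qed.

Lemma kap_step_le z w n : `|kap_step z w n| <= (2 * gam n) * rnorm (z * w) ^+ n.
Proof.
case: n => [|n]; first by rewrite /= gam0 expr0 normr1; lra.
have gS := gam_le n.
have r0 := rnorm_ge0 (z * w).
rewrite /kap_step (le_trans (Re_le_rnorm _)) // (le_trans (rnormD _ _)) // rnormN.
have h1 := kap_le lambda_ge0 z w n.+1; have h2 := kap_le lambda_ge0 z w n.
rewrite (_ : 2 * gam n.+1 = gam n.+1 + gam n.+1); last by ring.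
rewrite mulrDl lerD // rnormM (le_trans (ler_wpM2l r0 h2)) //.
by rewrite mulrCA -exprS ler_wpM2r ?exprn_ge0.
Qed.

Lemma slow_2gam : slow (fun n => 2 * gam n).
Proof. exact: (slowM (slow_cst (ler0n R 2)) (slow_gam lambda_ge0)). Qed.

Section FixedPoints.
Variables (z w : R[i]).
Hypothesis zw1 : rnorm (z * w) < 1.
Let p := z * w.
Let p' := z * conjc w.
Let rho := rnorm p.

Lemma rho01 : 0 <= rho < 1.
Proof. by rewrite rnorm_ge0. Qed.

Lemma cvg_gam_rho t : 0 <= t <= 1 -> cvgn (series (fun n => gam n * (rho * t) ^+ n)).
Proof.
move=> /andP[t0 t1]; apply: slow_cvg; first exact: slow_gam.
have /andP[r0 r1] := rho01.
by rewrite mulr_ge0 //= (le_lt_trans _ r1) // ler_piMr.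
Qed.

Lemma summable_kap t : 0 <= t <= 1 -> summable (fun n => (t ^+ n)%:C * kap z w n).
Proof.
move=> t01; apply: summable_dominated (cvg_gam_rho t01) => n.
have /andP[t0 _] := t01; have tn : 0 <= t ^+ n by exact: exprn_ge0.
rewrite rnormM rnormR ger0_norm // mulrC exprMn mulrA ler_wpM2r //.
exact: kap_le.
Qed.

Lemma cvg_kap_step t : 0 <= t <= 1 -> cvgn (series (fun n => kap_step z w n * t ^+ n)).
Proof.
move=> /andP[t0 t1]; have /andP[r0 r1] := rho01.
apply: (cvg_slow_pseries slow_2gam r0 t0) (kap_step_le z w).
by rewrite (le_lt_trans _ r1) // ler_piMr.
Qed.

(* [t z w genK] is the generating function of [z w kap (n-1)]. *)
Lemma genK_shift t : 0 <= t <= 1 ->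
  genK z w t = t%:C * p * genK z w t + (genq z w t)%:C.
Proof.
move=> t01; have s0 := summable_kap t01; have c0 := cvg_kap_step t01.
rewrite {1}/genK (csumS s0) kap0 expr0 mulr1.
rewrite /genq (rsumS c0) [kap_step z w 0]/= mul1r expr0 rcD -csum_real addrCA; congr (_ + _).
have s1 : summable (fun n => (kap_step z w n.+1 * t ^+ n.+1)%:C).
  apply: (@summableS _ (fun n => (kap_step z w n * t ^+ n)%:C)).
  apply: summable_dominated (cvg_seriesZ (k := 2) (cvg_gam_rho t01)) => n.
  have /andP[t0 _] := t01.
  rewrite rnormR normrM normrX (ger0_norm t0) exprMn.
  rewrite (_ : 2 * _ = 2 * gam n * rho ^+ n * t ^+ n); last by ring.
  by rewrite ler_wpM2r ?exprn_ge0 //; exact: kap_step_le.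
rewrite -(csumZ _ s0) -csumD //; last exact: summableZ.
congr csum; apply/funext => n.
by rewrite kap_stepE // exprS !rcM /p; ring.
Qed.

Lemma genK_genq t : 0 <= t <= 1 -> (1 - t%:C * p) * genK z w t = (genq z w t)%:C.
Proof.
by move=> t01; rewrite mulrBl mul1r {1}(genK_shift t01) addrAC subrr add0r.
Qed.

Definition dgenq t := rsum (fun n => pseries_diffs (kap_step z w) n * t ^+ n).

Lemma genq_derive t : 0 <= t <= 1 -> is_derive t (1 : R) (genq z w) (dgenq t).
Proof.
move=> /andP[t0 t1]; apply: (pseries_derive slow_2gam rho01 (kap_step_le z w)).
by rewrite ger0_norm.
Qed.

Lemma genq0 : genq z w 0 = 1.
Proof.
rewrite /genq (rsumS (cvg_kap_step _)) ?lexx ?ler01 //= mul1r expr0.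
rewrite /rsum (_ : series _ = cst 0) ?lim_cst ?addr0 //.
by apply/funext => n; rewrite /series /= big1 // => i _; rewrite exprS mul0r mulr0.
Qed.

End FixedPoints.

Lemma sqr_rnorm1B t z : rnorm (1 - t%:C * z) ^+ 2 =
  1 - 2 * complex.Re z * t + rnorm z ^+ 2 * t ^+ 2.
Proof. by rewrite !sqr_rnorm !(ReD, ImD, ReN, ImN, ReZ, ImZ) /=; ring. Qed.

(** Put [p = z conj w] and let [V], [Y] be [genq] and [genK] at [conj w]. Summing [kap_step_rec]
    gives [t q' + lambda q = lambda (V + 2 Re (t p Y))] with [Y = V / (1 - t p)], and
    [1 + 2 Re (t p / (1 - t p))] is the Poisson kernel [(1 - |p|^2 t^2) / |1 - t p|^2]. *)
Lemma genq_ode z w t : rnorm (z * w) < 1 -> 0 <= t <= 1 ->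
  t * dgenq z w t = - lambda * genq z w t
   + lambda * ((1 - rnorm (z * w) ^+ 2 * t ^+ 2) / rnorm (1 - t%:C * (z * conjc w)) ^+ 2)
     * genq z (conjc w) t.
Proof.
move=> zw1 t01.
have zw1' : rnorm (z * conjc w) < 1 by rewrite rnorm_mul_conj.
have /andP[t0 t1] := t01.
have cq := cvg_kap_step zw1 t01; have cq' := cvg_kap_step zw1' t01.
rewrite /dgenq (rsum_diffs slow_2gam (rho01 zw1) (kap_step_le z w) t01).
pose c n : R := if n is m.+1 then complex.Re (z * conjc w * kap z (conjc w) m) else 0.
have sK := summable_kap zw1' t01.
have cs : cvgn (series (fun n => c n * t ^+ n)).
  have /andP[r0 r1] := rho01 zw1.
  apply: (cvg_slow_pseries (slow_gam lambda_ge0) r0 t0).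
    by rewrite (le_lt_trans _ r1) // ler_piMr.
  case=> [|n]; first by rewrite normr0 gam0 mul1r exprn_ge0.
  rewrite /c (le_trans (Re_le_rnorm _)) // rnormM rnorm_mul_conj.
  have := kap_le lambda_ge0 z (conjc w) n; rewrite rnorm_mul_conj => h.
  rewrite (le_trans (ler_wpM2l r0 h)) // exprS mulrCA.
  by rewrite ler_wpM2r ?mulr_ge0 ?exprn_ge0 // gam_le.
have sE : rsum (fun n => c n * t ^+ n) =
    complex.Re (t%:C * (z * conjc w) * genK z (conjc w) t).
  rewrite (rsumS cs) {1}/c mul0r add0r -(csumZ _ sK) /csum /=.
  congr rsum; apply/funext => n; rewrite mulrC -ReZ; congr complex.Re.
  by rewrite exprS !rcM; ring.
have -> : rsum (fun n => n%:R * kap_step z w n * t ^+ n) =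
    - lambda * genq z w t + lambda * (genq z (conjc w) t
      + 2 * complex.Re (t%:C * (z * conjc w) * genK z (conjc w) t)).
  have c1 := cvg_seriesZ (k := 2) cs.
  have c2 := cvg_seriesD cq' c1; have c3 := cvg_seriesZ (k := lambda) c2.
  have c4 := cvg_seriesZ (k := - lambda) cq.
  rewrite -sE -(rsumZ 2 cs) /genq -(rsumD cq' c1) -(rsumZ lambda c2).
  rewrite -(rsumZ (- lambda) cq) -(rsumD c4 c3).
  congr rsum; apply/funext => n.
  have h := kap_step_rec lambda_ge0 z w n; rewrite -/(c n) in h.
  rewrite (_ : n%:R * _ = (n%:R + lambda) * kap_step z w n - lambda * kap_step z w n).
    by rewrite h; ring.
  by ring.
congr (_ + _); rewrite -[RHS]mulrA; congr (_ * _).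
have hY := genK_genq zw1' t01.
set p := z * conjc w in hY *; set Y := genK z (conjc w) t in hY *.
set V := genq z (conjc w) t in hY *.
have D0 : 0 < rnorm (1 - t%:C * p).
  rewrite lt_neqAle rnorm_ge0 eq_sym rnorm_eq0 subr_eq0 andbT.
  apply/eqP => h; have : rnorm (t%:C * p) = 1 by rewrite -h rnorm1.
  rewrite rnormM rnormR ger0_norm // => e1; have /andP[r0 r1] := rho01 zw1'.
  have : t * rnorm p <= rnorm p by rewrite ler_piMl.
  by rewrite e1 leNgt r1.
(* Multiplication by [|1 - t p|^2] clears the denominator, since
   [|1 - t p|^2 Y = V conj (1 - t p)]. *)
have E : rnorm (1 - t%:C * p) ^+ 2 * complex.Re (t%:C * p * Y) =
    V * (t * complex.Re p - t ^+ 2 * rnorm p ^+ 2).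
  rewrite -ReZ sqr_rnormE (_ : _ * _ * _ = V%:C * (t%:C * p * conjc (1 - t%:C * p))).
    rewrite ReZ; congr (_ * _); rewrite sqr_rnorm.
    by case: (p) => a b /=; ring.
  by rewrite -hY; ring.
apply: (@mulfI _ (rnorm (1 - t%:C * p) ^+ 2)); first by rewrite expf_neq0 // gt_eqF.
rewrite [RHS]mulrA [_ * (_ / _)]mulrC mulfVK; last by rewrite expf_neq0 // gt_eqF.
rewrite mulrDr [X in _ + X]mulrCA E sqr_rnorm1B -rnorm_mul_conj -/p.
by ring.
Qed.

Lemma rnorm1B_gt0 t z : rnorm z < 1 -> 0 <= t <= 1 -> 0 < rnorm (1 - t%:C * z).
Proof.
move=> z1 /andP[t0 t1].
rewrite lt_neqAle rnorm_ge0 eq_sym rnorm_eq0 subr_eq0 andbT.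
apply/eqP => h; have : rnorm (t%:C * z) = 1 by rewrite -h rnorm1.
rewrite rnormM rnormR ger0_norm // => e1.
have : t * rnorm z <= rnorm z by rewrite ler_piMl // rnorm_ge0.
by rewrite e1 leNgt z1.
Qed.

Lemma rnorm_quotient z w t : 0 < rnorm z -> 0 <= t -> z * w = t%:C ->
  rnorm w = t / rnorm z.
Proof.
move=> z0 t0 h; apply: (mulfI (lt0r_neq0 z0)).
by rewrite -rnormM h rnormR ger0_norm // mulrCA mulfV ?mulr1 // gt_eqF.
Qed.

Definition Bmax z w t := Num.max (rnorm (1 - t%:C * (z * w))) (rnorm (1 - t%:C * (z * conjc w))).
Definition Bmin z w t := Num.min (rnorm (1 - t%:C * (z * w))) (rnorm (1 - t%:C * (z * conjc w))).

Lemma BmaxJ z w t : Bmax z (conjc w) t = Bmax z w t.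
Proof. by rewrite /Bmax conjcK maxC. Qed.

Lemma BminJ z w t : Bmin z (conjc w) t = Bmin z w t.
Proof. by rewrite /Bmin conjcK minC. Qed.

Definition K0 : R := expR (2 * lambda ^+ 2) * (1 + lambda).

(** The loss [sqrt (D2 / D1) = b2 / b1] in the bound for [V] is exactly what turns the division by
    [b2] into a division by [b1], so both kernels get the same bound. *)
Lemma kernel_bound_arith (u v b1 b2 : R) : 0 < b1 -> b1 <= b2 ->
  (b2 ^+ 2) `^ lambda * u <= expR (2 * lambda ^+ 2) ->
  (b2 ^+ 2) `^ lambda * v <=
    expR (2 * lambda ^+ 2) * (1 + lambda) * Num.sqrt (b2 ^+ 2 / b1 ^+ 2) ->
  u / b1 <= K0 * b2 `^ (- (2 * lambda)) / b1 /\
  v / b2 <= K0 * b2 `^ (- (2 * lambda)) / b1.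
Proof.
move=> p1 b12; have p2 := lt_le_trans p1 b12.
have -> : (b2 ^+ 2) `^ lambda = b2 `^ (2 * lambda).
  by rewrite powRrM powR_mulrn // ltW.
have -> : Num.sqrt (b2 ^+ 2 / b1 ^+ 2) = b2 / b1.
  by rewrite -expr_div_n sqrtr_sqr ger0_norm // divr_ge0 // ltW.
have P0 : 0 < b2 `^ (2 * lambda) by rewrite powR_gt0.
rewrite powRN => hU hV; have l1 : 1 <= 1 + lambda by rewrite lerDl.
split.
  rewrite ler_wpM2r ?invr_ge0 ?(ltW p1) // ler_pdivlMr // mulrC.
  by rewrite (le_trans hU) // /K0 ler_peMr // expR_ge0.
rewrite ler_pdivrMr // [leRHS](_ : _ = K0 * (b2 / b1) / b2 `^ (2 * lambda)); last by ring.
by rewrite ler_pdivlMr // mulrC.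
Qed.

(** The larger real part belongs to the smaller modulus, so the ordering is the [c2 <= c1] of the
    differential system, taken with [d = |z w|^2]. *)
Lemma genK_bound_ordered z w t : rnorm (z * w) < 1 -> 0 <= t <= 1 ->
  complex.Re (z * conjc w) <= complex.Re (z * w) ->
  rnorm (genK z w t) <= K0 * Bmax z w t `^ (- (2 * lambda)) / Bmin z w t /\
  rnorm (genK z (conjc w) t) <= K0 * Bmax z w t `^ (- (2 * lambda)) / Bmin z w t.
Proof.
move=> zw1 t01 cc.
have zw1' : rnorm (z * conjc w) < 1 by rewrite rnorm_mul_conj.
have d01 : 0 <= rnorm (z * w) ^+ 2 < 1 by rewrite exprn_ge0 ?rnorm_ge0 //= exprn_ilt1 ?rnorm_ge0.
have b1 s : 0 <= s <= 1 -> 0 < rnorm (1 - s%:C * (z * w)) by exact: rnorm1B_gt0.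
have b2 s : 0 <= s <= 1 -> 0 < rnorm (1 - s%:C * (z * conjc w)) by exact: rnorm1B_gt0.
have D1p s : 0 <= s <= 1 ->
    0 < 1 - 2 * complex.Re (z * w) * s + rnorm (z * w) ^+ 2 * s ^+ 2.
  by move=> s01; rewrite -sqr_rnorm1B exprn_gt0 // b1.
have O1 s : 0 <= s <= 1 -> s * dgenq z w s = - lambda * genq z w s
   + lambda * ((1 - rnorm (z * w) ^+ 2 * s ^+ 2) / (1 - 2 * complex.Re (z * conjc w) * s
      + rnorm (z * w) ^+ 2 * s ^+ 2)) * genq z (conjc w) s.
  by move=> s01; have := genq_ode zw1 s01; rewrite sqr_rnorm1B rnorm_mul_conj.
have O2 s : 0 <= s <= 1 -> s * dgenq z (conjc w) s = - lambda * genq z (conjc w) s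
   + lambda * ((1 - rnorm (z * w) ^+ 2 * s ^+ 2) / (1 - 2 * complex.Re (z * w) * s
      + rnorm (z * w) ^+ 2 * s ^+ 2)) * genq z w s.
  by move=> s01; have := genq_ode zw1' s01; rewrite conjcK sqr_rnorm1B rnorm_mul_conj.
have hU := KernelSystem_U lambda_ge0 cc d01 D1p (genq0 zw1) (genq0 zw1')
  (genq_derive zw1) (genq_derive zw1') O1 O2 t01.
have hV := KernelSystem_V lambda_ge0 cc d01 D1p (genq0 zw1) (genq0 zw1')
  (genq_derive zw1) (genq_derive zw1') O1 O2 t01.
have U0 := U_gt0 lambda_ge0 cc d01 D1p (genq0 zw1) (genq0 zw1')
  (genq_derive zw1) (genq_derive zw1') O1 O2 t01.
have V0 := V_gt0 lambda_ge0 cc d01 D1p (genq0 zw1) (genq0 zw1')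
  (genq_derive zw1) (genq_derive zw1') O1 O2 t01.
have D12 := D12 (rnorm (z * w) ^+ 2) cc t01.
move: hU hV D12.
rewrite -(sqr_rnorm1B t (z * w)) -(rnorm_mul_conj z w) -(sqr_rnorm1B t (z * conjc w)).
have p1 := b1 _ t01; have p2 := b2 _ t01.
have g1 := genK_genq zw1 t01; have g2 := genK_genq zw1' t01.
rewrite /Bmax /Bmin.
move: (1 - t%:C * (z * w)) p1 g1 => B1 p1 g1.
move: (1 - t%:C * (z * conjc w)) p2 g2 => B2 p2 g2.
have n1 := rnorm_quotient p1 (ltW U0) g1.
have n2 := rnorm_quotient p2 (ltW V0) g2.
move=> hU hV; rewrite ler_pXn2r ?nnegrE ?rnorm_ge0 // => B12.
rewrite (max_idPr B12) (min_idPl B12).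
have [h1 h2] := kernel_bound_arith p1 B12 hU hV.
by split; [rewrite n1; exact: h1|rewrite n2; exact: h2].
Qed.

Lemma genK_bound z w t : rnorm (z * w) < 1 -> 0 <= t <= 1 ->
  rnorm (genK z w t) <= K0 * Bmax z w t `^ (- (2 * lambda)) / Bmin z w t /\
  rnorm (genK z (conjc w) t) <= K0 * Bmax z w t `^ (- (2 * lambda)) / Bmin z w t.
Proof.
move=> zw1 t01.
have [cc|/ltW cc] := leP (complex.Re (z * conjc w)) (complex.Re (z * w)).
  exact: genK_bound_ordered.
have zw1' : rnorm (z * conjc w) < 1 by rewrite rnorm_mul_conj.
have := @genK_bound_ordered z (conjc w) t zw1' t01.
by rewrite BmaxJ BminJ conjcK => /(_ cc)[].
Qed.

End GeneratingFunctions.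

Lemma rcN (R : realType) (x : R) : (- x)%:C = - x%:C :> R[i].
Proof. exact: (raddfN (real_complex R)). Qed.

(** * Kernels with coefficients of integer order *)

Section WeightedGeneratingFunctions.
Variables (R : realType) (lambda : R).
Hypothesis lambda_ge0 : 0 <= lambda.
Implicit Types (z w : R[i]) (t : R) (n i : nat) (g h : nat -> R).

Local Notation kap := (kap lambda).
Local Notation gam := (gam lambda).

Definition genW g z w t : R[i] := csum (fun n => (g n * t ^+ n)%:C * kap z w n).

Lemma cvg_genW_bound g rho t : slow g -> 0 <= rho < 1 -> 0 <= t <= 1 ->
  cvgn (series (fun n => g n * gam n * (rho * t) ^+ n)).
Proof.
move=> sg /andP[r0 r1] /andP[t0 t1]; apply: slow_cvg; first exact: slowM sg (slow_gam lambda_ge0).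
by rewrite mulr_ge0 //= (le_lt_trans _ r1) // ler_piMr.
Qed.

Lemma genW_term_le g z w t n : slow g -> 0 <= t ->
  rnorm ((g n * t ^+ n)%:C * kap z w n) <= g n * gam n * (rnorm (z * w) * t) ^+ n.
Proof.
move=> [g0 _] t0; have gn := g0 n; have tn : 0 <= t ^+ n by exact: exprn_ge0.
rewrite rnormM rnormR ger0_norm ?mulr_ge0 // exprMn.
rewrite (_ : _ * (_ * t ^+ n) = g n * t ^+ n * (gam n * rnorm (z * w) ^+ n)); last by ring.
by rewrite ler_wpM2l ?mulr_ge0 // kap_le.
Qed.

Lemma summable_genW g z w t : slow g -> rnorm (z * w) < 1 -> 0 <= t <= 1 ->
  summable (fun n => (g n * t ^+ n)%:C * kap z w n).
Proof.
move=> sg zw1 t01; have /andP[t0 _] := t01.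
by apply: summable_dominated (cvg_genW_bound sg (rho01 zw1) t01) => n; exact: genW_term_le.
Qed.

Lemma genWD g h (c : R) z w t : slow g -> slow h -> rnorm (z * w) < 1 -> 0 <= t <= 1 ->
  genW (fun n => g n + c * h n) z w t = genW g z w t + c%:C * genW h z w t.
Proof.
move=> sg sh zw1 t01; have s1 := summable_genW sg zw1 t01.
have s2 := summable_genW sh zw1 t01.
rewrite /genW -(csumZ _ s2) -csumD //; last exact: summableZ.
by congr csum; apply/funext => n; rewrite !(rcM, rcD); ring.
Qed.

Lemma slow_lshift (a : R) k : 0 <= a -> slow (fun n => poch (a + 1 + n%:R) k).
Proof. by move=> a0; apply: slow_poch_shift; rewrite ltr_wpDl. Qed.

Lemma slow_succ_add (a : R) : 0 <= a -> slow (fun n => a + 1 + n%:R).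
Proof.
move=> /(slow_lshift 1); congr slow; apply/funext => n.
by rewrite pochS poch0 mul1r addr0.
Qed.

(** [kap_rec] is multiplied by [h (n+1) t^(n+1)] and summed; the terms of index 0 on the two sides
    agree because [kap] is 1 there. *)
Lemma genW_step h z w t : slow h ->
  rnorm (z * w) < 1 -> 0 <= t <= 1 ->
  genW (fun n => (lambda + n%:R) * h n) z w t
  - t%:C * (z * w) * genW (fun n => (lambda + n.+1%:R) * h n.+1) z w t
  = lambda%:C * (genW h z (conjc w) t
      + t%:C * conjc (z * conjc w * genW (fun n => h n.+1) z (conjc w) t)).
Proof.
move=> sh zw1 t01.
have zw1' : rnorm (z * conjc w) < 1 by rewrite rnorm_mul_conj.
have s1 : summable (fun n => ((lambda + n%:R) * h n * t ^+ n)%:C * kap z w n).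
  have := summableD (summable_genW (slowM (slow_succ_add lambda_ge0) sh) zw1 t01)
    (summableZ (c := -1) (summable_genW sh zw1 t01)).
  congr summable; apply/funext => n.
  rewrite (_ : lambda + 1 + n%:R = lambda + n%:R + 1); last by rewrite addrAC.
  by rewrite mulrDl mul1r [in LHS]mulrDl rcD; ring.
have s2 : summable (fun n => ((lambda + n.+1%:R) * h n.+1 * t ^+ n)%:C * kap z w n).
  have := summable_genW (slowM (slow_succ_add lambda_ge0) (slowS sh)) zw1 t01.
  by congr summable; apply/funext => n; rewrite -natr1 (addrC n%:R) addrA.
have s3 := summable_genW sh zw1' t01.
have s4 := summable_genW (slowS sh) zw1' t01.
have s5 := summable_conj (summableZ (c := z * conjc w) s4).
have key : csum (fun n => ((lambda + n.+1%:R) * h n.+1 * t ^+ n.+1)%:C * kap z w n.+1)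
  - t%:C * (z * w) * genW (fun n => (lambda + n.+1%:R) * h n.+1) z w t =
  lambda%:C * (csum (fun n => (h n.+1 * t ^+ n.+1)%:C * kap z (conjc w) n.+1)
    + t%:C * conjc (z * conjc w * genW (fun n => h n.+1) z (conjc w) t)); last first.
  rewrite {1}/genW (csumS s1) [genW h z (conjc w) t]/genW (csumS s3).
  have k0 : ((lambda + 0%:R) * h 0%N * t ^+ 0)%:C * kap z w 0 =
      lambda%:C * ((h 0%N * t ^+ 0)%:C * kap z (conjc w) 0).
    by rewrite (kap0 lambda z w) (kap0 lambda z (conjc w)) addr0 [t ^+ 0]expr0 !mulr1 rcM.
  by rewrite -[LHS]addrA key k0 -mulrDr addrA.
have s6 := summableZ (c := - (t%:C * (z * w))) s2.
have s7 := summableZ (c := t%:C) s5.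
have s8 := summableD (summableS s3) s7.
have E1 := csumD (summableS s1) s6; rewrite (csumZ _ s2) mulNr in E1.
have E2 := csumZ lambda%:C s8.
have E3 := csumD (summableS s3) s7; rewrite (csumZ _ s5) (csum_conj (summableZ s4)) (csumZ _ s4) in E3.
rewrite E3 in E2; apply: (etrans (esym E1)); apply: etrans E2.
congr csum; apply/funext => n.
have E := kap_rec lambda_ge0 z w n.
rewrite exprS (_ : lambda + n.+1%:R = n.+1%:R + lambda); last by rewrite addrC.
move: E; clear; move: (n.+1%:R + lambda) (h n.+1) (t ^+ n) => c k tn.
move: (kap z w n.+1) (kap z w n) (kap z (conjc w) n.+1) (kap z (conjc w) n) => a b a' b'.
rewrite !conjcM !conjc_real !conjcK !rcM => E.
transitivity (k%:C * (t%:C * tn%:C) * (c%:C * (a - z * w * b))); first by ring.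
by rewrite E; ring.
Qed.

Lemma genW_ext g h z w t : g =1 h -> genW g z w t = genW h z w t.
Proof. by move=> gh; congr csum; apply/funext => n; rewrite gh. Qed.

Lemma Bmin_gt0 z w t : rnorm (z * w) < 1 -> 0 <= t <= 1 -> 0 < Bmin z w t.
Proof.
move=> zw1 t01; rewrite lt_min !rnorm1B_gt0 //.
by rewrite rnorm_mul_conj.
Qed.

Lemma Bmin_le2 z w t : rnorm (z * w) < 1 -> 0 <= t <= 1 -> Bmin z w t <= 2.
Proof.
move=> zw1 /andP[t0 t1]; rewrite ge_min; apply/orP; left.
rewrite (le_trans (rnormD _ _)) // rnorm1 rnormN rnormM rnormR ger0_norm //.
have : t * rnorm (z * w) <= 1 by rewrite mulr_ile1 // ?rnorm_ge0 // ltW.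
by lra.
Qed.

Definition Gam z w t := Bmax z w t `^ (- (2 * lambda)) / Bmin z w t.

Lemma GamJ z w t : Gam z (conjc w) t = Gam z w t.
Proof. by rewrite /Gam BmaxJ BminJ. Qed.

(** For [h n = (lambda + 1 + n)_i], both products in [genW_step] are [(lambda + 1 + n)_(i+1)], the
    first up to a multiple of [h]. So [1 - t z w] times the sum of order [i + 1] is expressed by
    sums of order [i], and dividing costs one power of [Bmin]. The shifted sum is carried along
    because the step produces [h (n+1)]. *)
Lemma genW_poch_bound i : exists2 C : R, 0 <= C & forall z w t,
  rnorm (z * w) < 1 -> 0 <= t <= 1 ->
  rnorm (genW (fun n => poch (lambda + 1 + n%:R) i) z w t) <= C * Gam z w t / Bmin z w t ^+ i /\ rnorm (genW (fun n => poch (lambda + 1 + n.+1%:R) i) z w t) <= C * Gam z w t / Bmin z w t ^+ i.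
Proof.
elim: i => [|i [C C0 IH]].
  exists (K0 lambda); first by rewrite mulr_ge0 ?expR_ge0 // addr_ge0.
  move=> z w t zw1 t01; rewrite expr0 divr1 /Gam mulrA.
  have [h _] := genK_bound lambda_ge0 zw1 t01.
  by split; apply: le_trans h; rewrite le_eqVlt; apply/orP; left; apply/eqP;
    congr rnorm; congr csum; apply/funext => n; rewrite poch0 mul1r.
(* The step itself costs [i.+1 + 2 lambda]; isolating [G1] and then shifting it cost [i.+1 * Q]
   each, and [Q <= 2 (Q / m)] because [m <= 2]. *)
exists ((5 * i.+1%:R + 2 * lambda) * C); first by nonneg.
move=> z w t zw1 t01.
have zw1' : rnorm (z * conjc w) < 1 by rewrite rnorm_mul_conj.
have m0 := Bmin_gt0 zw1 t01; have m2 := Bmin_le2 zw1 t01.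
have [hS hS'] := IH z w t zw1 t01.
have := IH z (conjc w) t zw1' t01; rewrite GamJ BminJ => -[hT hT'].
have B1m : Bmin z w t <= rnorm (1 - t%:C * (z * w)) by rewrite ge_min lexx.
have sg := slow_lshift i lambda_ge0.
have st := genW_step sg zw1 t01.
have sS := slow_lshift i.+1 lambda_ge0.
have E1 : genW (fun n => (lambda + n.+1%:R) * poch (lambda + 1 + n.+1%:R) i) z w t =
    genW (fun n => poch (lambda + 1 + n%:R) i.+1) z w t.
  apply: genW_ext => n; rewrite pochSl.
  rewrite (_ : lambda + 1 + n%:R = lambda + n.+1%:R); last by rewrite -natr1; ring.
  by rewrite (_ : lambda + 1 + n.+1%:R = lambda + n.+1%:R + 1) //; ring.
have E2 : genW (fun n => (lambda + n%:R) * poch (lambda + 1 + n%:R) i) z w t =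
    genW (fun n => poch (lambda + 1 + n%:R) i.+1) z w t
    + (- i.+1%:R)%:C * genW (fun n => poch (lambda + 1 + n%:R) i) z w t.
  rewrite -genWD //; apply: genW_ext => n; rewrite pochS.
  by rewrite -natr1; ring.
have E3 : genW (fun n => poch (lambda + 1 + n.+1%:R) i.+1) z w t =
    genW (fun n => poch (lambda + 1 + n%:R) i.+1) z w t
    + i.+1%:R%:C * genW (fun n => poch (lambda + 1 + n.+1%:R) i) z w t.
  rewrite -genWD //; last exact: slowS sg.
  apply: genW_ext => n; rewrite pochS [poch (lambda + 1 + n%:R) i.+1]pochSl.
  rewrite (_ : lambda + 1 + n%:R + 1 = lambda + 1 + n.+1%:R); last by rewrite -natr1; ring.
  by rewrite -!natr1; ring.
rewrite E1 E2 in st; rewrite E3; clear E1 E2 E3 IH sg sS.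
set G1 := genW (fun n => poch (lambda + 1 + n%:R) i.+1) z w t in st *.
set Gh := genW (fun n => poch (lambda + 1 + n%:R) i) z w t in st hS.
set Gh' := genW (fun n => poch (lambda + 1 + n.+1%:R) i) z w t in hS' *.
set Hh := genW (fun n => poch (lambda + 1 + n%:R) i) z (conjc w) t in st hT.
set Hh' := genW (fun n => poch (lambda + 1 + n.+1%:R) i) z (conjc w) t in st hT'.
set m := Bmin z w t in m0 m2 B1m hS hS' hT hT' *.
set Q := C * Gam z w t / m ^+ i in hS hS' hT hT'.
have Q0 : 0 <= Q by exact: le_trans (rnorm_ge0 _) hS.
clearbody G1 Gh Gh' Hh Hh'.
have ub (a x : R) : a <= 1 -> 0 <= x -> x <= Q -> a * x <= Q.
  by move=> a1 x0 xQ; rewrite (le_trans _ xQ) // ler_piMl.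
rewrite (_ : (5 * i.+1%:R + 2 * lambda) * C * Gam z w t / m ^+ i.+1
  = (5 * i.+1%:R + 2 * lambda) * (Q / m)); last first.
  by rewrite /Q exprS; field; rewrite gt_eqF //= expf_neq0 // gt_eqF.
have st' : (1 - t%:C * (z * w)) * (G1 + (- i.+1%:R)%:C * Gh) =
    i.+1%:R%:C * (t%:C * (z * w) * Gh) + lambda%:C * (Hh + t%:C * conjc (z * conjc w * Hh')).
  rewrite -st; rewrite rcN.
  by ring.
have tp (u : R[i]) : rnorm u < 1 -> t * rnorm u <= 1.
  by move=> u1; have /andP[t0 t1] := t01; rewrite mulr_ile1 ?rnorm_ge0 // ltW.
have Qm : Q <= 2 * (Q / m).
  by rewrite mulrA ler_pdivlMr // mulrC ler_wpM2r.
have h1 : rnorm (G1 + (- i.+1%:R)%:C * Gh) <= (i.+1%:R + 2 * lambda) * (Q / m).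
  rewrite mulrA ler_pdivlMr // mulrC.
  apply: (@le_trans _ _ (rnorm (1 - t%:C * (z * w)) * rnorm (G1 + (- i.+1%:R)%:C * Gh))).
    by rewrite ler_wpM2r ?rnorm_ge0.
  rewrite -rnormM st' (le_trans (rnormD _ _)) // mulrDl lerD //.
    rewrite rnormM rnormR ger0_norm // ler_wpM2l // rnormM.
    apply: ub hS; rewrite ?rnorm_ge0 // rnormM rnormR ger0_norm; first exact: tp.
    by case/andP: t01.
  rewrite rnormM rnormR ger0_norm // [leRHS](_ : _ = lambda * (2 * Q)); last by ring.
  rewrite ler_wpM2l //.
  rewrite (le_trans (rnormD _ _)) // (_ : 2 * Q = Q + Q); last by ring.
  apply: lerD hT _; rewrite rnormM rnormR rnorm_conj rnormM mulrA.
  apply: ub hT'; rewrite ?rnorm_ge0 // ger0_norm; first exact: tp.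
  by case/andP: t01.
have h2 : rnorm G1 <= (3 * i.+1%:R + 2 * lambda) * (Q / m).
  rewrite -[G1](addrK ((- i.+1%:R)%:C * Gh)) (le_trans (rnormD _ _)) // rnormN.
  rewrite [rnorm (_ * Gh)]rnormM rnormR normrN ger0_norm //.
  have := ler_wpM2l (ler0n R i.+1) hS; have := ler_wpM2l (ler0n R i.+1) Qm.
  by move: h1; lra.
split.
  have : 0 <= 2 * i.+1%:R * (Q / m) by nonneg.
  by move: h2; lra.
rewrite (le_trans (rnormD _ _)) // [rnorm (_ * Gh')]rnormM rnormR ger0_norm //.
have := ler_wpM2l (ler0n R i.+1) hS'; have := ler_wpM2l (ler0n R i.+1) Qm.
by move: h2; lra.
Qed.

End WeightedGeneratingFunctions.

(** * Beta averages and the kernel estimate *)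

Section BetaAverages.
Variable R : realType.
Implicit Types (f g F : R -> R) (x y t : R) (n : nat).
Local Notation isD f x df := (is_derive (x : R) (1 : R) (f : R -> R) (df : R)).
Local Notation mu := (@lebesgue_measure R).

Definition cont01 f : Prop := {within `[0%R, 1%R], continuous f}.
Definition int01 f : R := \int[mu]_(t in `[0%R, 1%R]) f t.

Lemma cont01M f g : cont01 f -> cont01 g -> cont01 (fun t => f t * g t).
Proof. by move=> cf cg x; apply: cvgM; [exact: cf|exact: cg]. Qed.

Lemma cont01D f g : cont01 f -> cont01 g -> cont01 (fun t => f t + g t).
Proof. by move=> cf cg x; apply: cvgD; [exact: cf|exact: cg]. Qed.

Lemma cont01_cst c : cont01 (fun=> c).
Proof. by move=> x; exact: cvg_cst. Qed.

Lemma cont01_norm f : cont01 f -> cont01 (fun t => `|f t|).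
Proof. by move=> cf x; apply: cvg_norm; exact: cf. Qed.

Lemma cont01_X n : cont01 (fun t => t ^+ n).
Proof. by apply: continuous_subspaceT => x; exact: exprn_continuous. Qed.

Lemma cont01_sum N (F : nat -> R -> R) : (forall n, cont01 (F n)) ->
  cont01 (fun t => \sum_(n < N) F n t).
Proof.
move=> cF; elim: N => [|N IH].
  rewrite (_ : (fun t => _) = fun=> 0); first exact: cont01_cst.
  by apply/funext => t; rewrite big_ord0.
rewrite (_ : (fun t => _) = fun t => \sum_(n < N) F n t + F N t); first exact: cont01D.
by apply/funext => t; rewrite big_ord_recr.
Qed.

Lemma cont01_integrable f : cont01 f -> mu.-integrable `[0%R, 1%R] (EFin \o f).
Proof. by move=> cf; apply: continuous_compact_integrable => //; exact: segment_compact. Qed.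

Lemma int01D f g : cont01 f -> cont01 g -> int01 (fun t => f t + g t) = int01 f + int01 g.
Proof. by move=> cf cg; apply: RintegralD => //; exact: cont01_integrable. Qed.

Lemma int01Z c f : cont01 f -> int01 (fun t => c * f t) = c * int01 f.
Proof. by move=> cf; apply: RintegralZl => //; exact: cont01_integrable. Qed.

Lemma le_int01 f g : cont01 f -> cont01 g -> (forall t, 0 <= t <= 1 -> f t <= g t) ->
  int01 f <= int01 g.
Proof.
move=> cf cg fg; apply: le_Rintegral => //; try exact: cont01_integrable.
Qed.

Lemma int01_sum N (F : nat -> R -> R) : (forall n, cont01 (F n)) ->
  int01 (fun t => \sum_(n < N) F n t) = \sum_(n < N) int01 (F n).
Proof.
move=> cF; elim: N => [|N IH].
  rewrite big_ord0 (_ : (fun t => _) = fun=> 0 * 0); first by rewrite int01Z ?mul0r //; exact: cont01_cst.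
  by apply/funext => t; rewrite big_ord0 mul0r.
rewrite big_ord_recr /= -IH -int01D //; last exact: cont01_sum.
by congr int01; apply/funext => t; rewrite big_ord_recr.
Qed.

Lemma int01_FTC f F : cont01 f -> derivable_oo_LRcontinuous F 0 1 ->
  (forall t, 0 < t < 1 -> isD F t (f t)) -> int01 f = F 1 - F 0.
Proof.
move=> cf dF h; rewrite /int01 /Rintegral (continuous_FTC2 ltr01 cf dF) //.
by move=> t; rewrite in_itv /= => /h [_ <-]; rewrite derive1E.
Qed.

Lemma int01_isD f F : cont01 f -> (forall t, 0 <= t <= 1 -> isD F t (f t)) ->
  int01 f = F 1 - F 0.
Proof.
move=> cf h; apply: int01_FTC => //; last first.
  by move=> t /andP[t0 t1]; apply: h; rewrite !ltW.
have := @isD_within _ F f 0 1 h; rewrite continuous_within_itvP ?ltr01 // => -[_ h0 h1].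
split=> // t; rewrite in_itv /= => /andP[t0 t1].
have t01 : 0 <= t <= 1 by rewrite !ltW.
by case: (h t t01).
Qed.

Definition bump x y t : R := t `^ x * (1 - t) `^ y.

Let onem_near0 y : (1 - t) `^ y @[t --> (0:R)^'+] --> (1 - 0) `^ y.
Proof.
apply: cvg_at_right_filter.
have p0 : 0 < 1 - 0 :> R by rewrite subr0.
have h := @isD_powR _ (fun t => 1 - t) 0 _ y p0 (isD_B (isD_cst 1 0) (isD_id 0)).
exact: (@isD_cont _ (fun t => (1 - t) `^ y) _ _ h).
Qed.

Let pow_near1 x : t `^ x @[t --> (1:R)^'-] --> 1 `^ x.
Proof.
apply: cvg_at_left_filter.
have h := @isD_powR _ id 1 _ x ltr01 (isD_id 1).
exact: (@isD_cont _ (fun t => t `^ x) _ _ h).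
Qed.

Let pow_near0 x : 0 <= x -> t `^ x @[t --> (0:R)^'+] --> 0 `^ x.
Proof.
rewrite le_eqVlt => /predU1P[<-|x0].
  rewrite powRr0 (_ : (fun t => _) = fun=> 1); first exact: cvg_cst.
  by apply/funext => t; rewrite powRr0.
by rewrite powR0 ?gt_eqF //; exact: powR_cvg0.
Qed.

Let onem_near1 y : 0 <= y -> (1 - t) `^ y @[t --> (1:R)^'-] --> (1 - 1) `^ y.
Proof.
rewrite subrr le_eqVlt => /predU1P[<-|y0].
  rewrite powRr0 (_ : (fun t => _) = fun=> 1); first exact: cvg_cst.
  by apply/funext => t; rewrite powRr0.
rewrite powR0 ?gt_eqF //.
apply: (@cvg_comp _ _ _ (fun t : R => 1 - t) (fun t => t `^ y) _ 0^'+); last exact: powR_cvg0.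
move=> A /nbhs_ballP[e /= e0 hA]; apply/nbhs_ballP; exists e => //= t ht t1.
apply: hA; last by rewrite /= subr_gt0.
by move: ht; rewrite /ball /= sub0r normrN.
Qed.

Lemma bump_derive x y t : 0 < t < 1 ->
  isD (bump x y) t (bump (x - 1) (y - 1) t * (x * (1 - t) - y * t)).
Proof.
move=> /andP[t0 t1]; have s0 : 0 < 1 - t by rewrite subr_gt0.
have h := isD_M (@isD_powR _ id t _ x t0 (isD_id t))
  (@isD_powR _ (fun t => 1 - t) t _ y s0 (isD_B (isD_cst 1 t) (isD_id t))).
apply: is_derive_eq h _.
rewrite /bump !powRB ?(gt_eqF t0) ?(gt_eqF s0) ?implybT // !powRr1 ?ltW //.
by field; rewrite !gt_eqF.
Qed.

Lemma bump_LR x y : 0 <= x -> 0 <= y -> derivable_oo_LRcontinuous (bump x y) 0 1.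
Proof.
move=> x0 y0; split.
- by move=> t; rewrite in_itv /= => /(bump_derive x y) [].
- by apply: cvgM; [exact: pow_near0|exact: onem_near0].
- by apply: cvgM; [exact: pow_near1|exact: onem_near1].
Qed.

Lemma bump_cont x y : 0 <= x -> 0 <= y -> cont01 (bump x y).
Proof.
move=> x0 y0; have [_ h0 h1] := bump_LR x0 y0.
apply/continuous_within_itvP; rewrite ?ltr01 //; split=> //.
move=> t; rewrite in_itv /= => t01; exact: isD_cont (bump_derive x y t01).
Qed.

Lemma powR_gt0_cont01 (F : R -> R) x (dF : R -> R) : (forall t, 0 <= t <= 1 -> 0 < F t) ->
  (forall t, 0 <= t <= 1 -> isD F t (dF t)) -> cont01 (fun t => F t `^ x).
Proof.
move=> F0 dFE; apply: (@isD_within _ _ (fun t => x * F t `^ x * dF t / F t)) => t t01.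
exact: isD_powR (F0 t t01) (dFE t t01).
Qed.

Lemma bump_ge0 x y t : 0 <= bump x y t.
Proof. by rewrite mulr_ge0 // powR_ge0. Qed.

Lemma bump_expn x y t n : 0 <= x -> 0 <= t -> t ^+ n * bump x y t = bump (x + n%:R) y t.
Proof.
move=> x0; rewrite le_eqVlt => /predU1P[<-|t0]; rewrite /bump mulrA; congr (_ * _); last first.
  by rewrite -powR_mulrn ?(ltW t0) // -powRD 1?addrC // (gt_eqF t0) implybT.
case: n => [|n]; first by rewrite expr0 mul1r addr0.
by rewrite expr0n /= mul0r powR0 // gt_eqF // ltr_wpDl // ltr0n.
Qed.

(** [Bet x y] is Euler's [B (x + 1, y + 1)]. *)
Definition Bet x y : R := int01 (bump x y).

(** A multiple of the parabola [t - t^2 - 1/8] lies below the integrand: where it is positive, [t]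
    and [1 - t] are at least 1/8, so the integrand is at least [c]. Its integral over the interval
    is still positive. *)
Lemma Bet_gt0 x y : 0 <= x -> 0 <= y -> 0 < Bet x y.
Proof.
move=> x0 y0.
pose c : R := 8^-1 `^ x * 8^-1 `^ y.
have c0 : 0 < c by rewrite mulr_gt0 // powR_gt0.
pose p t : R := 8 * c * (t - t ^+ 2 - 8^-1).
have cp : cont01 p.
  apply: (@isD_within _ p (fun t => 8 * c * (1 - 2 * t))) => t _.
  by apply: is_derive_eq; rewrite /GRing.scale /=; ring.
have pE : int01 p = c / 3.
  pose F t : R := 8 * c * (t ^+ 2 / 2 - t ^+ 3 / 3 - t / 8).
  have h t : 0 <= t <= 1 -> isD F t (p t).
    by move=> _; apply: is_derive_eq; rewrite /GRing.scale /= /p; field.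
  by rewrite (int01_isD cp h) /F; field.
apply: (@lt_le_trans _ _ (int01 p)); first by rewrite pE divr_gt0.
apply: le_int01 => // [|t /andP[t0 t1]]; first exact: bump_cont.
have [h|h] := lerP (t - t ^+ 2 - 8^-1) 0.
  by rewrite (le_trans _ (bump_ge0 _ _ _)) // /p mulr_ge0_le0 // mulr_ge0 // ltW.
have h1 : 8^-1 <= t by nra.
have h2 : 8^-1 <= 1 - t by nra.
apply: (@le_trans _ _ c).
  rewrite /p mulrAC ger_pMl // -ler_pdivlMl // mulr1.
  have : 0 <= (t - 2^-1) ^+ 2 by exact: sqr_ge0.
  by lra.
rewrite /bump ler_pM ?powR_ge0 //; apply: ge0_ler_powR => //; rewrite nnegrE //.
by rewrite subr_ge0.
Qed.

(** [bump x y] vanishes at both ends, and its derivative is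
    [x bump (x-1) (y-1) - (x+y) bump x (y-1)]. *)
Lemma Bet_rec x y : 1 <= x -> 1 <= y -> (x + y) * Bet x (y - 1) = x * Bet (x - 1) (y - 1).
Proof.
move=> x1 y1; have x0 : 0 <= x - 1 by rewrite subr_ge0.
have y0 : 0 <= y - 1 by rewrite subr_ge0.
have xx : 0 <= x by rewrite (le_trans ler01).
have yy : 0 <= y by rewrite (le_trans ler01).
have c1 := bump_cont x0 y0; have c2 := bump_cont xx y0.
have e t : 0 <= t -> bump x (y - 1) t = t * bump (x - 1) (y - 1) t.
  by move=> t0; rewrite -{2}(expr1 t) bump_expn // subrK.
pose f t := x * bump (x - 1) (y - 1) t + - (x + y) * bump x (y - 1) t.
have cf : cont01 f by apply: cont01D; apply: cont01M => //; exact: cont01_cst.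
have : int01 f = 0.
  have h t : 0 < t < 1 -> isD (bump x y) t (f t).
    move=> t01; apply: is_derive_eq (bump_derive x y t01) _.
    rewrite /f e; first by ring.
    by case/andP: t01 => /ltW.
  rewrite (int01_FTC cf (bump_LR xx yy) h).
  by rewrite /bump subrr subr0 !powR0 ?mul0r ?mulr0 ?subrr // gt_eqF // (lt_le_trans ltr01).
rewrite /f int01D ?int01Z // => [h||].
- by apply/eqP; rewrite -subr_eq0 -/(Bet _ _) -opprB oppr_eq0 -h /Bet; apply/eqP; ring.
- by apply: cont01M => //; exact: cont01_cst.
- by apply: cont01M => //; exact: cont01_cst.
Qed.

Lemma Bet_moment a b n : 1 <= a -> 1 <= b ->
  Bet (a - 1 + n%:R) (b - 1) = poch a n / poch (a + b) n * Bet (a - 1) (b - 1).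
Proof.
move=> a1 b1; have a0 : 0 < a by exact: lt_le_trans ltr01 a1.
have ab0 : 0 < a + b by rewrite ltr_wpDr // (le_trans ler01).
elim: n => [|n IH]; first by rewrite !poch0 divr1 mul1r addr0.
have := @Bet_rec (a + n%:R) b _ b1; rewrite ler_wpDr // => /(_ isT).
rewrite (_ : a + n%:R - 1 = a - 1 + n%:R); last by ring.
rewrite (_ : a - 1 + n.+1%:R = a + n%:R); last by rewrite -natr1; ring.
rewrite IH !pochS => h.
have an0 : 0 < a + b + n%:R by rewrite ltr_wpDr.
apply: (@mulfI _ (a + b + n%:R)); first by rewrite gt_eqF.
rewrite (_ : a + b + n%:R = a + n%:R + b); last by ring.
rewrite h (_ : a + b + n%:R = a + n%:R + b) in an0 *; last by ring.
field.
by rewrite !gt_eqF // ?poch_gt0.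
Qed.

(** The sum is the average of the polynomial [sum v n t^n] against the normalised weight
    [bump (a-1) (b-1)], by [Bet_moment]. With [t^(a-1) <= 1] and [(1-t)^(b-1) <= (m + 1 - t)^(b-1)]
    the integrand gets an explicit primitive, and [b < N0] leaves a negative power of [m]. The
    normalisation lets the error [e] pass unchanged. *)
Lemma beta_average_bound a b N0 K m e N (v : nat -> R) : 1 <= a -> 1 <= b -> b < N0 ->
  0 < m -> 0 <= K ->
  (forall t, 0 <= t <= 1 -> `|\sum_(n < N) v n * t ^+ n| <= K * (m + (1 - t)) `^ (- N0) + e) ->
  `|\sum_(n < N) v n * (poch a n / poch (a + b) n)| <=
    K * (m `^ (b - N0) / (N0 - b)) / Bet (a - 1) (b - 1) + e.
Proof.
move=> a1 b1 bN m0 K0 hv.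
have a0 : 0 <= a - 1 by rewrite subr_ge0.
have b0 : 0 <= b - 1 by rewrite subr_ge0.
have B0 := Bet_gt0 a0 b0; have cb := bump_cont a0 b0.
set S := \sum_(n < N) _.
have cX n : cont01 (fun t => v n * t ^+ n * bump (a - 1) (b - 1) t).
  by apply: cont01M => //; apply: cont01M; [exact: cont01_cst|exact: cont01_X].
have SE : S * Bet (a - 1) (b - 1) =
    int01 (fun t => \sum_(n < N) (v n * t ^+ n * bump (a - 1) (b - 1) t)).
  rewrite (int01_sum N cX) mulr_suml; apply: eq_bigr => i _.
  rewrite -mulrA -Bet_moment // /Bet -int01Z; last by apply: bump_cont => //; rewrite addr_ge0.
  apply: eq_Rintegral => t; rewrite inE /= in_itv /= => /andP[t0 _].
  by rewrite -bump_expn // mulrA.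
pose g t := K * (m + (1 - t)) `^ (b - 1 - N0) + e * bump (a - 1) (b - 1) t.
have pos t : 0 <= t <= 1 -> 0 < m + (1 - t) by move=> /andP[_ t1]; rewrite ltr_wpDr // subr_ge0.
have dpos t : 0 <= t <= 1 -> isD (fun t => m + (1 - t)) t (0 + (0 - 1)).
  by move=> _; exact: isD_D (isD_cst m t) (isD_B (isD_cst 1 t) (isD_id t)).
have cg1 : cont01 (fun t => (m + (1 - t)) `^ (b - 1 - N0)) by exact: powR_gt0_cont01 pos dpos.
have cg : cont01 g.
  by apply: cont01D; apply: cont01M => //; exact: cont01_cst.
have cS : cont01 (fun t => \sum_(n < N) (v n * t ^+ n * bump (a - 1) (b - 1) t)).
  exact: (@cont01_sum N (fun n t => v n * t ^+ n * bump (a - 1) (b - 1) t) cX).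
have bound : `|S * Bet (a - 1) (b - 1)| <= int01 g.
  rewrite SE (le_trans (le_normr_Rintegral _ _)) //; first exact: cont01_integrable.
  apply: le_int01 => //; first exact: cont01_norm.
  move=> t t01; rewrite -mulr_suml normrM [`|bump _ _ _|]ger0_norm ?bump_ge0 //.
  apply: (le_trans (ler_wpM2r (bump_ge0 _ _ _) (hv t t01))).
  rewrite mulrDl /g lerD2r -mulrA ler_wpM2l // /bump.
  have p0 := pos t t01; have /andP[t0 t1] := t01.
  rewrite (_ : b - 1 - N0 = (- N0) + (b - 1)); last by ring.
  rewrite [leRHS]powRD ?(gt_eqF p0) ?implybT // ler_wpM2l ?powR_ge0 //.
  apply: (@le_trans _ _ (1 * (1 - t) `^ (b - 1))).
    rewrite ler_wpM2r ?powR_ge0 //.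
    have := @ge0_ler_powR R (a - 1) a0 t 1; rewrite powR1 !nnegrE ler01; exact.
  rewrite mul1r ge0_ler_powR // ?nnegrE ?subr_ge0 // ?(ltW p0) //.
  by rewrite lerDr ltW.
have gE : int01 g <= K * (m `^ (b - N0) / (N0 - b)) + e * Bet (a - 1) (b - 1).
  rewrite /g int01D ?int01Z //; [|by apply: cont01M => //; exact: cont01_cst..].
  rewrite lerD2r ler_wpM2l //.
  pose F t : R := (m + (1 - t)) `^ (b - N0) / (N0 - b).
  have h t : 0 <= t <= 1 -> isD F t ((m + (1 - t)) `^ (b - 1 - N0)).
    move=> t01; have p0 := pos t t01.
    have h1 := @isD_powR _ (fun t => m + (1 - t)) t _ (b - N0) p0 (dpos t t01).
    apply: is_derive_eq (isD_M h1 (isD_cst (N0 - b)^-1 t)) _.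
    rewrite (_ : b - 1 - N0 = b - N0 - 1); last by ring.
    rewrite [in RHS]powRB ?(gt_eqF p0) ?implybT // powRr1 ?(ltW p0) //.
    by field; rewrite (gt_eqF p0) subr_eq0 gt_eqF.
  rewrite (int01_isD cg1 h) /F.
  by rewrite subrr addr0 gerBl divr_ge0 ?powR_ge0 // subr_ge0 ltW.
rewrite -(ler_pM2r B0) -{1}(ger0_norm (ltW B0)) -normrM mulrDl mulfVK ?gt_eqF //.
exact: le_trans bound gE.
Qed.

End BetaAverages.

Lemma cvg_series_addn (R : realType) (b : nat -> R) N : cvgn (series b) ->
  cvgn (series (fun n => b (n + N)%N)).
Proof.
move=> cb; elim: N => [|N IH]; first by under eq_fun do rewrite addn0.
by have := cvg_seriesS IH; congr (cvgn (series _)); apply/funext => n; rewrite addSnnS.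
Qed.

(** * Pointwise estimate of the truncated kernel *)

Section KernelEstimate.
Variables (R : realType) (lambda alpha : R).
Hypothesis lambda_ge0 : 0 <= lambda.
Hypothesis alpha_gt : -1 < alpha.
Implicit Types (z w : R[i]) (u : R[i]) (t x : R) (n k N : nat).

Local Notation kap := (kap lambda).
Local Notation gam := (gam lambda).

(** The Gamma quotient of the series [F], rewritten with Pochhammer symbols ([Fcoef_kcoef]). *)
Definition kcoef n : R := poch (lambda + alpha + 2) n / poch (lambda + 1) n.

Definition dunkl_kernel N z w : R[i] := \sum_(n < N) (kcoef n)%:C * kap z w n.

(** Both sides are [poch x (n + k)]. *)
Lemma poch_swap x n k : poch x n * poch (x + n%:R) k = poch x k * poch (x + k%:R) n.
Proof.
have addE (y : R) i j : poch y (i + j) = poch y i * poch (y + i%:R) j.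
  elim: j => [|j IH]; first by rewrite addn0 poch0 mulr1.
  by rewrite addnS !pochS IH natrD addrA mulrA.
by rewrite -!addE addnC.
Qed.

Lemma kcoef_ge0 n : 0 <= kcoef n.
Proof. by rewrite divr_ge0 // poch_ge0 //; move: lambda_ge0 alpha_gt; lra. Qed.

(** The first factor is a coefficient of integer order [k], the second a moment of the Beta weight
    with [a = lambda + alpha + 2] and [b = k - 1 - alpha], so that [a + b = lambda + 1 + k]. *)
Lemma kcoef_split k n : alpha + 2 < k%:R ->
  kcoef n = poch (lambda + 1 + n%:R) k / poch (lambda + 1) k
    * (poch (lambda + alpha + 2) n / poch (lambda + alpha + 2 + (k%:R - 1 - alpha)) n).
Proof.
move=> ak; have l1 : 0 < lambda + 1 by rewrite ltr_wpDl.
have h := poch_swap (lambda + 1) n k.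
rewrite (_ : lambda + alpha + 2 + (k%:R - 1 - alpha) = lambda + 1 + k%:R); last by ring.
have p1 := poch_gt0 n l1; have p2 := poch_gt0 k l1.
have l2 : 0 < lambda + 1 + k%:R by rewrite ltr_wpDr.
have p3 := poch_gt0 n l2.
rewrite /kcoef; move: h p1 p2 p3.
move: (poch (lambda + 1) n) (poch (lambda + 1) k) (poch (lambda + 1 + k%:R) n)
  (poch (lambda + 1 + n%:R) k) => A B C D h A0 B0 C0.
have -> : D = B * C / A by rewrite -h mulrAC mulfV ?mul1r // gt_eqF.
by field; rewrite !gt_eqF.
Qed.

Lemma rnorm1B_ge t u : rnorm u <= 1 -> 0 <= t -> 1 - t <= rnorm (1 - t%:C * u).
Proof.
move=> u1 t0; have := rnormD (1 - t%:C * u) (t%:C * u).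
rewrite subrK rnorm1 rnormM rnormR ger0_norm //.
have : t * rnorm u <= t by rewrite ler_piMr.
lra.
Qed.

(** [1 - u] differs from [1 - t u] by [(1 - t) u], and [1 - t <= |1 - t u|] as well. *)
Lemma rnorm1B_le2 t u : rnorm u <= 1 -> 0 <= t <= 1 -> rnorm (1 - u) <= 2 * rnorm (1 - t%:C * u).
Proof.
move=> u1 /andP[t0 t1].
have h1 : rnorm (1 - u) <= rnorm (1 - t%:C * u) + (1 - t) * rnorm u.
  rewrite (_ : 1 - u = (1 - t%:C * u) + (- (1 - t))%:C * u); last by rewrite rcN rcD rcN; ring.
  by rewrite (le_trans (rnormD _ _)) // rnormM rnormR normrN ger0_norm ?subr_ge0.
have h2 := rnorm1B_ge u1 t0.
have h3 : (1 - t) * rnorm u <= 1 - t by rewrite ler_piMr // subr_ge0.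
lra.
Qed.

(** The mean of the two lower bounds [Bmin z w 1 / 2] and [1 - t]; the shape [m + (1 - t)] is the
    one that [beta_average_bound] integrates. *)
Lemma Bmin_ge z w t : rnorm (z * w) < 1 -> 0 <= t <= 1 ->
  (Bmin z w 1 / 2 + (1 - t)) / 2 <= Bmin z w t.
Proof.
move=> zw1 t01; have /andP[t0 t1] := t01.
have zw1' : rnorm (z * conjc w) <= 1 by rewrite rnorm_mul_conj ltW.
have h u : rnorm u <= 1 -> (rnorm (1 - 1%:C * u) / 2 + (1 - t)) / 2 <= rnorm (1 - t%:C * u).
  move=> u1; have := rnorm1B_le2 u1 t01; have := rnorm1B_ge u1 t0.
  by rewrite mul1r; lra.
have h1 := h _ (ltW zw1); have h2 := h _ zw1'.
rewrite /Bmin [leRHS]minEle; case: ifP => _.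
  by rewrite (le_trans _ h1) // ler_pM2r // lerD2r ler_pM2r // ge_min lexx.
by rewrite (le_trans _ h2) // ler_pM2r // lerD2r ler_pM2r // ge_min lexx orbT.
Qed.

Lemma Bmax_ge z w t : rnorm (z * w) < 1 -> 0 <= t <= 1 -> Bmax z w 1 / 2 <= Bmax z w t.
Proof.
move=> zw1 t01.
have zw1' : rnorm (z * conjc w) <= 1 by rewrite rnorm_mul_conj ltW.
rewrite ler_pdivrMr // mulrC /Bmax !mul1r ge_max.
have h1 := rnorm1B_le2 (ltW zw1) t01; have h2 := rnorm1B_le2 zw1' t01.
apply/andP; split.
  by rewrite (le_trans h1) // ler_pM2l // le_max lexx.
by rewrite (le_trans h2) // ler_pM2l // le_max lexx orbT.
Qed.

Lemma Bmax_gt0 z w t : rnorm (z * w) < 1 -> 0 <= t <= 1 -> 0 < Bmax z w t.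
Proof. by move=> zw1 t01; rewrite lt_max rnorm1B_gt0. Qed.

(** Majorant of the remainder after [N] terms of the generating series of order [k], uniform in [w]
    and [t]; the 2 comes from [rnorm_csum_le]. *)
Definition tail k z N : R :=
  2 * rsum (fun n => poch (lambda + 1 + (n + N)%:R) k * gam (n + N) * rnorm z ^+ (n + N)).

Lemma cvg_tail_terms k z : rnorm z < 1 ->
  cvgn (series (fun n => poch (lambda + 1 + n%:R) k * gam n * rnorm z ^+ n)).
Proof.
move=> z1; apply: slow_cvg; last by rewrite rnorm_ge0.
exact: slowM (slow_lshift k lambda_ge0) (slow_gam lambda_ge0).
Qed.

Lemma tail_ge0 k z N : rnorm z < 1 -> 0 <= tail k z N.
Proof.
move=> z1; rewrite /tail mulr_ge0 // rsum_ge0 // => [n|].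
  have g0 := ltW (gam_gt0 lambda_ge0 (n + N)).
  have p0 : 0 <= poch (lambda + 1 + (n + N)%:R) k by rewrite poch_ge0 // !addr_ge0.
  by nonneg.
exact: (cvg_series_addn (@cvg_tail_terms k z z1)).
Qed.

Lemma tail_cvg k z : rnorm z < 1 -> tail k z @ \oo --> 0.
Proof.
move=> z1; have h := rsum_tail (@cvg_tail_terms k z z1).
have := cvgM (cvg_cst (2 : R)) h; rewrite mulr0; exact.
Qed.

Lemma genW_partial k z w t N : rnorm z < 1 -> rnorm w <= 1 -> 0 <= t <= 1 ->
  rnorm (\sum_(n < N) (poch (lambda + 1 + n%:R) k * t ^+ n)%:C * kap z w n)
  <= rnorm (genW lambda (fun n => poch (lambda + 1 + n%:R) k) z w t) + tail k z N.
Proof.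
move=> z1 w1 t01; have /andP[t0 t1] := t01.
have zwz : rnorm (z * w) <= rnorm z by rewrite rnormM ler_piMr ?rnorm_ge0.
have zw1 : rnorm (z * w) < 1 by exact: le_lt_trans z1.
have sk := slow_lshift k lambda_ge0.
have su := summable_genW lambda_ge0 sk zw1 t01.
rewrite /genW (csum_split N su).
set S := \sum_(n < N) _; set T := csum _.
rewrite -{1}[S](addrK T) (le_trans (rnormD _ _)) // rnormN lerD2l /tail.
apply: rnorm_csum_le => [n|].
  apply: le_trans (genW_term_le lambda_ge0 z w (n + N) sk t0) _.
  apply: ler_wpM2l; first by rewrite mulr_ge0 ?(ltW (gam_gt0 _ _)) // poch_ge0 // !addr_ge0.
  rewrite lerXn2r ?nnegrE ?mulr_ge0 ?rnorm_ge0 // (le_trans _ zwz) // ler_piMr ?rnorm_ge0 //.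
exact: (cvg_series_addn (@cvg_tail_terms k z z1)).
Qed.

(** At an integer order [k > alpha + 2] the kernel is bounded by [Bmin^(-k-1)], and the Beta average
    with [b = k - 1 - alpha] changes the exponent to [b - (k + 1) = - (alpha + 2)]. The factor
    [Bmax^(- 2 lambda)] is replaced by its value at [t = 1] and leaves the integral. *)
Lemma dunkl_kernel_bound : exists2 C : R, 0 <= C & exists k, forall z w N,
  rnorm z < 1 -> rnorm w <= 1 ->
  rnorm (dunkl_kernel N z w) <=
    C * (Bmax z w 1 `^ (- (2 * lambda)) * Bmin z w 1 `^ (- (alpha + 2))) + C * tail k z N.
Proof.
have [k ak] : exists k : nat, alpha + 2 < k%:R.
  by exists (Num.bound (alpha + 2)); rewrite archi_boundP //; move: alpha_gt; lra.
have [C0 C00 hC] := genW_poch_bound lambda_ge0 k.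
pose a := lambda + alpha + 2; pose b := k%:R - 1 - alpha.
have a1 : 1 <= a by rewrite /a; move: lambda_ge0 alpha_gt; lra.
have b1 : 1 <= b by rewrite /b; move: ak; lra.
have bN : b < k.+1%:R by rewrite /b -natr1; move: alpha_gt; lra.
have a0 : 0 <= a - 1 by rewrite subr_ge0.
have b0 : 0 <= b - 1 by rewrite subr_ge0.
have B0 := Bet_gt0 a0 b0.
have l1 : 0 < lambda + 1 by rewrite ltr_wpDl.
have P0 := poch_gt0 k l1.
(* The powers of 2 are the losses in [Bmax_ge] and [Bmin_ge]. *)
pose c1 := C0 * 2 `^ (2 * lambda) * 2 ^+ k.+1.
pose C := 2 * (1 + c1 * (2 `^ (alpha + 2) / (alpha + 2)) / Bet (a - 1) (b - 1)) / poch (lambda + 1) k.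
have al0 : 0 < alpha + 2 by move: alpha_gt; lra.
have c10 : 0 <= c1 by nonneg.
have Q0 : 0 <= c1 * (2 `^ (alpha + 2) / (alpha + 2)) / Bet (a - 1) (b - 1) by nonneg.
exists C; first by rewrite /C; nonneg.
exists k => z w N z1 w1.
have zw1 : rnorm (z * w) < 1 by rewrite (le_lt_trans _ z1) // rnormM ler_piMr ?rnorm_ge0.
have t11 : 0 <= (1 : R) <= 1 by rewrite ler01 lexx.
set M := Bmax z w 1; set m := Bmin z w 1.
have M0 : 0 < M by exact: Bmax_gt0.
have m0 : 0 < m by exact: Bmin_gt0.
pose K := c1 * M `^ (- (2 * lambda)).
have K0 : 0 <= K by rewrite mulr_ge0 // powR_ge0.
have gb t : 0 <= t <= 1 ->
    rnorm (\sum_(n < N) (poch (lambda + 1 + n%:R) k * t ^+ n)%:C * kap z w n)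
    <= K * (m / 2 + (1 - t)) `^ (- k.+1%:R) + tail k z N.
  move=> t01; apply: (le_trans (genW_partial k N z1 w1 t01)); rewrite lerD2r.
  have [h _] := hC z w t zw1 t01; apply: (le_trans h).
  have Mt := Bmax_ge zw1 t01; have mt := Bmin_ge zw1 t01.
  have mt0 := Bmin_gt0 zw1 t01.
  have t1 : 0 <= 1 - t by rewrite subr_ge0; case/andP: t01.
  have u0 : 0 < m / 2 + (1 - t) by rewrite ltr_pwDl // divr_gt0.
  rewrite /Gam -!mulrA -invfM -exprS -/m -/M in Mt mt *.
  rewrite [leRHS](_ : _ = C0 * ((2 `^ (2 * lambda) * M `^ (- (2 * lambda))) *
     (2 ^+ k.+1 * (m / 2 + (1 - t)) `^ (- k.+1%:R)))); last by rewrite /K /c1; ring.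
  apply: ler_wpM2l => //.
  apply: ler_pM; rewrite ?powR_ge0 ?invr_ge0 ?exprn_ge0 ?(ltW mt0) //.
    have lam2 : 0 <= 2 * lambda by rewrite mulr_ge0.
    rewrite !powRN -ler_pdivrMl ?powR_gt0 // -invfM lef_pV2 ?posrE ?mulr_gt0 ?powR_gt0 //;
      last exact: Bmax_gt0.
    rewrite -powRM ?(ltW (Bmax_gt0 _ _)) //; apply: ge0_ler_powR; rewrite ?nnegrE ?(ltW M0) //.
      by rewrite mulr_ge0 // ltW // Bmax_gt0.
    by rewrite mulrC -ler_pdivrMr.
  rewrite powRN powR_mulrn ?(ltW u0) // -[2 ^+ _]invrK -invfM lef_pV2; last 2 first.
  - by rewrite posrE exprn_gt0.
  - by rewrite posrE mulr_gt0 ?invr_gt0 ?exprn_gt0.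
  by rewrite -exprVn -exprMn lerXn2r ?nnegrE ?(ltW mt0) // ?mulr_ge0 ?(ltW u0) // mulrC.
pose e := tail k z N.
pose D := c1 * (2 `^ (alpha + 2) / (alpha + 2)) / Bet (a - 1) (b - 1)
  * (M `^ (- (2 * lambda)) * m `^ (- (alpha + 2))) + e.
have mE : K * ((m / 2) `^ (b - k.+1%:R) / (k.+1%:R - b)) / Bet (a - 1) (b - 1) + e = D.
  rewrite /D /K; congr (_ + _).
  rewrite (_ : b - k.+1%:R = - (alpha + 2)); last by rewrite /b -natr1; ring.
  rewrite (_ : k.+1%:R - b = alpha + 2); last by rewrite /b -natr1; ring.
  rewrite powRM ?invr_ge0 ?(ltW m0) // -(powR_inv1 (ler0n R 2)) -powRrM mulN1r opprK.
  by ring.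
have m20 : 0 < m / 2 by rewrite divr_gt0.
(* The Beta average concerns real sequences, so it is applied to the real and the imaginary part
   separately; [f] stands for either. *)
have part (f : R[i] -> R) : (forall u v, f (u + v) = f u + f v) -> f 0 = 0 ->
    (forall (r : R) u, f (r%:C * u) = r * f u) -> (forall u, `|f u| <= rnorm u) ->
    `|f (dunkl_kernel N z w)| <= D / poch (lambda + 1) k.
  move=> fD f0 fZ fle.
  have fS (F : nat -> R[i]) : f (\sum_(n < N) F n) = \sum_(n < N) f (F n).
    exact: (big_morph f fD f0).
  rewrite ler_pdivlMr //.
  have -> : `|f (dunkl_kernel N z w)| * poch (lambda + 1) k =
      `|\sum_(n < N) (poch (lambda + 1 + n%:R) k * f (kap z w n)) * (poch a n / poch (a + b) n)|.
    rewrite -{1}(ger0_norm (ltW P0)) -normrM /dunkl_kernel (fS (fun n => (kcoef n)%:C * kap z w n)) mulr_suml; congr `|_|.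
    apply: eq_bigr => i _; rewrite fZ (kcoef_split _ ak) -/a -/b.
    by move: (poch a i / _) => u; field; rewrite gt_eqF.
  rewrite -mE.
  apply: (@beta_average_bound R a b k.+1%:R K (m / 2) e N
    (fun n => poch (lambda + 1 + n%:R) k * f (kap z w n))) => // t t01.
  apply: le_trans (gb t t01).
  have -> : \sum_(n < N) poch (lambda + 1 + n%:R) k * f (kap z w n) * t ^+ n =
      f (\sum_(n < N) (poch (lambda + 1 + n%:R) k * t ^+ n)%:C * kap z w n).
    rewrite (fS (fun n => (poch (lambda + 1 + n%:R) k * t ^+ n)%:C * kap z w n)).
    by apply: eq_bigr => i _; rewrite fZ; ring.
  exact: fle.
(* The zero functional in [part] yields the sign of [D]. *)
have D0 : 0 <= D by have := part (fun=> 0); rewrite normr0 => h; rewrite -[D](mulfVK (x := poch (lambda + 1) k)) ?gt_eqF // mulr_ge0 ?(ltW P0) // h // => *; rewrite ?addr0 ?mulr0 ?normr0 ?rnorm_ge0.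
have e0 : 0 <= e by exact: tail_ge0.
have hR := part (@complex.Re R) (@ReD R) erefl (@ReZ R) (@Re_le_rnorm R).
have hI := part (@complex.Im R) (@ImD R) erefl (@ImZ R) (@Im_le_rnorm R).
apply: (le_trans (rnorm_le_ReIm _)); apply: (le_trans (lerD hR hI)).
have -> : D / poch (lambda + 1) k + D / poch (lambda + 1) k = 2 * D / poch (lambda + 1) k by ring.
set X := M `^ _ * m `^ _.
have X0 : 0 <= X by rewrite mulr_ge0 // powR_ge0.
move: Q0 @C @D mE part D0 hR hI; set Q := c1 * _ / _ => Q0 C D _ _ _ _ _.
rewrite [leLHS](_ : _ = 2 / poch (lambda + 1) k * D); last by ring.
rewrite [leRHS](_ : _ = 2 / poch (lambda + 1) k * ((1 + Q) * (X + e))); last by rewrite /C -/e; ring.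
apply: ler_wpM2l; first by nonneg.
have : 0 <= X + Q * e by nonneg.
by rewrite /D -/X; lra.
Qed.

End KernelEstimate.

(** * Integration over circles *)

Section LinearScaling.
Variable R : realType.
Local Notation mu := (@lebesgue_measure R).
Local Open Scope ereal_scope.

Lemma lebesgue_measure_scale (c : R) (A : set R) : (0 < c)%R -> measurable A ->
  mu A = c%:E * mu ((fun x => c * x)%R @^-1` A).
Proof.
move=> c0; have c0' := ltW c0.
pose g : measurableTypeR R -> measurableTypeR R := (fun x => c * x)%R.
have mg : measurable_fun setT g by apply: continuous_measurable_fun; exact: mulrl_continuous.
pose m' : {measure set (measurableTypeR R) -> \bar R} := mscale (NngNum c0') (pushforward mu g).
pose m := m' mg.
move=> mA; rewrite -[RHS]/(m A); apply: lebesgue_measure_unique => //.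
move=> _ [[a b]] _ <-; rewrite -[RHS]/(c%:E * mu (g @^-1` `]a, b]%classic)).
have -> : g @^-1` `]a, b]%classic = `](a / c)%R, (b / c)%R]%classic.
  apply/seteqP; split => x /=; rewrite !in_itv /= ltr_pdivrMr // ler_pdivlMr // ![(x * c)%R]mulrC //.
rewrite !lebesgue_measure_itv /= !lte_fin ltr_pM2r ?invr_gt0 //.
case: ifP => _; last by rewrite mule0.
by rewrite -!EFinB -EFinM -mulrBl mulrCA mulfV ?mulr1 // gt_eqF.
Qed.

Lemma ge0_integral_scale_pos (c : R) (f : R -> \bar R) : (0 < c)%R ->
  measurable_fun setT f -> (forall x, 0 <= f x) ->
  \int[mu]_x f x = \int[mu]_x (f (c * x)%R * c%:E).
Proof.
move=> c0 mf f0; have c0' := ltW c0.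
pose g : measurableTypeR R -> measurableTypeR R := (fun x => c * x)%R.
have mg : measurable_fun setT g by apply: continuous_measurable_fun; exact: mulrl_continuous.
pose m' : {measure set (measurableTypeR R) -> \bar R} := mscale (NngNum c0') (pushforward mu g).
pose m := m' mg.
transitivity (\int[m]_x f x).
  by apply: eq_measure_integral => A mA _; exact: (lebesgue_measure_scale c0 mA).
rewrite ge0_integral_mscale //=; under [RHS]eq_integral do rewrite muleC.
rewrite ge0_integralZl //; first by congr (_ * _); rewrite ge0_integral_pushforward.
by apply: measurableT_comp mf _.
Qed.

Lemma ge0_integralN (f : R -> \bar R) :
  measurable_fun setT f -> (forall x, 0 <= f x) ->
  \int[mu]_x f x = \int[mu]_x f (- x)%R.
Proof.
move=> mf f0.
pose g : measurableTypeR R -> measurableTypeR R := (fun x => - x)%R.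
have mg : measurable_fun setT g by exact: oppr_measurable.
transitivity (\int[pushforward mu g]_x f x); last by rewrite ge0_integral_pushforward.
by apply: eq_measure_integral => A mA _; apply/esym/lebesgue_measureN.
Qed.

Lemma ge0_integral_scale (c : R) (f : R -> \bar R) : (c != 0)%R ->
  measurable_fun setT f -> (forall x, 0 <= f x) ->
  \int[mu]_x f x = \int[mu]_x (f (c * x)%R * `|c|%R%:E).
Proof.
move=> c0 mf f0; have [c1|c1|c1] := ltgtP c 0%R; last by rewrite c1 eqxx in c0.
  rewrite (@ge0_integral_scale_pos (- c)) ?oppr_gt0 // ge0_integralN //; last 2 first.
  - by apply: emeasurable_funM => //; apply: measurableT_comp mf _.
  - by move=> x; rewrite mule_ge0 // lee_fin oppr_ge0 ltW.
  by apply: eq_integral => x _; rewrite mulrNN ltr0_norm.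
by rewrite gtr0_norm //; exact: ge0_integral_scale_pos.
Qed.

End LinearScaling.

(** * Polar coordinates with the slope as angular variable *)

Section Polar.
Variable R : realType.
Local Notation mu := (@lebesgue_measure R).
Local Open Scope ereal_scope.

(** On each vertical line with [x != 0] the substitution [y = x t] is linear; the exceptional line
    [x = 0] is null. *)
Lemma ge0_integral_slope (h : R * R -> \bar R) :
  measurable_fun setT h -> (forall z, 0 <= h z) ->
  \int[mu \x mu]_z h z = \int[mu]_t \int[mu]_x (h (x, x * t)%R * `|x|%R%:E).
Proof.
move=> mh h0; rewrite fubini_tonelli1 // /fubini_F.
have m1 : measurable_fun setT (fun z : R * R => h (z.1, z.1 * z.2)%R * `|z.1|%R%:E).
  apply: emeasurable_funM.
    apply: measurableT_comp mh _.
    by apply/measurable_fun_pair => //=; apply: measurable_funM.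
  by apply/measurable_EFinP; apply: measurableT_comp.
have m0 z : 0 <= h (z.1, z.1 * z.2)%R * `|z.1|%R%:E by rewrite mule_ge0 // lee_fin.
rewrite -(@fubini_tonelli _ _ _ _ _ mu mu _ m1 m0); apply: ge0_ae_eq_integral => //.
- exact: measurable_fun_fubini_tonelli_F.
- exact: (@measurable_fun_fubini_tonelli_F _ _ _ _ _ mu _ m1 m0).
- by move=> x _; apply: integral_ge0.
- by move=> x _; apply: integral_ge0.
exists [set 0%R]; split => //=; first exact: lebesgue_measure_set1.
move=> x /= hx; apply: contrapT => /eqP x0; apply: hx => _.
by rewrite (@ge0_integral_scale _ x) //; apply: measurableT_comp mh _.
Qed.

(** After the order of integration is exchanged, [x = s / sqrt (1 + t^2)] for fixed [t] makes [s]
    the signed distance to the origin. With the slope in place of the angle, only linear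
    substitutions in one variable and Tonelli are involved. *)
Lemma ge0_integral_polar (h : R * R -> \bar R) :
  measurable_fun setT h -> (forall z, 0 <= h z) ->
  let c t := Num.sqrt (1 + t ^+ 2)%R in
  let H s := \int[mu]_t (h (s / c t, s * t / c t)%R * (`|s| / (1 + t ^+ 2))%R%:E) in
  measurable_fun setT H /\ \int[mu \x mu]_z h z = \int[mu]_s H s.
Proof.
move=> mh h0 c H; have -> := ge0_integral_slope mh h0.
have c2 t : (c t ^+ 2 = 1 + t ^+ 2)%R by rewrite sqr_sqrtr // addr_ge0 // sqr_ge0.
have c0 t : (0 < c t)%R by rewrite sqrtr_gt0 ltr_wpDr // sqr_ge0.
have mc : measurable_fun setT (fun t : R => (c t)^-1)%R.
  apply: continuous_measurable_fun => t; apply: cvgV; first by rewrite gt_eqF.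
  apply: continuous_comp; last exact: sqrt_continuous.
  by apply: cvgD; [exact: cvg_cst|apply: exprn_continuous].
have mc2 : measurable_fun setT (fun t : R => (1 + t ^+ 2)^-1)%R.
  rewrite (_ : (fun t => _) = (fun t => (c t)^-1 * (c t)^-1)%R); first exact: measurable_funM.
  by apply/funext => t; rewrite -invfM -expr2 c2.
have m1 : measurable_fun setT (fun z : R * R =>
    h (z.1 / c z.2, z.1 * z.2 / c z.2)%R * (`|z.1| / (1 + z.2 ^+ 2))%R%:E).
  have mcz : measurable_fun setT (fun z : R * R => (c z.2)^-1)%R by apply: measurableT_comp mc _.
  apply: emeasurable_funM.
    apply: measurableT_comp mh _.
    by apply/measurable_fun_pair => //=; do ?apply: measurable_funM.
  apply/measurable_EFinP; apply: measurable_funM; first exact: measurableT_comp.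
  exact: measurableT_comp mc2 _.
have m0 z : 0 <= h (z.1 / c z.2, z.1 * z.2 / c z.2)%R * (`|z.1| / (1 + z.2 ^+ 2))%R%:E.
  by rewrite mule_ge0 // lee_fin divr_ge0 // addr_ge0 // sqr_ge0.
split; first exact: (@measurable_fun_fubini_tonelli_F _ _ _ _ _ mu _ m1 m0).
apply: (etrans _ (esym (@fubini_tonelli _ _ _ _ _ mu mu _ m1 m0))); apply: eq_integral => t _.
rewrite /fubini_G /=.
rewrite (@ge0_integral_scale _ (c t)^-1) ?gt_eqF ?invr_gt0 //.
- apply: eq_integral => x _ /=; have ct := c0 t.
  rewrite -muleA -EFinM normrM -c2 normfV (gtr0_norm ct).
  congr (h (_, _) * _%:E); first by rewrite mulrC.
    by rewrite -mulrA mulrC.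
  by rewrite expr2 invfM [in RHS]mulrA; congr (_ * _)%R; exact: mulrC.
- apply: emeasurable_funM.
    apply: measurableT_comp mh _.
    by apply/measurable_fun_pair => //=; do ?apply: measurable_funM.
  by apply/measurable_EFinP.
- by move=> x; rewrite mule_ge0 // lee_fin.
Qed.

(** The identity from the completed to the Borel sigma-algebra is measurable and pushes the
    completed measure to Lebesgue measure. *)
Lemma ge0_completed_integral (A : set R) (f : R -> \bar R) : measurable A ->
  measurable_fun A f -> (forall x, A x -> 0 <= f x) ->
  \int[completed_lebesgue_measure]_(x in A) f x = \int[mu]_(x in A) f x.
Proof.
move=> mA mf f0.
pose g : caratheodory_type (wlength (@idfun R))^*%mu -> measurableTypeR R := id.
have mg : measurable_fun setT g.
  by move=> _ B mB; rewrite setTI; apply: sub_caratheodory.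
rewrite -[RHS](@eq_measure_integral _ _ _ _ _ (pushforward completed_lebesgue_measure g)) //.
by rewrite ge0_integral_pushforward // => x /set_mem; exact: f0.
Qed.

End Polar.

(** * Comparison of integrals without measurability *)

Section IntegralBelow.
Context d (T : measurableType d) (R : realType).
Variable mu : {measure set T -> \bar R}.
Local Open Scope ereal_scope.
Import HBNNSimple.

(** The integral of a nonnegative function is a supremum over the simple functions below it, so a
    larger function has more competitors. *)
Lemma ge0_integral_mono (D : set T) (f g : T -> \bar R) :
  (forall x, D x -> 0 <= f x) -> (forall x, D x -> f x <= g x) ->
  \int[mu]_(x in D) f x <= \int[mu]_(x in D) g x.
Proof.
move=> f0 fg; rewrite !ge0_integralE //; last first.
  by move=> x Dx; exact: le_trans (f0 _ Dx) (fg _ Dx).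
apply: ereal_sup_le => _ [h hf <-]; exists h => //= x; apply: (le_trans (hf x)).
by rewrite !patchE; case: ifPn => // /set_mem; exact: fg.
Qed.

(** Meant for integrands containing [w (|z|)], where [w] is only Lebesgue measurable: bounding the
    Borel functions below is enough, and Tonelli applies to these. *)
Lemma ge0_integral_le_measurable (D : set T) (f : T -> \bar R) (b : \bar R) :
  (forall x, D x -> 0 <= f x) ->
  (forall h : T -> \bar R, measurable_fun setT h -> (forall x, 0 <= h x) ->
     (forall x, h x <= (f \_ D) x) -> \int[mu]_x h x <= b) ->
  \int[mu]_(x in D) f x <= b.
Proof.
move=> f0 hb; rewrite ge0_integralE //; apply: ge_ereal_sup => _ [h hf <-].
rewrite (_ : sintegral mu h = \int[mu]_x (h x)%:E); last by rewrite integral_nnsfun // patch_setT.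
apply: hb => //.
  exact/measurable_EFinP.
by move=> x; rewrite lee_fin.
Qed.

End IntegralBelow.

Section DiscIntegral.
Variable R : realType.
Local Notation mu := (@lebesgue_measure R).
Local Notation cmu := (@completed_lebesgue_measure R).
Local Open Scope ereal_scope.

Lemma ge0_integral_swap (h : R * R -> \bar R) :
  measurable_fun setT h -> (forall z, 0 <= h z) ->
  \int[mu \x mu]_z h z = \int[mu \x mu]_z h (z.2, z.1).
Proof.
move=> mh h0; rewrite [RHS]fubini_tonelli1 //; last first.
  by apply: measurableT_comp mh _; apply/measurable_fun_pair.
rewrite fubini_tonelli1 //; exact: fubini_tonelli.
Qed.

(** The line is split at 0 and its negative half reflected. [H] is Borel but [u] need not be, so on
    each half the Borel integral of [H] becomes a completed one before the comparison with [u]. *)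
Lemma ge0_integral_even_le (H : R -> \bar R) (u : R -> \bar R) :
  measurable_fun setT H -> (forall s, 0 <= H s) ->
  (forall s, (0 <= s < 1)%R -> 0 <= u s) ->
  (forall s : R, (s != 0)%R -> (`|s| < 1)%R -> H s <= u `|s|%R) ->
  (forall s : R, (s == 0)%R || (1 <= `|s|)%R -> H s = 0) ->
  \int[mu]_s H s <= 2%:E * \int[cmu]_(s in `[0%R, 1%R[) u s.
Proof.
move=> mH H0 u0 Hu Hz.
pose K (G : R -> \bar R) := G \_ `[0%R, 1%R[.
have mK (G : R -> \bar R) : measurable_fun setT G -> measurable_fun setT (K G).
  by move=> mG; apply/(measurable_restrictT _ _).1 => //; exact: measurable_funTS mG.
have K0 (G : R -> \bar R) : (forall s, 0 <= G s) -> forall s, 0 <= K G s.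
  by move=> G0 s; rewrite /K patchE; case: ifP.
pose H' s := H (- s)%R.
have mH' : measurable_fun setT H' by apply: measurableT_comp mH _.
have H'0 s : 0 <= H' s by exact: H0.
have half (G : R -> \bar R) : measurable_fun setT G -> (forall s, 0 <= G s) ->
   (forall s, (0 <= s < 1)%R -> G s <= u s) ->
   \int[mu]_s K G s <= \int[cmu]_(s in `[0%R, 1%R[) u s.
  move=> mG G0 Gu; rewrite -integral_mkcond -ge0_completed_integral //; last exact: measurable_funTS.
  by apply: ge0_integral_mono => // s; rewrite /= in_itv; exact: Gu.
have Hu' s : (0 <= s < 1)%R -> H s <= u s /\ H' s <= u s.
  move=> /andP[s0 s1]; have [-> |sn] := eqVneq s 0%R.
    by rewrite /H' oppr0 Hz ?eqxx // u0 // lexx /= ltr01.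
  have as_ : `|s|%R = s by rewrite ger0_norm.
  split; first by rewrite -{2}as_; apply: Hu; rewrite ?as_.
  by rewrite -{2}as_ -normrN; apply: Hu; rewrite ?normrN ?as_ ?oppr_eq0.
rewrite -[2%R]/(1 + 1)%R EFinD ge0_muleDl ?lee_fin // !mul1e.
have mKN : measurable_fun setT (fun s : R => K H' (- s)%R).
  by apply: measurableT_comp (mK _ mH') _.
apply: (@le_trans _ _ (\int[mu]_s (K H s + K H' (- s)%R))).
  apply: ge0_integral_mono => // s _.
  have [sz|] := boolP ((s == 0)%R || (1 <= `|s|)%R); first by rewrite (Hz _ sz) adde_ge0 //; [exact: K0|apply: (K0 H') => r; exact: H0].
  rewrite negb_or -ltNge => /andP[sn s1].
  have KE (G : R -> \bar R) r : (0 <= r < 1)%R -> K G r = G r.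
    by move=> r01; rewrite /K patchE mem_set //= in_itv.
  have [s0|s0] := leP 0%R s.
    have s2 : (0 <= s < 1)%R by move: s1; rewrite ger0_norm // s0.
    by rewrite (KE H _ s2) leeDl // (K0 H').
  have s2 : (0 <= - s < 1)%R by move: s1; rewrite ltr0_norm // oppr_ge0 ltW.
  by rewrite (KE H' _ s2) /H' opprK leeDr // (K0 H).
have -> := @ge0_integralD _ _ _ mu _ measurableT _ _ (fun s _ => K0 H H0 s) (mK _ mH)
  (fun s _ => K0 H' H'0 (- s)%R) mKN.
apply: leeD; first by apply: half => // s /Hu'[].
rewrite -(@ge0_integralN _ (K H')) //; first by apply: half => // s /Hu'[].
  exact: mK.
exact: (K0 H').
Qed.

(* With [t = tan theta], [dt / (1 + t^2) = d theta]: the integral of [G] over the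
   half circle of signed radius [s]. *)
Definition circle_int (G : R * R -> R) (s : R) : \bar R :=
  \int[mu]_t (G (s / Num.sqrt (1 + t ^+ 2), s * t / Num.sqrt (1 + t ^+ 2)) / (1 + t ^+ 2))%R%:E.

End DiscIntegral.

Section DiscIntegralLe.
Variable R : realType.
Local Notation mu := (@lebesgue_measure R).
Local Notation cmu := (@completed_lebesgue_measure R).
Local Open Scope ereal_scope.

Lemma rnorm_slope (s t : R) :
  rnorm (toC (s / Num.sqrt (1 + t ^+ 2), s * t / Num.sqrt (1 + t ^+ 2))%R) = `|s|%R.
Proof.
have c1 : (0 < 1 + t ^+ 2)%R by rewrite ltr_wpDr // sqr_ge0.
apply/eqP; rewrite -(eqrXn2 (n := 2)) ?rnorm_ge0 // sqr_rnorm /=.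
rewrite !exprMn exprVn sqr_sqrtr ?ltW // real_normK ?num_real //.
by apply/eqP; field; rewrite gt_eqF.
Qed.

Lemma measurable_slope (s : R) :
  measurable_fun setT (fun t : R => (s / Num.sqrt (1 + t ^+ 2), s * t / Num.sqrt (1 + t ^+ 2)))%R.
Proof.
have mc : measurable_fun setT (fun t : R => (Num.sqrt (1 + t ^+ 2))^-1)%R.
  apply: continuous_measurable_fun => t; apply: cvgV.
    by rewrite gt_eqF // sqrtr_gt0 ltr_wpDr // sqr_ge0.
  apply: continuous_comp; last exact: sqrt_continuous.
  by apply: cvgD; [exact: cvg_cst|apply: exprn_continuous].
by apply/measurable_fun_pair => //=; do ?apply: measurable_funM.
Qed.

Lemma measurable_inv1Dsqr : measurable_fun setT (fun t : R => (1 + t ^+ 2)^-1)%R.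
Proof.
apply: continuous_measurable_fun => t; apply: cvgV.
  by rewrite gt_eqF // ltr_wpDr // sqr_ge0.
by apply: cvgD; [exact: cvg_cst|apply: exprn_continuous].
Qed.

(** Tonelli is applied to a Borel [h] below the integrand. On the circle of radius [|s|] the weight
    is constant, and the Jacobian factor [|s| <= 1] is dropped; the 2 counts the half circles
    [s > 0] and [s < 0]. *)
Lemma disc_integral_le (G : R * R -> R) (w Phi : R -> R) :
  measurable_fun setT G -> (forall z, 0 <= G z)%R ->
  (forall s, 0 <= s < 1 -> 0 < w s)%R ->
  (forall s, 0 <= s < 1 -> 0 <= Phi s)%R ->
  (forall s : R, (s != 0)%R -> (`|s| < 1)%R -> circle_int G s <= (Phi `|s|%R)%:E) ->
  \int[(mu \x mu)%E]_(xy in @disc2 R) (G xy * w (rnorm (toC xy)))%:E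
    <= 2%:E * \int[cmu]_(s in `[0%R, 1%R[) (w s * Phi s)%:E.
Proof.
move=> mG G0 w0 P0 GP.
apply: ge0_integral_le_measurable => [z zD|h mh h0 hle].
  by rewrite lee_fin mulr_ge0 // ltW // w0 // rnorm_ge0.
have [mH ->] := ge0_integral_polar mh h0.
apply: ge0_integral_even_le => //.
- move=> s; apply: integral_ge0 => t _; rewrite mule_ge0 // lee_fin divr_ge0 //.
  by rewrite addr_ge0 // sqr_ge0.
- by move=> s s01; rewrite lee_fin mulr_ge0 ?P0 // ltW // w0.
- move=> s s0 s1; have s2 : (0 <= `|s| < 1)%R by rewrite normr_ge0.
  have w1 := ltW (w0 _ s2).
  apply: (@le_trans _ _ (\int[mu]_t ((w `|s|)%:E *
     (G (s / Num.sqrt (1 + t ^+ 2), s * t / Num.sqrt (1 + t ^+ 2)) / (1 + t ^+ 2))%R%:E))).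
    apply: ge0_integral_mono => t _; have t0 : (0 <= 1 + t ^+ 2)%R by rewrite addr_ge0 // sqr_ge0.
      by rewrite mule_ge0 // lee_fin divr_ge0.
    set z := (_, _); have zs : rnorm (toC z) = `|s|%R := rnorm_slope s t.
    have := hle z; rewrite patchE mem_set /disc2 /disc /= ?zs // => hz.
    apply: (@le_trans _ _ ((G z * w `|s|)%:E * (`|s| / (1 + t ^+ 2))%:E)).
      by apply: lee_wpmul2r => //; rewrite lee_fin divr_ge0.
    rewrite -!EFinM lee_fin; set I := (_^-1)%R; have I0 : (0 <= I)%R by rewrite invr_ge0.
    have -> : (G z * w `|s| * (`|s| * I) = `|s| * (w `|s| * (G z * I)))%R by ring.
    by apply: ler_piMl; rewrite ?mulr_ge0 // ltW.
  rewrite ge0_integralZl_EFin //; last 2 first.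
  - by move=> t _; rewrite lee_fin divr_ge0 // addr_ge0 // sqr_ge0.
  - apply/measurable_EFinP; apply: measurable_funM; last exact: measurable_inv1Dsqr.
    exact: measurableT_comp mG (measurable_slope s).
  by rewrite EFinM; apply: lee_wpmul2l; rewrite ?lee_fin //; exact: GP.
- move=> s /orP[/eqP ->|s1].
    by apply: integral0_eq => t _; rewrite normr0 !mul0r mule0.
  apply: integral0_eq => t _; set z := (_, _); have zs : rnorm (toC z) = `|s|%R := rnorm_slope s t.
  have := hle z; rewrite patchE memNset; last by rewrite /disc2 /disc /= zs; apply/negP; rewrite -leNgt.
  by move=> hz; rewrite (_ : h z = 0) ?mul0e //; apply/eqP; rewrite eq_le h0 andbT.
Qed.

End DiscIntegralLe.

(** * Power integrals on the line *)

Section PowerTail.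
Variable R : realType.
Local Notation mu := (@lebesgue_measure R).
Implicit Types (e t a N : R).

Lemma ge0_integral_shift a (f : R -> \bar R) :
  measurable_fun setT f -> (forall x, 0 <= f x)%E ->
  (\int[mu]_x f x = \int[mu]_x f (x + a)%R)%E.
Proof.
move=> mf f0.
pose g : measurableTypeR R -> measurableTypeR R := (fun x => x + a).
have mg : measurable_fun setT g by exact: measurable_funD.
pose m' : {measure set (measurableTypeR R) -> \bar R} := pushforward mu g.
transitivity (\int[m' mg]_x f x)%E; last by rewrite ge0_integral_pushforward.
apply: eq_measure_integral => A mA _; apply: (@lebesgue_measure_unique _ (m' mg)) => //.
move=> _ [[b c]] _ <-; rewrite -[RHS]/(mu (g @^-1` `]b, c]%classic)).
have -> : g @^-1` `]b, c]%classic = `](b - a), (c - a)]%classic.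
  by apply/seteqP; split => x /=; rewrite !in_itv /= ltrBlDr lerBrDr.
rewrite !lebesgue_measure_itv /= !lte_fin ltrD2r; case: ifP => // _.
by rewrite -!EFinB; congr EFin; ring.
Qed.

Lemma powR_shift_cvg0 e a : 0 < a -> (e + t) `^ (- a) @[t --> +oo] --> 0.
Proof.
move=> a0; apply/cvgrPdist_lt => d d0; near=> t.
have da : 0 < d `^ (- a^-1) by exact: powR_gt0.
have et : d `^ (- a^-1) < e + t by rewrite -ltrBlDl; near: t; apply: nbhs_pinfty_gt; rewrite num_real.
rewrite sub0r normrN ger0_norm ?powR_ge0 // powRN.
rewrite -[ltRHS]invrK ltf_pV2 ?posrE ?invr_gt0 ?powR_gt0 //; last exact: lt_trans da et.
have -> : d^-1 = (d `^ (- a^-1)) `^ a.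
  by rewrite -powRrM mulNr mulVf ?gt_eqF // powR_inv1 // ltW.
by apply: gt0_ltr_powR => //; rewrite nnegrE ltW //; exact: lt_trans da et.
Unshelve. all: by end_near. Qed.

Lemma integral_powR_tail e N : 0 < e -> 1 < N ->
  (\int[mu]_(t in `[0%R, +oo[) ((e + t) `^ (- N))%:E = (e `^ (1 - N) / (N - 1))%:E)%E.
Proof.
move=> e0 N1; have N0 : 0 < N - 1 by rewrite subr_gt0.
pose F t := - (N - 1)^-1 * (e + t) `^ (- (N - 1)).
have dF t : 0 <= t -> is_derive t 1 F ((e + t) `^ (- N)).
  move=> t0; have et : 0 < e + t by rewrite ltr_wpDr.
  have h : is_derive t (1 : R) (fun t => e + t) 1.
    by apply: is_derive_eq (isD_D (isD_cst e t) (isD_id t)) _; rewrite add0r.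
  apply: is_derive_eq (isD_Z (- (N - 1)^-1) (isD_powR (- (N - 1)) et h)) _.
  rewrite (_ : - N = - (N - 1) - 1); last by ring.
  rewrite powRB ?(gt_eqF et) ?implybT // powRr1 ?ltW //.
  by field; rewrite !gt_eqF.
have cf t : 0 <= t -> {for t, continuous (fun t => (e + t) `^ (- N))}.
  move=> t0; have et : 0 < e + t by rewrite ltr_wpDr.
  have h : is_derive t (1 : R) (fun t => e + t) 1.
    by apply: is_derive_eq (isD_D (isD_cst e t) (isD_id t)) _; rewrite add0r.
  exact: isD_cont (isD_powR (- N) et h).
rewrite (@ge0_continuous_FTC2y _ _ F 0 0).
- by rewrite sub0e /F addr0 mulNr EFinN oppeK opprB mulrC.
- by move=> *; exact: powR_ge0.
- apply: continuous_in_subspaceT => x; rewrite inE /= in_itv /= andbT; exact: cf.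
- rewrite -[X in _ --> X](mulr0 (- (N - 1)^-1)); apply: cvgM; first exact: cvg_cst.
  exact: powR_shift_cvg0.
- by move=> x x0; case: (dF _ (ltW x0)).
- have [d0 _] := dF _ (lexx 0); apply: cvg_at_right_filter.
  by apply: differentiable_continuous; exact/derivable1_diffP.
- move=> x; rewrite in_itv /= andbT => x0; rewrite derive1E; have := dF _ (ltW x0) => h.
  exact: derive_val.
Qed.

Lemma integral_powR_line e t0 N : 0 < e -> 1 < N ->
  (\int[mu]_t ((e + `|t - t0|) `^ (- N))%:E <= (2 * (e `^ (1 - N) / (N - 1)))%:E)%E.
Proof.
move=> e0 N1.
have mf (s : R) : measurable_fun setT (fun t : R => ((e + `|t - s|) `^ (- N))%:E).
  apply/measurable_EFinP; apply: (@measurableT_comp _ _ _ _ _ _ (fun x : R => x `^ (- N))); first exact: measurable_powR.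
  apply: measurable_funD => //; apply: measurableT_comp => //.
  by apply: measurable_funD.
have f0 s t : (0 <= ((e + `|t - s|) `^ (- N))%:E)%E by rewrite lee_fin powR_ge0.
rewrite (ge0_integral_shift t0) //; under eq_integral do rewrite addrK.
have {}mf : measurable_fun setT (fun t : R => ((e + `|t|) `^ (- N))%:E).
  by have := mf 0; under eq_fun do rewrite subr0.
have {}f0 t : (0 <= ((e + `|t|) `^ (- N))%:E)%E by rewrite lee_fin powR_ge0.
have half : (\int[mu]_(t in `[0%R, +oo[) ((e + `|t|) `^ (- N))%:E = (e `^ (1 - N) / (N - 1))%:E)%E.
  rewrite -(integral_powR_tail e0 N1); apply: eq_integral => t; rewrite inE /= in_itv /= andbT => t0'.
  by rewrite ger0_norm.
have -> : [set: R] = `]-oo, 0%R[ `|` `[0%R, +oo[.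
  by apply/seteqP; split => x //= _; rewrite !in_itv /= andbT; case: ltP; [left|right].
rewrite ge0_integral_setU //; last 2 first.
- exact: measurable_funS mf.
- apply/disj_setPS => x /= []; rewrite !in_itv /= andbT; lra.
rewrite mulr_natl mulr2n EFinD; apply: leeD; last by rewrite half.
rewrite -half ge0_integration_by_substitution0 //.
under [leRHS]eq_integral do rewrite normrN.
apply: ge0_subset_integral => //; first exact: measurable_funS mf.
by move=> x /=; rewrite !in_itv /=; exact: ltW.
Qed.

(** [1 / (1 + t^2) <= 2 (1 + |t|)^(-2)], and [integral_powR_line] with [e = 1] and [N = 2] gives
    another factor 2. *)
Lemma integral_inv1Dsqr_le : (\int[mu]_t (1 + t ^+ 2)^-1%:E <= 4%:E)%E.
Proof.
apply: (@le_trans _ _ (\int[mu]_t (2%:E * ((1 + `|t - 0|) `^ (- 2))%:E))%E).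
  apply: ge0_integral_mono => t _; first by rewrite lee_fin invr_ge0 addr_ge0 // sqr_ge0.
  rewrite -EFinM lee_fin subr0 powRN powR_mulrn ?addr_ge0 //.
  have a0 : 0 <= `|t| by []. have := real_normK (num_real t); move: a0.
  move: `|t| => a a0 <-.
  rewrite ler_pdivlMr ?exprn_gt0 ?ltr_wpDr // mulrC ler_pdivrMr ?ltr_wpDr ?sqr_ge0 //.
  have -> : 2 * (1 + a ^+ 2) = (1 + a) ^+ 2 + (a - 1) ^+ 2 by ring.
  by rewrite lerDl sqr_ge0.
rewrite ge0_integralZl_EFin //.
- have h := @integral_powR_line 1 0 2 ltr01 (ltr1n _ 2).
  rewrite (_ : 4%:E = 2%:E * 2%:E)%E; last by rewrite -EFinM -natrM.
   apply: lee_wpmul2l; first by rewrite lee_fin.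
  apply: (le_trans h); rewrite powR1 lee_fin (_ : 2 - 1 = 1 :> R) ?invr1 ?mulr1 //; ring.
- apply/measurable_EFinP; apply: (@measurableT_comp _ _ _ _ _ _ (fun x : R => x `^ (- 2))); first exact: measurable_powR.
  apply: measurable_funD => //; apply: measurableT_comp => //.
  by apply: measurable_funD.
Qed.

End PowerTail.

(** * Power kernels on a circle *)

Section CircleKernel.
Variable R : realType.
Local Notation mu := (@lebesgue_measure R).
Implicit Types (z v : R[i]) (s t N : R).

Definition slope_point s t : R * R :=
  (s / Num.sqrt (1 + t ^+ 2), s * t / Num.sqrt (1 + t ^+ 2)).

Definition disc_kernel N z (xy : R * R) : R := rnorm (1 - z * toC xy) `^ (- N).

(** If [|v| >= 1/2], use [Im v = - Im (1 - v)]; otherwise [|1 - v| >= 1/2]. *)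
Lemma Im_le_rnorm1B v : rnorm v <= 1 -> `|complex.Im v| <= 2 * (rnorm v * rnorm (1 - v)).
Proof.
move=> v1; have [hv|hv] := lerP (2^-1) (rnorm v).
  have -> : `|complex.Im v| = `|complex.Im (1 - v)| by rewrite ImD ImN /= add0r normrN.
  apply: (le_trans (Im_le_rnorm _)).
  by rewrite mulrA ler_peMl ?rnorm_ge0 //; move: hv; lra.
apply: (le_trans (Im_le_rnorm _)); rewrite mulrCA ler_peMr ?rnorm_ge0 //.
have := rnormD (1 - v) v; rewrite subrK rnorm1; move: hv; lra.
Qed.

Lemma powRN_le_scale (k x y N : R) : 0 < k -> 0 < x -> 0 <= N -> x <= k * y ->
  y `^ (- N) <= k `^ N * x `^ (- N).
Proof.
move=> k0 x0 N0 xy; have y0 : 0 < y by rewrite -(pmulr_rgt0 _ k0); exact: lt_le_trans xy.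
rewrite !powRN ler_pdivlMr ?powR_gt0 // mulrC ler_pdivrMr ?powR_gt0 //.
rewrite -powRM ?(ltW k0) ?(ltW y0) //; apply: ge0_ler_powR => //; rewrite nnegrE ltW ?mulr_gt0 //.
Qed.

(** For [v = z toC (slope_point s t)], [|1 - v|] dominates [1 - |v|] and, through [Im v], the
    deviation of [t] from the slope [t0 = - Im z / Re z] at which [v] is real. For [|t| <= 3] this
    deviation is comparable to [|t - t0|]; for [|t| > 3], [v] stays away from 1, because
    [|Im z| <= |Re z|] gives [|t0| <= 1]. *)
Lemma disc_kernel_slope_le N z s t : 0 <= N -> rnorm z < 1 -> z != 0 ->
  `|complex.Im z| <= `|complex.Re z| -> s != 0 -> `|s| < 1 ->
  disc_kernel N z (slope_point s t) / (1 + t ^+ 2) <=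
  24 `^ N * ((1 - rnorm z * `|s| + `|t - - (complex.Im z / complex.Re z)|) `^ (- N)
    + (1 + t ^+ 2)^-1).
Proof.
move=> N0 z1 zn0 iz sn0 s1.
set a := complex.Re z; set b := complex.Im z; set c := Num.sqrt (1 + t ^+ 2).
set r := rnorm z; set v := z * toC (slope_point s t).
have r0 : 0 < r by rewrite lt_neqAle rnorm_ge0 eq_sym rnorm_eq0 zn0.
have s0 : 0 < `|s| by rewrite normr_gt0.
have c21 : c ^+ 2 = 1 + t ^+ 2 by rewrite sqr_sqrtr // addr_ge0 // sqr_ge0.
have c0 : 0 < c by rewrite sqrtr_gt0 ltr_wpDr // sqr_ge0.
have nv : rnorm v = r * `|s| by rewrite rnormM rnorm_slope.
have imv : complex.Im v = s * (b + a * t) / c.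
  by rewrite /v ImM /= -/a -/b -/c; field; rewrite gt_eqF.
have r2 : r ^+ 2 = a ^+ 2 + b ^+ 2 by rewrite sqr_rnorm.
have a2 : `|a| ^+ 2 = a ^+ 2 by rewrite real_normK ?num_real.
have b2 : `|b| ^+ 2 = b ^+ 2 by rewrite real_normK ?num_real.
have ra : r <= 2 * `|a|.
  rewrite -(@ler_pXn2r _ 2) ?nnegrE ?mulr_ge0 // ?(ltW r0) // r2 exprMn -a2 -b2.
  have : `|b| ^+ 2 <= `|a| ^+ 2 by rewrite lerXn2r ?nnegrE.
  have := sqr_ge0 `|a|; lra.
have an0 : a != 0 by rewrite -normr_gt0; move: ra r0; lra.
have rs1 : r * `|s| < 1.
  apply: (@lt_le_trans _ _ (1 * `|s|)); first by rewrite ltr_pM2r.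
  by rewrite mul1r ltW.
set e := 1 - r * `|s|; have e0 : 0 < e by rewrite subr_gt0.
have ev : e <= rnorm (1 - v).
  by have := rnormD (1 - v) v; rewrite subrK rnorm1 nv /e; lra.
set d := `|b + a * t| / (r * c).
have dv : d <= 2 * rnorm (1 - v).
  have := @Im_le_rnorm1B v; rewrite nv imv => /(_ (ltW rs1)).
  rewrite !normrM normfV (gtr0_norm c0) => h.
  rewrite /d ler_pdivrMr ?mulr_gt0 // -(ler_pM2l s0).
  move: h; rewrite ler_pdivrMr //; congr (_ <= _); ring.
have ed : e + d <= 3 * rnorm (1 - v) by move: ev dv; lra.
set t0 := - (b / a).
have bat : `|b + a * t| = `|a| * `|t - t0|.
  by rewrite -normrM /t0; congr (`|_|); field.
have dl : `|t - t0| / c <= 2 * d.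
  rewrite ler_pdivrMr //.
  have -> : 2 * d * c = 2 * `|a| / r * `|t - t0|.
    by rewrite /d bat; field; rewrite (gt_eqF c0) (gt_eqF r0).
  by rewrite ler_peMl // ler_pdivlMr // mul1r.
have t01 : `|t0| <= 1 by rewrite normrN normrM normfV ler_pdivrMr ?normr_gt0 // mul1r.
have I0 : 0 < (1 + t ^+ 2)^-1 by rewrite invr_gt0 -c21 exprn_gt0.
have I1 : (1 + t ^+ 2)^-1 <= 1.
  by rewrite invf_le1 ?lerDl ?sqr_ge0 // -c21 exprn_gt0.
have k0 : 0 < 24 `^ N :> R by apply: powR_gt0.
have tt : `|t| ^+ 2 = t ^+ 2 by rewrite real_normK ?num_real.
rewrite /disc_kernel -/v; have [t3|t3] := lerP `|t| 3.
  (* With [c <= 4], [|t - t0| <= 8 d], so [e + |t - t0| <= 8 (e + d) <= 24 |1 - v|]. *)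
  have c4 : c <= 4.
    rewrite -(@ler_pXn2r _ 2) ?nnegrE ?(ltW c0) // c21 -tt.
    have : `|t| ^+ 2 <= 3 ^+ 2 by rewrite lerXn2r ?nnegrE.
    rewrite !expr2; lra.
  have d8 : `|t - t0| <= 8 * d.
    move: dl; rewrite ler_pdivrMr // => /le_trans; apply.
    have d0 : 0 <= d by rewrite /d divr_ge0 // mulr_ge0 // ltW.
    by rewrite mulrAC (_ : 8 = 2 * 4) ?ler_wpM2r ?ler_wpM2l // -natrM.
  apply: (@le_trans _ _ (24 `^ N * (e + `|t - t0|) `^ (- N))); last first.
    by rewrite ler_wpM2l ?(ltW k0) // lerDl ltW.
  apply: (@le_trans _ _ (rnorm (1 - v) `^ (- N))); first by rewrite ler_piMr ?powR_ge0.
  apply: powRN_le_scale => //; first by rewrite ltr_wpDr.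
  by move: ed d8 e0; lra.
apply: (@le_trans _ _ (24 `^ N * (1 + t ^+ 2)^-1)); last first.
  by rewrite ler_wpM2l ?(ltW k0) // lerDr powR_ge0.
rewrite ler_pM2r // -[leRHS]mulr1 -[X in _ * X](congr1 (fun f => f (- N)) (@powR1 R)) powRN_le_scale //.
(* Here [|t - t0| / c >= (|t| - 1) / (|t| + 1) >= 1/2], so [d >= 1/4] and [|1 - v| >= 1/12]. *)
have cl : c <= 1 + `|t|.
  rewrite -(@ler_pXn2r _ 2) ?nnegrE ?(ltW c0) ?addr_ge0 // c21 -tt sqrrD expr1n mul1r.
  by rewrite lerD2r lerDl mulrn_wge0.
have : 2^-1 <= `|t - t0| / c.
  rewrite ler_pdivlMr //; have := lerB_dist t t0; move: cl t3 t01; lra.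
by move: dl ed e0; lra.
Qed.

Lemma measurable_disc_kernel N z : measurable_fun setT (disc_kernel N z).
Proof.
rewrite (_ : disc_kernel N z = fun xy => Num.sqrt
   ((1 - (complex.Re z * xy.1 - complex.Im z * xy.2)) ^+ 2
    + (complex.Re z * xy.2 + complex.Im z * xy.1) ^+ 2) `^ (- N)).
  apply: (@measurableT_comp _ _ _ _ _ _ (fun x : R => x `^ (- N))); first exact: measurable_powR.
  apply: (@measurableT_comp _ _ _ _ _ _ (@Num.sqrt R)).
    by apply: continuous_measurable_fun => x; exact: sqrt_continuous.
  apply: measurable_funD; apply: measurable_funX.
    apply: measurable_funB => //; apply: measurable_funB; exact: measurable_funM.
  by apply: measurable_funD; exact: measurable_funM.
apply/funext => xy; rewrite /disc_kernel; congr (_ `^ _).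
by rewrite /rnorm normc_def /= !ReD !ImD ReN ImN ReM ImM /= add0r sqrrN.
Qed.

Lemma disc_kernel_ge0 N z xy : 0 <= disc_kernel N z xy.
Proof. exact: powR_ge0. Qed.

(** Exchanging the coordinates of [v] gives [i conj v]. *)
Lemma disc_kernel_swap N z xy :
  disc_kernel N z (xy.2, xy.1) = disc_kernel N (conjc (z * 'i%C)) xy.
Proof.
rewrite /disc_kernel -[in RHS]rnorm_conj; congr (rnorm _ `^ _).
by apply: complex_ext; rewrite ?(Re_conj, Im_conj) !(ReD, ImD) ?(Re_conj, Im_conj) !(ReN, ImN, ReM, ImM) /=
  ?(Re_conj, Im_conj) ?ReM ?ImM /=; ring.
Qed.

(** [disc_kernel_slope_le] is integrated; since [e = 1 - |z| |s| <= 1], the factor [e^(1 - N) >= 1]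
    absorbs the bounded contribution of [1 / (1 + t^2)]. *)
Lemma circle_int_kernel_le N : 1 < N -> exists2 C : R, 0 < C & forall z s,
  rnorm z < 1 -> `|complex.Im z| <= `|complex.Re z| -> s != 0 -> `|s| < 1 ->
  (circle_int (disc_kernel N z) s <= (C * (1 - rnorm z * `|s|) `^ (1 - N))%:E)%E.
Proof.
move=> N1; have N0 : 0 <= N by move: N1; lra.
have N10 : 0 < N - 1 by rewrite subr_gt0.
have k1 : 1 <= 24 `^ N :> R.
  rewrite -[leLHS](congr1 (fun f => f N) (@powR1 R)).
  by apply: ge0_ler_powR => //; rewrite ?nnegrE // ler1n.
have k0 : 0 < 24 `^ N :> R by apply: lt_le_trans k1.
exists (24 `^ N * (2 / (N - 1) + 4)).
  by rewrite mulr_gt0 // addr_gt0 // divr_gt0.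
move=> z s z1 iz s0 s1.
(* For [z = 0] the slope [t0] has no meaning; the kernel is constantly 1. *)
have [->|zn0] := eqVneq z 0.
  rewrite rnorm0 mul0r subr0 powR1 mulr1.
  rewrite /circle_int /disc_kernel; under eq_integral do rewrite mul0r subr0 rnorm1 powR1 mul1r.
  apply: (le_trans (integral_inv1Dsqr_le R)); rewrite lee_fin.
  have := divr_ge0 (ler0n R 2) (ltW N10); move: k1; nra.
set e := 1 - rnorm z * `|s|; set t0 := - (complex.Im z / complex.Re z).
have rs1 : rnorm z * `|s| < 1.
  apply: (@le_lt_trans _ _ (1 * `|s|)); first by rewrite ler_wpM2r // ltW.
  by rewrite mul1r.
have rs0 : 0 <= rnorm z * `|s| by rewrite mulr_ge0 ?rnorm_ge0.
have e0 : 0 < e by rewrite subr_gt0.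
have e1 : 1 <= e `^ (1 - N).
  rewrite -[leLHS](powRr0 e); apply: ger_powR; last by move: N1; lra.
  by rewrite e0 /e /=; move: rs0; lra.
have mf : measurable_fun setT (fun t : R => ((e + `|t - t0|) `^ (- N))%:E).
  apply/measurable_EFinP; apply: (@measurableT_comp _ _ _ _ _ _ (fun x : R => x `^ (- N))).
    exact: measurable_powR.
  apply: measurable_funD => //; apply: measurableT_comp => //.
  by apply: measurable_funD.
have mg : measurable_fun setT (fun t : R => (1 + t ^+ 2)^-1%:E).
  by apply/measurable_EFinP; exact: measurable_inv1Dsqr.
have f0 (t : R) : (0 <= ((e + `|t - t0|) `^ (- N))%:E)%E by rewrite lee_fin powR_ge0.
have g0 (t : R) : (0 <= (1 + t ^+ 2)^-1%:E)%E by rewrite lee_fin invr_ge0 addr_ge0 // sqr_ge0.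
apply: (@le_trans _ _ (\int[mu]_t ((24 `^ N)%:E * (((e + `|t - t0|) `^ (- N))%:E + (1 + t ^+ 2)^-1%:E)))%E).
  apply: ge0_integral_mono => t _.
    by rewrite lee_fin divr_ge0 ?disc_kernel_ge0 // addr_ge0 // sqr_ge0.
  by rewrite -EFinD -EFinM lee_fin; exact: disc_kernel_slope_le.
rewrite ge0_integralZl_EFin //; [|by move=> t _; exact: adde_ge0|exact: emeasurable_funD].
rewrite ge0_integralD // -mulrA EFinM; apply: lee_wpmul2l; first by rewrite lee_fin ltW.
apply: (le_trans (leeD (integral_powR_line t0 e0 N1) (integral_inv1Dsqr_le R))).
have -> : (2 / (N - 1) + 4) * e `^ (1 - N) = 2 * (e `^ (1 - N) / (N - 1)) + 4 * e `^ (1 - N).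
  by ring.
by rewrite -[leLHS]/(_ + 4)%:E lee_fin lerD2l ler_peMr.
Qed.

Lemma measurable_circle (G : R * R -> R) s : measurable_fun setT G ->
  measurable_fun setT (fun t => (G (slope_point s t) / (1 + t ^+ 2))%:E).
Proof.
move=> mG; apply/measurable_EFinP; apply: measurable_funM; last exact: measurable_inv1Dsqr.
exact: measurableT_comp mG (measurable_slope s).
Qed.

Lemma circle_intD (G G' : R * R -> R) s :
  measurable_fun setT G -> measurable_fun setT G' ->
  (forall u, 0 <= G u) -> (forall u, 0 <= G' u) ->
  circle_int (fun u => G u + G' u) s = (circle_int G s + circle_int G' s)%E.
Proof.
move=> mG mG' G0 G0'; rewrite /circle_int -ge0_integralD //.
- by apply: eq_integral => t _; rewrite mulrDl EFinD.
- by move=> t _; rewrite lee_fin divr_ge0 // addr_ge0 // sqr_ge0.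
- exact: (measurable_circle s mG).
- by move=> t _; rewrite lee_fin divr_ge0 // addr_ge0 // sqr_ge0.
- exact: (measurable_circle s mG').
Qed.

Lemma circle_intZ (G : R * R -> R) (a : R) s : measurable_fun setT G ->
  (forall u, 0 <= G u) -> 0 <= a ->
  circle_int (fun u => a * G u) s = (a%:E * circle_int G s)%E.
Proof.
move=> mG G0 a0; rewrite /circle_int -ge0_integralZl_EFin //.
- by apply: eq_integral => t _; rewrite -mulrA EFinM.
- by move=> t _; rewrite lee_fin divr_ge0 // addr_ge0 // sqr_ge0.
- exact: (measurable_circle s mG).
Qed.

End CircleKernel.

Section DiscKernelIntegral.
Variable R : realType.
Local Notation mu := (@lebesgue_measure R).
Local Notation cmu := (@completed_lebesgue_measure R).

Lemma measurable_swap_pair : measurable_fun setT (fun xy : R * R => (xy.2, xy.1)).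
Proof. exact/measurable_fun_pair. Qed.

Lemma disc_integral_swap_le (G : R * R -> R) (w Phi : R -> R) :
  measurable_fun setT G -> (forall u, 0 <= G u) ->
  (forall s, 0 <= s < 1 -> 0 < w s) ->
  (forall s, 0 <= s < 1 -> 0 <= Phi s) ->
  (forall s : R, s != 0 -> `|s| < 1 ->
     (circle_int (fun u => G (u.2, u.1)) s <= (Phi `|s|)%:E)%E) ->
  (\int[(mu \x mu)%E]_(xy in @disc2 R) (G xy * w (rnorm (toC xy)))%:E
    <= 2%:E * \int[cmu]_(s in `[0%R, 1%R[) (w s * Phi s)%:E)%E.
Proof.
move=> mG G0 w0 P0 GP.
apply: ge0_integral_le_measurable => [z zD|h mh h0 hle].
  by rewrite lee_fin mulr_ge0 // ltW // w0 // rnorm_ge0.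
have mG' : measurable_fun setT (fun u => G (u.2, u.1)).
  exact: measurableT_comp mG measurable_swap_pair.
apply: le_trans (@disc_integral_le _ (fun u => G (u.2, u.1)) w Phi mG' _ w0 P0 GP); last by [].
rewrite ge0_integral_swap // [leRHS]integral_mkcond; apply: ge0_integral_mono => // u _.
have sw : rnorm (toC (u.2, u.1)) = rnorm (toC u).
  by apply/eqP; rewrite -(eqrXn2 (n := 2)) ?rnorm_ge0 // !sqr_rnorm /= addrC.
apply: (le_trans (hle _)).
rewrite !patchE (_ : ((u.2, u.1) \in @disc2 R) = (u \in @disc2 R)) ?sw //.
by apply/idP/idP; rewrite !inE /disc2 /disc /= sw.
Qed.

(** When [|Im z| > |Re z|], the coordinates are exchanged, which replaces [z] by [conj (i z)] and so
    interchanges the two sizes. [C] is chosen before [w], [z], [A] and [B], because [A] and [B] will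
    depend on the point and on the truncation. *)
Lemma disc_kernel_integral_le (N1 N2 : R) : 1 < N1 -> 1 < N2 ->
  exists2 C : R, 0 < C & forall (w : R -> R) (z : R[i]) (A B : R),
  (forall s, 0 <= s < 1 -> 0 < w s) -> rnorm z < 1 -> 0 <= A -> 0 <= B ->
  (\int[(mu \x mu)%E]_(xy in @disc2 R)
     ((A * (disc_kernel N1 z xy + disc_kernel N1 (conjc z) xy)
       + B * (disc_kernel N2 z xy + disc_kernel N2 (conjc z) xy)) * w (rnorm (toC xy)))%:E
   <= 2%:E * \int[cmu]_(s in `[0%R, 1%R[)
     (w s * (C * (A * (1 - rnorm z * s) `^ (1 - N1) + B * (1 - rnorm z * s) `^ (1 - N2))))%:E)%E.
Proof.
move=> N11 N21; have [C1 C10 hC1] := circle_int_kernel_le N11.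
have [C2 C20 hC2] := circle_int_kernel_le N21.
exists (2 * (C1 + C2)); first by rewrite mulr_gt0 // addr_gt0.
move=> w z A B w0 z1 A0 B0.
pose Phi s := 2 * (C1 + C2) * (A * (1 - rnorm z * s) `^ (1 - N1) + B * (1 - rnorm z * s) `^ (1 - N2)).
have P0 s : 0 <= s < 1 -> 0 <= Phi s by move=> _; rewrite /Phi; nonneg.
have circ z1' z2' s : s != 0 -> `|s| < 1 ->
   rnorm z1' = rnorm z -> rnorm z2' = rnorm z ->
   `|complex.Im z1'| <= `|complex.Re z1'| -> `|complex.Im z2'| <= `|complex.Re z2'| ->
   (circle_int (fun xy => A * (disc_kernel N1 z1' xy + disc_kernel N1 z2' xy)
     + B * (disc_kernel N2 z1' xy + disc_kernel N2 z2' xy))%R s <= (Phi `|s|)%:E)%E.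
  move=> s0 s1 n1 n2 i1 i2.
  have mK N u : measurable_fun setT (disc_kernel N u) by exact: measurable_disc_kernel.
  have mD N : measurable_fun setT (fun xy => disc_kernel N z1' xy + disc_kernel N z2' xy).
    by apply: measurable_funD; exact: mK.
  have mZ N (c : R) : measurable_fun setT (fun xy => c * (disc_kernel N z1' xy + disc_kernel N z2' xy)).
    by apply: measurable_funM => //; exact: mD.
  have D0 N xy : 0 <= disc_kernel N z1' xy + disc_kernel N z2' xy.
    by rewrite addr_ge0 ?disc_kernel_ge0.
  rewrite circle_intD // ?circle_intZ // ?circle_intD //; last 6 first.
  - by move=> xy; exact: disc_kernel_ge0.
  - by move=> xy; exact: disc_kernel_ge0.
  - by move=> xy; exact: disc_kernel_ge0.
  - by move=> xy; exact: disc_kernel_ge0.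
  - by move=> xy; rewrite mulr_ge0.
  - by move=> xy; rewrite mulr_ge0.
  have h11 := hC1 z1' s; have h12 := hC1 z2' s; have h21 := hC2 z1' s; have h22 := hC2 z2' s.
  move: h11 h12 h21 h22; rewrite n1 n2 => /(_ z1 i1 s0 s1) h11 /(_ z1 i2 s0 s1) h12 /(_ z1 i1 s0 s1) h21 /(_ z1 i2 s0 s1) h22.
  apply: (le_trans (leeD (lee_wpmul2l _ (leeD h11 h12)) (lee_wpmul2l _ (leeD h21 h22)))); rewrite ?lee_fin //.
  rewrite /Phi.
  set a := _ `^ (1 - N1); set b := _ `^ (1 - N2).
  rewrite -subr_ge0 (_ : _ - _ = 2 * (C2 * (A * a)) + 2 * (C1 * (B * b))); last by ring.
  by have a0 : 0 <= a := powR_ge0 _ _; have b0 : 0 <= b := powR_ge0 _ _; rewrite addr_ge0 // !mulr_ge0 // ltW.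
have mG : measurable_fun setT (fun xy => A * (disc_kernel N1 z xy + disc_kernel N1 (conjc z) xy)
     + B * (disc_kernel N2 z xy + disc_kernel N2 (conjc z) xy)).
  by apply: measurable_funD; apply: measurable_funM => //; apply: measurable_funD; exact: measurable_disc_kernel.
have G0 xy : 0 <= A * (disc_kernel N1 z xy + disc_kernel N1 (conjc z) xy)
     + B * (disc_kernel N2 z xy + disc_kernel N2 (conjc z) xy).
  by rewrite addr_ge0 // mulr_ge0 // addr_ge0 ?disc_kernel_ge0.
have [iz|iz] := lerP `|complex.Im z| `|complex.Re z|.
  apply: (@disc_integral_le _ _ w Phi) => // s s0 s1; apply: circ => //; first exact: rnorm_conj.
  by rewrite Im_conj Re_conj normrN.
apply: (@disc_integral_swap_le _ w Phi) => // s s0 s1.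
have -> : (fun u => A * (disc_kernel N1 z (u.2, u.1) + disc_kernel N1 (conjc z) (u.2, u.1))
     + B * (disc_kernel N2 z (u.2, u.1) + disc_kernel N2 (conjc z) (u.2, u.1)))
  = (fun u => A * (disc_kernel N1 (conjc (z * 'i%C)) u + disc_kernel N1 (conjc (conjc z * 'i%C)) u)
     + B * (disc_kernel N2 (conjc (z * 'i%C)) u + disc_kernel N2 (conjc (conjc z * 'i%C)) u)).
  by apply/funext => u; rewrite !disc_kernel_swap.
have ni : rnorm ('i%C : R[i]) = 1.
  by apply/eqP; rewrite -(eqrXn2 (n := 2)) ?rnorm_ge0 // sqr_rnorm /= expr0n expr1n add0r.
apply: circ => //; rewrite ?rnorm_conj ?rnormM ?rnorm_conj ?ni ?mulr1 //;
  rewrite Im_conj Re_conj ImM ReM ?Im_conj ?Re_conj /= !mulr0 !mulr1 ?addr0 ?sub0r !normrN; exact: ltW.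
Qed.

End DiscKernelIntegral.

(** * The weight condition and the Bergman norm of the kernel *)

Section CompletedMeasurable.
Variable R : realType.

Lemma measurable_completed (f : R -> R) : measurable_fun setT f ->
  measurable_fun setT (f : caratheodory_type (wlength (@idfun R))^*%mu -> R).
Proof.
move=> mf _ B mB; rewrite setTI; apply: sub_caratheodory.
by rewrite -[_ @^-1` _]setTI; exact: mf.
Qed.

Lemma measurable_completed_set (A : set R) : measurable A ->
  measurable (A : set (caratheodory_type (wlength (@idfun R))^*%mu)).
Proof. exact: sub_caratheodory. Qed.

End CompletedMeasurable.

Section Weight.
Variables (R : realType) (w : R -> R) (q : R).
Local Notation cmu := (@completed_lebesgue_measure R).
Hypothesis q_gt0 : 0 < q.
Hypothesis w_weight : is_weight w.
Implicit Types (r s a : R).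

Local Notation W r := (\int[cmu]_(s in `[r, 1%R[) w s).

Lemma weight_gt0 s : 0 <= s < 1 -> 0 < w s.
Proof. by case: w_weight => h _; exact: h. Qed.

Lemma measurable_weight : measurable_fun (`[0%R, 1%R[ : set (caratheodory_type (wlength (@idfun R))^*%mu)) w.
Proof. by case: w_weight => _ /integrableP[/measurable_EFinP]. Qed.

Lemma weight_EFin r : 0 <= r <= 1 ->
  (\int[cmu]_(s in `[r, 1%R[) (w s)%:E = (W r)%:E)%E.
Proof.
move=> /andP[r0 r1]; rewrite /Rintegral fineK //.
apply: integrable_fin_num; first exact: measurable_completed_set.
have [_ h] := w_weight; apply: integrableS h => //; try exact: measurable_completed_set.
by move=> x /=; rewrite !in_itv /= => /andP[rx ->]; rewrite (le_trans r0 rx).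
Qed.

Lemma weightZ_EFin r (k : R) : 0 <= r <= 1 -> 0 <= k ->
  (\int[cmu]_(s in `[r, 1%R[) (k%:E * (w s)%:E) = (k * W r)%:E)%E.
Proof.
move=> r01 k0; have /andP[r0 _] := r01; rewrite EFinM -weight_EFin //.
have sub : (`[r, 1%R[ `<=` (`[0%R, 1%R[ : set R))%classic.
  by move=> s /=; rewrite !in_itv /= => /andP[h ->]; rewrite (le_trans _ h).
have mr : measurable (`[r, 1%R[ : set (caratheodory_type (wlength (@idfun R))^*%mu)).
  by apply: measurable_completed_set; exact: measurable_itv.
have m01 : measurable (`[0%R, 1%R[ : set (caratheodory_type (wlength (@idfun R))^*%mu)).
  by apply: measurable_completed_set; exact: measurable_itv.
have mw : measurable_fun (`[r, 1%R[ : set (caratheodory_type (wlength (@idfun R))^*%mu)) (EFin \o w).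
  by apply/measurable_EFinP; exact: measurable_funS m01 sub measurable_weight.
have w0 s : `[r, 1%R[%classic s -> (0 <= (EFin \o w) s)%E.
  by move=> /sub; rewrite /= in_itv /= => h; rewrite lee_fin ltW // weight_gt0.
exact: (@ge0_integralZl_EFin _ _ _ cmu _ mr _ w0 mw _ k0).
Qed.

Hypothesis w_cond : exists2 c : R, 0 < c & forall r : R, 0 < r < 1 ->
  \int[cmu]_(s in `[0, r]) (w s / (1 - s) `^ q) <= c * ((1 - r) `^ q)^-1 * W r.

Lemma measurable_weight_pow r a : 0 <= r < 1 ->
  measurable_fun (`[0%R, 1%R[ : set (caratheodory_type (wlength (@idfun R))^*%mu))
    (fun s => (w s * (1 - r * s) `^ (- a))%:E).
Proof.
move=> r01; apply/measurable_EFinP; apply: measurable_funM; first exact: measurable_weight.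
apply: measurable_funTS; apply: measurable_completed.
apply: (@measurableT_comp _ _ _ _ _ _ (fun x : R => x `^ (- a))); first exact: measurable_powR.
by apply: measurable_funB.
Qed.

Lemma powRN_anti x y a : 0 < x -> x <= y -> 0 <= a -> y `^ (- a) <= x `^ (- a).
Proof.
move=> x0 xy a0; have y0 : 0 < y by exact: lt_le_trans xy.
rewrite !powRN lef_pV2 ?posrE ?powR_gt0 //.
by apply: ge0_ler_powR => //; rewrite nnegrE ltW.
Qed.

(** The interval is split at [rho = sqrt r]. On [[rho, 1)] simply [1 - r s >= 1 - r]. Below [rho]
    the exponent is split as [(a - q) + q]: [1 - r s >= 1 - r] serves the first part and
    [1 - r s >= 1 - s] the second, the condition on [w] applies at [rho], and [1 - r <= 2 (1 - rho)]
    converts the resulting power. *)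
Lemma weight_integral_le : exists2 C : R, 0 < C & forall r a, 0 <= r < 1 -> q <= a ->
  (\int[cmu]_(s in `[0%R, 1%R[) (w s * (1 - r * s) `^ (- a))%:E
   <= (C * (1 - r) `^ (- a) * W (Num.sqrt r))%:E)%E.
Proof.
have [c c0 hc] := w_cond.
have k0 : 0 < 2 `^ q :> R by apply: powR_gt0.
exists (1 + c * 2 `^ q); first by rewrite addr_gt0 // mulr_gt0.
move=> r a r01 qa; have /andP[r0 r1] := r01.
have a0 : 0 <= a by rewrite (le_trans _ qa) // ltW.
have W0 x : 0 <= x <= 1 -> 0 <= W x.
  move=> /andP[x0 x1]; apply: Rintegral_ge0 => s; rewrite /= in_itv /= => /andP[xs s1].
  by rewrite ltW // weight_gt0 // s1 (le_trans x0).
set rho := Num.sqrt r.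
have rho0 : 0 <= rho by exact: sqrtr_ge0.
have rho2 : rho ^+ 2 = r by rewrite sqr_sqrtr.
have rho1 : rho < 1 by rewrite -(@ltr_pXn2r _ 2) ?nnegrE // rho2 expr1n.
have rrho : 1 - r <= 2 * (1 - rho).
  rewrite -rho2 (_ : 1 - rho ^+ 2 = (1 + rho) * (1 - rho)); last by ring.
  by rewrite ler_wpM2r ?subr_ge0 ?(ltW rho1) //; move: rho1; lra.
have e0 : 0 < 1 - r by rewrite subr_gt0.
have f0 s : 0 <= s < 1 -> (0 <= (w s * (1 - r * s) `^ (- a))%:E)%E.
  by move=> s01; rewrite lee_fin mulr_ge0 ?powR_ge0 // ltW // weight_gt0.
have mf := @measurable_weight_pow r a r01.
have -> : `[0%R, 1%R[%classic = `[0%R, rho[ `|` `[rho, 1%R[ :> set R.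
  apply/seteqP; split => s /=; rewrite !in_itv /=.
    by move=> /andP[-> ->]; case: ltP => _; [left|right].
  by case=> /andP[]; [move=> -> h; rewrite (lt_trans h)|move=> h ->; rewrite (le_trans _ h)].
have sub1 : (`[0%R, rho[ `<=` (`[0%R, 1%R[ : set R))%classic.
  by move=> s /=; rewrite !in_itv /= => /andP[-> h]; rewrite (lt_trans h).
have sub2 : (`[rho, 1%R[ `<=` (`[0%R, 1%R[ : set R))%classic.
  by move=> s /=; rewrite !in_itv /= => /andP[h ->]; rewrite (le_trans _ h).
have mset (A : interval R) : measurable ([set` A] : set (caratheodory_type (wlength (@idfun R))^*%mu)).
  by apply: measurable_completed_set; exact: measurable_itv.
have mU : measurable (`[0%R, rho[ `|` `[rho, 1%R[ : set (caratheodory_type (wlength (@idfun R))^*%mu)).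
  exact: measurableU.
have subU : (`[0%R, rho[ `|` `[rho, 1%R[ `<=` (`[0%R, 1%R[ : set R))%classic.
  by move=> s [] //; [exact: sub1|exact: sub2].
rewrite (ge0_integral_setU cmu (mset _) (mset _)); last 3 first.
- exact: measurable_funS mf.
- by move=> s /subU; rewrite /= in_itv; exact: f0.
- apply/disj_setPS => s /= []; rewrite !in_itv /= => /andP[_ h1] /andP[h2 _].
  by have := lt_le_trans h1 h2; rewrite ltxx.
rewrite !mulrDl mul1r [X in X%:E]addrC EFinD; apply: leeD.
  (* The condition on [w] is given at positive radii; for [r = 0] this piece is empty. *)
  have [r00|rn0] := eqVneq r 0.
    rewrite (_ : `[0%R, rho[%classic = set0) ?integral_set0 ?lee_fin.
      by rewrite !mulr_ge0 ?powR_ge0 ?(ltW c0) ?(ltW k0) // W0 // rho0 ltW.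
    by apply/seteqP; split => s //=; rewrite in_itv /= /rho r00 sqrtr0 => /andP[/le_lt_trans h /h]; rewrite ltxx.
  have rhop : 0 < rho by rewrite sqrtr_gt0 lt_neqAle eq_sym rn0.
  have rr1 : 0 < rho < 1 by rewrite rhop.
  have er0 : 0 < 1 - rho by rewrite subr_gt0.
  have cc s : 0 <= s <= rho -> (1 - s) `^ (- q) <= (1 - rho) `^ (- q).
    by move=> /andP[_ sr]; apply: powRN_anti => //; [rewrite lerB|exact: ltW].
  have mg : measurable_fun (`[0%R, rho] : set (caratheodory_type (wlength (@idfun R))^*%mu))
    (fun s => (w s / (1 - s) `^ q)%:E).
    rewrite (_ : (fun s => _) = (fun s => (w s * (1 - s) `^ (- q))%:E)); last first.
      by apply/funext => s; rewrite powRN.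
    apply/measurable_EFinP; apply: measurable_funM.
      apply: measurable_funS measurable_weight => // s /=; rewrite !in_itv /= => /andP[-> h].
      exact: le_lt_trans h rho1.
    apply: measurable_funTS; apply: measurable_completed.
    apply: (@measurableT_comp _ _ _ _ _ _ (fun x : R => x `^ (- q))); first exact: measurable_powR.
    by apply: measurable_funB.
  have g0 s : 0 <= s <= rho -> 0 <= w s / (1 - s) `^ q.
    move=> /andP[s0 sr]; rewrite divr_ge0 ?powR_ge0 // ltW // weight_gt0 // s0.
    exact: le_lt_trans sr rho1.
  (* The condition bounds a real-valued integral, which is 0 by convention when the extended one is
     infinite; finiteness is therefore checked before passing from one to the other. *)
  have fg : (\int[cmu]_(s in `[0%R, rho]) (w s / (1 - s) `^ q)%:E =
      (\int[cmu]_(s in `[0%R, rho]) (w s / (1 - s) `^ q))%:E)%E.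
    rewrite /Rintegral fineK // ge0_fin_numE; last first.
      by apply: integral_ge0 => s; rewrite /= in_itv /= lee_fin; exact: g0.
    apply: (@le_lt_trans _ _ (\int[cmu]_(s in `[0%R, 1%R[) (((1 - rho) `^ (- q))%:E * (w s)%:E))%E).
      apply: (@le_trans _ _ (\int[cmu]_(s in `[0%R, rho]) (((1 - rho) `^ (- q))%:E * (w s)%:E))%E).
        apply: ge0_integral_mono => s; rewrite /= in_itv /= => s01; first by rewrite lee_fin g0.
        rewrite -EFinM lee_fin -powRN mulrC; apply: ler_wpM2r; last exact: cc.
        by move: s01 => /andP[s0 sr]; rewrite ltW // weight_gt0 // s0 (le_lt_trans sr).
      apply: (ge0_subset_integral cmu (mset _) (mset _)).
      - by apply: measurable_funeM; apply/measurable_EFinP; exact: measurable_weight.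
      - move=> s; rewrite /= in_itv /= => h.
        by rewrite mule_ge0 // lee_fin ?powR_ge0 // ltW // weight_gt0.
      - move=> s /=; rewrite !in_itv /= => /andP[-> h]; exact: le_lt_trans h rho1.
    by rewrite weightZ_EFin ?powR_ge0 ?lexx ?ler01 // ltry.
  apply: (@le_trans _ _ (((1 - r) `^ (- (a - q)))%:E * (\int[cmu]_(s in `[0%R, rho]) (w s / (1 - s) `^ q))%:E)%E).
    rewrite -fg -(ge0_integralZl_EFin cmu (mset _)) ?powR_ge0 //.
    have sub3 : (`[0%R, rho] `<=` (`[0%R, 1%R[ : set R))%classic.
      by move=> s /=; rewrite !in_itv /= => /andP[-> h]; exact: le_lt_trans h rho1.
    apply: (@le_trans _ _ (\int[cmu]_(s in `[0%R, rho]) (w s * (1 - r * s) `^ (- a))%:E)%E).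
      apply: (ge0_subset_integral cmu (mset _) (mset _)).
      - exact: measurable_funS mf.
      - by move=> s /sub3; rewrite /= in_itv; exact: f0.
      - by move=> s /=; rewrite !in_itv /= => /andP[-> /ltW].
    apply: ge0_integral_mono => s hs; first by apply: f0; move: (sub3 _ hs); rewrite /= in_itv.
    move: (sub3 _ hs); rewrite /= in_itv /= => s01; have /andP[s0 s1] := s01.
    rewrite -EFinM lee_fin mulrCA; apply: ler_wpM2l; first by rewrite ltW // weight_gt0.
    have rs : 1 - r <= 1 - r * s by rewrite lerB // ler_piMr // ltW.
    have rs0 : 0 < 1 - r * s by exact: lt_le_trans rs.
    have -> : - a = - (a - q) + - q by ring.
    rewrite powRD ?(gt_eqF rs0) ?implybT // -powRN; apply: ler_pM; rewrite ?powR_ge0 //.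
      by apply: powRN_anti => //; rewrite subr_ge0.
    by apply: powRN_anti; rewrite ?subr_gt0 // ?(ltW q_gt0) // lerB // ler_piMl // ltW.
  rewrite -EFinM lee_fin.
  apply: (le_trans (ler_wpM2l (powR_ge0 _ _) (hc _ rr1))).
  rewrite mulrA; apply: ler_wpM2r; first by rewrite W0 // rho0 ltW.
  have -> : - a = - (a - q) + - q by ring.
  rewrite powRD ?(gt_eqF e0) ?implybT // -powRN [leRHS]mulrCA.
  apply: ler_wpM2l; first exact: powR_ge0.
  rewrite -mulrA; apply: ler_wpM2l; first exact: ltW.
  by apply: powRN_le_scale => //; exact: ltW.
apply: (@le_trans _ _ (\int[cmu]_(s in `[rho, 1%R[) (((1 - r) `^ (- a))%:E * (w s)%:E))%E).
  apply: ge0_integral_mono => s; rewrite /= in_itv /= => s01.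
    by apply: f0; move: s01 => /andP[h ->]; rewrite (le_trans _ h).
  have s02 : 0 <= s < 1 by move: s01 => /andP[h ->]; rewrite (le_trans _ h).
  move: s02 => /andP[s0 s1].
  rewrite -EFinM lee_fin mulrC; apply: ler_wpM2r; first by rewrite ltW // weight_gt0 // s0.
  by apply: powRN_anti => //; rewrite lerB // ler_piMr // ltW.
by rewrite weightZ_EFin ?powR_ge0 // rho0 ltW.
Qed.

End Weight.

(** * Pointwise bound of the integrand *)

Section KernelPointwise.
Variable R : realType.

Lemma powRD_le (a b p : R) : 0 <= a -> 0 <= b -> 0 <= p ->
  (a + b) `^ p <= 2 `^ p * (a `^ p + b `^ p).
Proof.
wlog ab : a b / a <= b.
  by move=> h a0 b0; have [/h|/ltW/h] := leP a b; [|rewrite addrC [b `^ _ + _]addrC]; exact.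
move=> a0 b0 p0; apply: (@le_trans _ _ (2 `^ p * b `^ p)).
  rewrite -powRM //; apply: ge0_ler_powR => //; rewrite ?nnegrE ?addr_ge0 ?mulr_ge0 //; lra.
by rewrite ler_wpM2l ?powR_ge0 // lerDr powR_ge0.
Qed.

(** By [y <= 2 M], [M^(- 2 lambda p) y^(2 lambda)] is at most a constant times [M^kappa], and
    [M <= D + m] splits this into [D^kappa] and [m^kappa], the latter cancelling [kappa] in the
    exponent of [m]. In the error term [y <= 1] and [m <= 2] give [1 <= 2^(q+1) m^(-(q+1))]. *)
Lemma kernel_pointwise (lambda p q C : R) : 0 <= lambda -> 0 < p <= 1 -> 0 < q -> 0 <= C ->
  let alpha := (q + 2 * lambda + 1) / p - 2 * lambda - 2 in
  let kappa := 2 * lambda * (1 - p) in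
  exists2 C' : R, 0 < C' & forall K M m D y tau : R,
  0 < m -> m <= M -> m <= 2 -> 0 <= D -> M <= D + m -> 0 <= y -> y <= 1 -> y <= 2 * M ->
  0 <= tau -> 0 <= K ->
  K <= C * (M `^ (- (2 * lambda)) * m `^ (- (alpha + 2))) + C * tau ->
  K `^ p * y `^ (2 * lambda) <=
    C' * (D `^ kappa * m `^ (- (q + 1 + kappa)) + (1 + tau `^ p) * m `^ (- (q + 1))).
Proof.
move=> l0 /andP[p0 p1] q0 C0 alpha kappa.
have ka0 : 0 <= kappa by rewrite !mulr_ge0 ?subr_ge0.
have ap : (alpha + 2) * p = q + 1 + kappa.
  by rewrite /alpha /kappa; field; rewrite gt_eqF.
have l2 : 0 <= 2 * lambda by rewrite mulr_ge0.
pose c1 := C `^ p * 2 `^ p * 2 `^ (2 * lambda) * 2 `^ kappa.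
pose c2 := C `^ p * 2 `^ p * 2 `^ (q + 1).
have c10 : 0 <= c1 by rewrite /c1; nonneg.
have c20 : 0 <= c2 by rewrite /c2; nonneg.
exists (c1 + c2 + 1); first by rewrite ltr_wpDl // addr_ge0.
move=> K M m D y tau m0 mM m2 D0 MD y0 y1 yM t0 K0 hK.
have M0 : 0 < M by exact: lt_le_trans mM.
set X := M `^ (- (2 * lambda)) * m `^ (- (alpha + 2)) in hK.
have X0 : 0 <= X by rewrite /X; nonneg.
have Kp : K `^ p <= C `^ p * 2 `^ p * (X `^ p + tau `^ p).
  rewrite -mulrDr in hK; rewrite -mulrA; apply: (@le_trans _ _ ((C * (X + tau)) `^ p)).
    by apply: ge0_ler_powR => //; rewrite ?nnegrE ?mulr_ge0 ?addr_ge0 // ltW.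
  by rewrite powRM ?addr_ge0 // ler_wpM2l ?powR_ge0 // powRD_le // ltW.
have Xp : X `^ p * y `^ (2 * lambda) <=
   2 `^ (2 * lambda) * 2 `^ kappa * (D `^ kappa * m `^ (- (q + 1 + kappa)) + m `^ (- (q + 1))).
  have yl : y `^ (2 * lambda) <= 2 `^ (2 * lambda) * M `^ (2 * lambda).
    rewrite -powRM ?(ltW M0) //; apply: ge0_ler_powR => //; rewrite ?nnegrE ?mulr_ge0 ?(ltW M0) //.
  have Mk : M `^ kappa <= 2 `^ kappa * (D `^ kappa + m `^ kappa).
    apply: le_trans (powRD_le D0 (ltW m0) ka0).
    by apply: ge0_ler_powR => //; rewrite ?nnegrE ?addr_ge0 // ltW.
  rewrite /X powRM ?powR_ge0 // -!powRrM (mulNr (alpha + 2)) ap.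
  have mk : m `^ (- (q + 1)) = m `^ kappa * m `^ (- (q + 1 + kappa)).
    by rewrite -powRD ?(gt_eqF m0) ?implybT //; congr (_ `^ _); ring.
  rewrite mk -mulrDl mulrAC [leRHS]mulrA; apply: ler_wpM2r; first exact: powR_ge0.
  apply: (le_trans (ler_wpM2l (powR_ge0 _ _) yl)).
  rewrite mulrCA -!mulrA; apply: ler_wpM2l; first exact: powR_ge0.
  rewrite -powRD ?(gt_eqF M0) ?implybT // (_ : _ + _ = kappa) //.
  by rewrite /kappa; ring.
have tp : tau `^ p * y `^ (2 * lambda) <= 2 `^ (q + 1) * (tau `^ p * m `^ (- (q + 1))).
  rewrite mulrCA; apply: ler_wpM2l; first exact: powR_ge0.
  apply: (@le_trans _ _ 1).
    rewrite -[leRHS](congr1 (fun f => f (2 * lambda)) (@powR1 R)).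
    by apply: ge0_ler_powR => //; rewrite nnegrE.
  rewrite powRN ler_pdivlMr ?powR_gt0 // mul1r; apply: ge0_ler_powR => //; rewrite ?nnegrE ?addr_ge0 // ltW //.
apply: (le_trans (ler_wpM2r (powR_ge0 _ _) Kp)).
set Y := y `^ _ in Xp tp *.
have -> : C `^ p * 2 `^ p * (X `^ p + tau `^ p) * Y = C `^ p * 2 `^ p * (X `^ p * Y + tau `^ p * Y) by ring.
set U := D `^ kappa * _ in Xp *; set V := m `^ (- (q + 1)) in Xp tp *.
have U0 : 0 <= U by rewrite /U; nonneg.
have V0 : 0 <= V by rewrite /V; nonneg.
have cp0 : 0 <= C `^ p * 2 `^ p by nonneg.
have tp0 : 0 <= tau `^ p := powR_ge0 _ _.
apply: (le_trans (ler_wpM2l cp0 (lerD Xp tp))).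
rewrite -subr_ge0 (_ : _ - _ = c1 * (tau `^ p * V) + c2 * (U + V) + (U + (1 + tau `^ p) * V)).
  by nonneg.
by rewrite /c1 /c2; ring.
Qed.

End KernelPointwise.

Section KernelIntegral.
Variable R : realType.
Implicit Types z v : R[i].

(* [|1 - conj z v|^2 - |z - v|^2 = (1 - |z|^2) (1 - |v|^2)]. *)
Lemma rnormB_le_1B z v : rnorm z <= 1 -> rnorm v <= 1 ->
  rnorm (z - v) <= rnorm (1 - z * conjc v).
Proof.
move=> z1 v1; rewrite -(@ler_pXn2r _ 2) ?nnegrE ?rnorm_ge0 // -subr_ge0.
have -> : rnorm (1 - z * conjc v) ^+ 2 - rnorm (z - v) ^+ 2
    = (1 - rnorm z ^+ 2) * (1 - rnorm v ^+ 2).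
  rewrite !sqr_rnorm !(ReD, ImD, ReN, ImN, ReM, ImM, Re_conj, Im_conj) /=; ring.
by rewrite mulr_ge0 // subr_ge0 expr_le1 ?rnorm_ge0.
Qed.

(** [1 - z v = (1 - z^2) + z (z - v)], and [rnormB_le_1B] treats the last factor. This is where
    [|1 - z^2|] enters. *)
Lemma rnorm1M_triangle z v : rnorm z <= 1 -> rnorm v <= 1 ->
  rnorm (1 - z * v) <= rnorm (1 - z ^+ 2) + rnorm (1 - z * conjc v).
Proof.
move=> z1 v1; have -> : 1 - z * v = 1 - z ^+ 2 + z * (z - v) by ring.
apply: (le_trans (rnormD _ _)); rewrite lerD2l rnormM.
apply: le_trans (rnormB_le_1B z1 v1).
by rewrite ler_piMl ?rnorm_ge0.
Qed.

(** The two numbers on the right differ by [2 |z| |Im v|] in modulus, which suffices for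
    [|z| >= 1/2]; for smaller [z] each modulus is at least [1 - |z|]. *)
Lemma Im_le_rnorm1M z v : rnorm z <= 1 -> rnorm v <= 1 ->
  `|complex.Im v| <= rnorm (1 - z * v) + rnorm (1 - z * conjc v).
Proof.
move=> z1 v1; have iv := le_trans (Im_le_rnorm v) v1.
have iv0 : 0 <= `|complex.Im v| := normr_ge0 _.
have hz : 2 * (rnorm z * `|complex.Im v|) <= rnorm (1 - z * v) + rnorm (1 - z * conjc v).
  have := rnormD (1 - z * conjc v) (- (1 - z * v)); rewrite rnormN addrC.
  have -> : - (1 - z * v) + (1 - z * conjc v) = z * (v - conjc v) by ring.
  have -> : rnorm (z * (v - conjc v)) = 2 * (rnorm z * `|complex.Im v|); last by rewrite addrC.
  rewrite rnormM mulrCA; congr (_ * _); apply/eqP.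
  rewrite -(eqrXn2 (n := 2)) ?rnorm_ge0 ?mulr_ge0 // sqr_rnorm ReD ImD ReN ImN Re_conj Im_conj /=.
  by rewrite exprMn real_normK ?num_real //; apply/eqP; ring.
have h1 u : rnorm u <= 1 -> 1 - rnorm z <= rnorm (1 - z * u).
  move=> u1; have := rnormD (1 - z * u) (z * u); rewrite subrK rnorm1 rnormM.
  have : rnorm z * rnorm u <= rnorm z by rewrite ler_piMr ?rnorm_ge0.
  lra.
have := h1 v v1; have := h1 (conjc v); rewrite rnorm_conj => /(_ v1).
have [h|h] := lerP (2^-1) (rnorm z); last by move: h hz iv; lra.
have : `|complex.Im v| <= 2 * (rnorm z * `|complex.Im v|) by rewrite mulrA ler_peMl //; move: h; lra.
by move: hz; lra.
Qed.

End KernelIntegral.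

(** * The Bergman norm of the truncated kernel *)

Section BergmanKernel.
Variables (R : realType) (lambda p q : R) (w : R -> R).
Hypothesis lambda_ge0 : 0 <= lambda.
Hypothesis p01 : 0 < p <= 1.
Hypothesis q_gt0 : 0 < q.
Let alpha := (q + 2 * lambda + 1) / p - 2 * lambda - 2.
Let kappa := 2 * lambda * (1 - p).
Implicit Types (z v : R[i]) (xy : R * R).

(** As [p <= 1], [alpha >= q - 1]. *)
Lemma alpha_gtN1 : -1 < alpha.
Proof.
have /andP[p0 p1] := p01; rewrite /alpha.
have h : q + 2 * lambda + 1 <= (q + 2 * lambda + 1) / p.
  have x0 : 0 <= q + 2 * lambda + 1 by rewrite !addr_ge0 ?mulr_ge0 // ltW.
  by rewrite ler_pdivlMr // ler_piMr.
by move: h q_gt0; lra.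
Qed.

Lemma kappa_ge0 : 0 <= kappa.
Proof. by have /andP[_ p1] := p01; rewrite /kappa !mulr_ge0 ?subr_ge0. Qed.

(** The minimum [m] is one of [|1 - z v|] and [|1 - conj z v|], so [m^(-n)] is at most the sum of
    the two disc kernels, for which the circle estimate is available. *)
Lemma dunkl_kernel_pointwise : exists2 C : R, 0 < C & exists k, forall z xy N,
  rnorm z < 1 -> rnorm (toC xy) < 1 ->
  rnorm (dunkl_kernel lambda alpha N z (toC xy)) `^ p * `|xy.2| `^ (2 * lambda) <=
  C * rnorm (1 - z ^+ 2) `^ kappa
    * (disc_kernel (q + 1 + kappa) z xy + disc_kernel (q + 1 + kappa) (conjc z) xy)
  + C * (1 + tail lambda k z N `^ p) * (disc_kernel (q + 1) z xy + disc_kernel (q + 1) (conjc z) xy).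
Proof.
have [C C0 [k hC]] := dunkl_kernel_bound lambda_ge0 alpha_gtN1.
have [C' C'0 hC'] := kernel_pointwise lambda_ge0 p01 q_gt0 C0.
exists C' => //; exists k => z xy N z1 v1; set v := toC xy in v1 *.
have one u : 1 - 1%:C * (z * u) = 1 - z * u by rewrite rmorph1 mul1r.
have mE : Bmin z v 1 = Num.min (rnorm (1 - z * v)) (rnorm (1 - z * conjc v)) by rewrite /Bmin !one.
have ME : Bmax z v 1 = Num.max (rnorm (1 - z * v)) (rnorm (1 - z * conjc v)) by rewrite /Bmax !one.
have b2 : rnorm (1 - conjc z * v) = rnorm (1 - z * conjc v).
  rewrite -[LHS]rnorm_conj; congr (rnorm _); apply: complex_ext;
    rewrite ?(Re_conj, Im_conj) !(ReD, ImD, ReN, ImN, ReM, ImM, Re_conj, Im_conj) /=; ring.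
have gt0 u : rnorm u < 1 -> 0 < rnorm (1 - z * u).
  move=> u1; rewrite lt_neqAle rnorm_ge0 andbT eq_sym rnorm_eq0 subr_eq0.
  apply/eqP => h; have := rnorm1 R; rewrite h rnormM => h1.
  have : rnorm z * rnorm u < 1 by rewrite mulr_ilt1 ?rnorm_ge0.
  by rewrite h1 ltxx.
have le2 u : rnorm u < 1 -> rnorm (1 - z * u) <= 2.
  move=> u1; apply: (le_trans (rnormD _ _)); rewrite rnormN rnorm1 rnormM.
  have : rnorm z * rnorm u < 1 by rewrite mulr_ilt1 ?rnorm_ge0.
  lra.
have v1' : rnorm (conjc v) < 1 by rewrite rnorm_conj.
have B1 := gt0 _ v1; have B2 := gt0 _ v1'.
have tr1 := rnorm1M_triangle (ltW z1) (ltW v1).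
have tr2 := rnorm1M_triangle (ltW z1) (ltW v1'); rewrite conjcK in tr2.
have im := Im_le_rnorm1M (ltW z1) (ltW v1).
have := hC' (rnorm (dunkl_kernel lambda alpha N z v)) (Bmax z v 1) (Bmin z v 1)
  (rnorm (1 - z ^+ 2)) `|xy.2| (tail lambda k z N).
have {hC} := hC z v N z1 (ltW v1); rewrite mE ME => hK.
set m := Num.min _ _ in hK *; set M := Num.max _ _ in hK *; set D := rnorm (1 - z ^+ 2).
have m0 : 0 < m by rewrite lt_min B1.
have mM : m <= M by rewrite /m /M ge_min !le_max lexx.
have m2 : m <= 2 by rewrite ge_min le2.
have D0 : 0 <= D := rnorm_ge0 _.
have MD : M <= D + m.
  rewrite -/D in tr1 tr2; move: tr1 tr2 D0; rewrite /M /m.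
  by case: (leP (rnorm (1 - z * v)) (rnorm (1 - z * conjc v))) => h; lra.
have yM : `|xy.2| <= 2 * M.
  have h1 : rnorm (1 - z * v) <= M by rewrite le_max lexx.
  have h2 : rnorm (1 - z * conjc v) <= M by rewrite le_max lexx orbT.
  by apply: (le_trans im); move: h1 h2; lra.
have y1 : `|xy.2| <= 1 by exact: le_trans (Im_le_rnorm v) (ltW v1).
move=> /(_ m0 mM m2 D0 MD (normr_ge0 _) y1 yM (tail_ge0 lambda_ge0 k N z1) (rnorm_ge0 _) hK) h.
apply: (le_trans h).
have N1 : 0 <= q + 1 + kappa by rewrite !addr_ge0 ?kappa_ge0 // ltW.
have N2 : 0 <= q + 1 by rewrite addr_ge0 // ltW.
have mN n : m `^ (- n) <= disc_kernel n z xy + disc_kernel n (conjc z) xy.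
  rewrite /disc_kernel -/v b2 /m.
  case: (leP (rnorm (1 - z * v)) (rnorm (1 - z * conjc v))) => _.
    by rewrite lerDl powR_ge0.
  by rewrite lerDr powR_ge0.
rewrite -/kappa mulrDr -[X in _ <= X + _]mulrA -[X in _ <= _ + X]mulrA.
apply: lerD; apply: ler_wpM2l; rewrite ?(ltW C'0) //.
  by apply: ler_wpM2l; rewrite ?powR_ge0.
by apply: ler_wpM2l; rewrite ?addr_ge0 ?powR_ge0.
Qed.

Hypothesis w_weight : is_weight w.
Hypothesis w_cond : exists2 c : R, 0 < c & forall r : R, 0 < r < 1 ->
  \int[completed_lebesgue_measure]_(s in `[0, r]) (w s / (1 - s) `^ q)
  <= c * ((1 - r) `^ q)^-1 * \int[completed_lebesgue_measure]_(s in `[r, 1[) w s.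

Local Notation W r := (\int[completed_lebesgue_measure]_(s in `[r, 1%R[) w s).

Lemma Gamma_ge0 (x : R) : 0 <= Gamma x.
Proof. by apply: Rintegral_ge0 => t _; rewrite mulr_ge0 ?powR_ge0 ?expR_ge0. Qed.

(** The circle integral lowers the exponents [q + 1 + kappa] and [q + 1] by 1, after which
    [weight_integral_le] is used with [a = q + kappa] and with [a = q]. *)
Lemma bergman_kernel_integral_le : exists2 C : R, 0 < C & exists k, forall z N, rnorm z < 1 ->
  (\int[(lebesgue_measure \x lebesgue_measure)%E]_(xy in @disc2 R)
     (rnorm (dunkl_kernel lambda alpha N z (toC xy)) `^ p * w (rnorm (toC xy))
      * sigma_density lambda xy)%:E <=
   (C * (rnorm (1 - z ^+ 2) `^ kappa * (1 - rnorm z) `^ (- (q + kappa))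
         + (1 + tail lambda k z N `^ p) * (1 - rnorm z) `^ (- q))
    * W (Num.sqrt (rnorm z)))%:E)%E.
Proof.
have [C C0 [k hC]] := dunkl_kernel_pointwise.
have N11 : 1 < q + 1 + kappa by move: q_gt0 kappa_ge0; lra.
have N21 : 1 < q + 1 by move: q_gt0; lra.
have [C1 C10 hC1] := disc_kernel_integral_le N11 N21.
have [C2 C20 hC2] := weight_integral_le q_gt0 w_weight w_cond.
have [cl cl0 clE] : exists2 cl : R, 0 <= cl &
    forall xy, sigma_density lambda xy = cl * `|xy.2| `^ (2 * lambda).
  exists (Gamma (lambda + 2) / (Gamma (lambda + 2^-1) * Gamma 2^-1)) => //.
  by rewrite divr_ge0 ?mulr_ge0 ?Gamma_ge0.
exists (2 * C1 * (cl * C) * C2 + 1); first by rewrite ltr_wpDl //; nonneg.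
exists k => z N z1; set r := rnorm z; have r01 : 0 <= r < 1 by rewrite rnorm_ge0.
set D := rnorm (1 - z ^+ 2); set tau := tail lambda k z N.
have t0 : 0 <= tau by exact: tail_ge0.
pose A := cl * C * D `^ kappa; pose B := cl * C * (1 + tau `^ p).
have A0 : 0 <= A by rewrite /A; nonneg.
have B0 : 0 <= B by rewrite /B; nonneg.
have w0 := weight_gt0 w_weight.
apply: (@le_trans _ _ (\int[(lebesgue_measure \x lebesgue_measure)%E]_(xy in @disc2 R)
  ((A * (disc_kernel (q + 1 + kappa) z xy + disc_kernel (q + 1 + kappa) (conjc z) xy)
   + B * (disc_kernel (q + 1) z xy + disc_kernel (q + 1) (conjc z) xy)) * w (rnorm (toC xy)))%:E)%E).
  apply: ge0_integral_mono => xy xyD; have xyd : rnorm (toC xy) < 1 by exact: xyD.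
    by rewrite lee_fin clE !mulr_ge0 ?powR_ge0 // ltW // w0 // rnorm_ge0.
  rewrite lee_fin clE mulrAC; apply: ler_wpM2r; first by rewrite ltW // w0 // rnorm_ge0.
  rewrite mulrCA; apply: (le_trans (ler_wpM2l cl0 (hC z xy N z1 xyd))).
  by rewrite /A /B le_eqVlt; apply/orP; left; apply/eqP; ring.
apply: (le_trans (hC1 w z A B w0 z1 A0 B0)).
pose f a s := (w s * (1 - r * s) `^ (- a))%:E.
have m01 : measurable (`[0%R, 1%R[ : set (caratheodory_type (wlength (@idfun R))^*%mu)).
  by apply: measurable_completed_set; exact: measurable_itv.
have mf a : measurable_fun (`[0%R, 1%R[ : set (caratheodory_type (wlength (@idfun R))^*%mu)) (f a).
  exact: measurable_weight_pow.
have f0 a s : `[0%R, 1%R[%classic s -> (0 <= f a s)%E.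
  by rewrite /= in_itv /= => s01; rewrite lee_fin mulr_ge0 ?powR_ge0 // ltW // w0.
pose g k a s := ((C1 * k)%:E * f a s)%E.
have mg k' a : measurable_fun (`[0%R, 1%R[ : set (caratheodory_type (wlength (@idfun R))^*%mu)) (g k' a).
  exact: measurable_funeM.
have g0 k' a s : 0 <= k' -> `[0%R, 1%R[%classic s -> (0 <= g k' a s)%E.
  by move=> k0 s01; rewrite mule_ge0 ?f0 // lee_fin mulr_ge0 // ltW.
have -> : (\int[completed_lebesgue_measure]_(s in `[0%R, 1%R[)
   (w s * (C1 * (A * (1 - r * s) `^ (1 - (q + 1 + kappa)) + B * (1 - r * s) `^ (1 - (q + 1)))))%:E =
   \int[completed_lebesgue_measure]_(s in `[0%R, 1%R[) (g A (q + kappa)%R s + g B q s))%E.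
  apply: eq_integral => s _; rewrite /g /f -!EFinM -EFinD; congr EFin.
  have -> : 1 - (q + 1 + kappa) = - (q + kappa) by ring.
  have -> : 1 - (q + 1) = - q by ring.
  by ring.
rewrite (@ge0_integralD _ _ _ completed_lebesgue_measure _ m01 (g A (q + kappa)) (g B q)
  (fun s => g0 A _ s A0) (mg _ _) (fun s => g0 B _ s B0) (mg _ _)).
have gi k' a : 0 <= k' -> q <= a ->
   (\int[completed_lebesgue_measure]_(s in `[0%R, 1%R[) g k' a s
    <= (C1 * k' * (C2 * (1 - r) `^ (- a) * W (Num.sqrt r)))%:E)%E.
  move=> k0 qa; have ck : 0 <= C1 * k' by rewrite mulr_ge0 // ltW.
  rewrite (@ge0_integralZl_EFin _ _ _ completed_lebesgue_measure _ m01 (f a) (f0 a) (mf a) _ ck).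
  by rewrite [leRHS]EFinM; apply: lee_wpmul2l; rewrite ?lee_fin //; exact: hC2.
have W0 : 0 <= W (Num.sqrt r).
  apply: Rintegral_ge0 => s; rewrite /= in_itv /= => /andP[h s1].
  by rewrite ltW // w0 // s1 (le_trans _ h).
apply: (le_trans (lee_wpmul2l _ (leeD (gi _ _ A0 _) (gi _ _ B0 (lexx q))))) => //.
  by rewrite lerDl kappa_ge0.
rewrite -EFinD -EFinM lee_fin /A /B.
have U0 := powR_ge0 (1 - r) (- (q + kappa)).
have V0 := powR_ge0 (1 - r) (- q).
move: U0 V0; set U := _ `^ (- (q + kappa)); set V := _ `^ (- q) => U0 V0.
rewrite -subr_ge0.
set Dk := D `^ kappa; have Dk0 : 0 <= Dk := powR_ge0 _ _.
have tp0 : 0 <= 1 + tau `^ p by rewrite addr_ge0 ?powR_ge0.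
rewrite (_ : _ - _ = (Dk * U + (1 + tau `^ p) * V) * W (Num.sqrt r)); last by ring.
by rewrite mulr_ge0 // addr_ge0 // mulr_ge0.
Qed.

End BergmanKernel.

(** * The Gamma function *)

Section GammaFunction.
Variable R : realType.
Local Notation mu := (@lebesgue_measure R).
Implicit Types (x a t : R).

(** [t / k <= exp (t / k)], raised to the power [a], gives at most [exp (a t / k)], and
    [k = 2 (a + 1)] keeps this below [exp (t / 2)]. *)
Lemma powR_expR_bound a : 0 <= a -> exists2 C : R, 0 <= C & forall t, 0 <= t ->
  t `^ a * expR (- t) <= C * expR (- (t / 2)).
Proof.
move=> a0; pose k := 2 * (a + 1); have k0 : 0 < k by rewrite mulr_gt0 // ltr_wpDl.
exists (k `^ a); first exact: powR_ge0.
move=> t t0; have tk : t / k <= expR (t / k) by have := expR_ge1Dx (t / k); lra.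
have h : (t / k) `^ a <= expR (t / 2).
  apply: (@le_trans _ _ (expR (t / k) `^ a)).
    by apply: ge0_ler_powR => //; rewrite nnegrE ?divr_ge0 ?expR_ge0 // ltW.
  rewrite /powR gt_eqF ?expR_gt0 // expRK ler_expR mulrA ler_pdivrMr //.
  have : a * t <= (a + 1) * t by rewrite ler_wpM2r // lerDl.
  by rewrite /k; lra.
have -> : t `^ a = k `^ a * (t / k) `^ a.
  by rewrite -powRM ?divr_ge0 ?(ltW k0) // mulrCA mulfV ?gt_eqF // mulr1.
rewrite -mulrA; apply: ler_wpM2l; first exact: powR_ge0.
apply: (le_trans (ler_wpM2r (expR_ge0 _) h)).
by rewrite -expRD ler_expR; lra.
Qed.

Lemma is_derive_expRN2 t : is_derive t (1 : R) (fun t => expR (- (t / 2))) (- (expR (- (t / 2)) / 2)).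
Proof.
have h : is_derive t (1 : R) (fun t : R => - (t / 2)) (- 2^-1).
  have -> : (fun t : R => - (t / 2)) = (fun t => - 2^-1 * t) by apply/funext => s; ring.
  by apply: is_derive_eq (isD_Z _ (isD_id t)) _; rewrite mulr1.
by apply: is_derive_eq (isD_expR h) _; rewrite mulrN.
Qed.

Lemma cvg_expRN2 : expR (- (t / 2)) @[t --> +oo] --> (0 : R).
Proof.
apply/cvgrPdist_lt => e e0; have /cvgrPdist_lt/(_ e e0) := @cvgr_expR R.
move=> [M [Mr hM]]; exists (2 * M); split; first by rewrite num_real.
by move=> t /= ht; apply: hM; lra.
Qed.

Lemma integral_expRN2 : (\int[mu]_(t in `[0%R, +oo[) (expR (- (t / 2)))%:E = 2%:E)%E.
Proof.
pose F t := - 2 * expR (- (t / 2)).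
have dF t : is_derive t (1 : R) F (expR (- (t / 2))).
  by apply: is_derive_eq (isD_Z (- 2) (is_derive_expRN2 t)) _; field.
rewrite (@ge0_continuous_FTC2y _ _ F 0 0).
- by rewrite sub0e /F mul0r oppr0 expR0 mulr1 EFinN oppeK.
- by move=> t _; exact: expR_ge0.
- by apply: continuous_in_subspaceT => t _; exact: isD_cont (is_derive_expRN2 t).
- rewrite -[X in _ --> X](mulr0 (- 2)); apply: cvgM; [exact: cvg_cst|exact: cvg_expRN2].
- by move=> t _; case: (dF t).
- by apply: cvg_at_right_filter; exact: isD_cont (dF 0).
- by move=> t _; rewrite derive1E; have := dF t => h; exact: derive_val.
Qed.

Lemma powR_right_cont0 a : 0 <= a -> (t : R) `^ a @[t --> 0^'+] --> (0 : R) `^ a.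
Proof.
rewrite le_eqVlt => /orP[/eqP <-|a0]; last by rewrite powR0 ?gt_eqF //; exact: powR_cvg0.
by under eq_fun do rewrite powRr0; rewrite powRr0; exact: cvg_cst.
Qed.

Local Notation f a := (fun t : R => t `^ a * expR (- t)).

Lemma is_derive_powR_expR a t : 0 < t ->
  is_derive t (1 : R) (f a) (a * (t `^ (a - 1) * expR (- t)) - t `^ a * expR (- t)).
Proof.
move=> t0.
have h : is_derive t (1 : R) (fun t : R => - t) (- 1).
  have -> : (fun t : R => - t) = (fun t => - 1 * t) by apply/funext => s; ring.
  by apply: is_derive_eq (isD_Z _ (isD_id t)) _; rewrite mulr1.
apply: is_derive_eq (isD_M (isD_powR a t0 (isD_id t)) (isD_expR h)) _.
by rewrite powRB ?(gt_eqF t0) ?implybT // powRr1 ?ltW //; field; rewrite gt_eqF.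
Qed.

Lemma continuous_powR_expR a : 0 <= a -> {within `[0%R, +oo[, continuous (f a)}.
Proof.
move=> a0; rewrite continuous_within_itvcyP; split.
  move=> t; rewrite in_itv /= andbT => t0; exact: isD_cont (is_derive_powR_expR a t0).
apply: cvgM; first exact: powR_right_cont0.
apply: cvg_at_right_filter; apply: continuous_comp; first exact: opp_continuous.
exact: continuous_expR.
Qed.

Lemma measurable_powR_expR a : measurable_fun setT (f a).
Proof.
apply: measurable_funM; first exact: measurable_powR.
apply: (@measurableT_comp _ _ _ _ _ _ (@expR R)); first exact: measurable_expR.
exact: oppr_measurable.
Qed.

Local Notation J a := (\int[mu]_(t in `[0%R, +oo[) ((t : R) `^ a * expR (- t))%:E)%E.

Lemma powR_expR_ge0 a t : (0 <= (t `^ a * expR (- t))%:E)%E.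
Proof. by rewrite lee_fin mulr_ge0 ?powR_ge0 ?expR_ge0. Qed.

(** Passes to the closed half-line and certifies finiteness, which the real-valued integral in
    [Gamma] conceals. *)
Lemma Gamma_fin a : 0 <= a -> (J a = (Gamma (a + 1))%:E)%E.
Proof.
move=> a0; rewrite -integral_itv_obnd_cbnd; last first.
  by apply/measurable_EFinP; exact: measurable_funTS (measurable_powR_expR a).
rewrite /Gamma /Rintegral fineK ?addrK // ge0_fin_numE; last first.
  by apply: integral_ge0 => t _; exact: powR_expR_ge0.
have [C C0 hC] := powR_expR_bound a0.
apply: (@le_lt_trans _ _ (\int[mu]_(t in `[0%R, +oo[) (C%:E * (expR (- (t / 2)))%:E))%E).
  rewrite integral_itv_obnd_cbnd; last first.
    by apply/measurable_EFinP; exact: measurable_funTS (measurable_powR_expR a).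
  apply: ge0_integral_mono => t; rewrite /= in_itv /= andbT => t0; first exact: powR_expR_ge0.
  by rewrite -EFinM lee_fin; exact: hC.
rewrite ge0_integralZl_EFin //.
- by rewrite integral_expRN2 -EFinM ltry.
- apply/measurable_EFinP; apply: measurable_funTS; apply: continuous_measurable_fun => t.
  exact: isD_cont (is_derive_expRN2 t).
Qed.

(** Integration by parts through a nonnegative integrand: [M exp (- t / 2)] is added to the
    derivative of [- t^x exp (- t)], with [M] so large that the sum [h] is nonnegative, and its
    integral [2 M] cancels at the end. For [x >= 1] the integrands are continuous at 0. *)
Lemma GammaS x : 1 <= x -> Gamma (x + 1) = x * Gamma x.
Proof.
move=> x1; have x0 : 0 <= x by rewrite (le_trans _ x1).
have y0 : 0 <= x - 1 by rewrite subr_ge0.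
have [C C0 hC] := powR_expR_bound y0.
pose M := x * C; have M0 : 0 <= M by rewrite mulr_ge0.
pose E t : R := M * expR (- (t / 2)).
pose h t := t `^ x * expR (- t) - x * (t `^ (x - 1) * expR (- t)) + E t.
have h0 t : 0 <= t -> 0 <= h t.
  move=> t0; rewrite /h /E -addrA addr_ge0 ?mulr_ge0 ?powR_ge0 ?expR_ge0 //.
  by rewrite addrC subr_ge0 /M -mulrA ler_wpM2l // hC.
have cE t : {for t, continuous E} := isD_cont (isD_Z M (is_derive_expRN2 t)).
have ch : {within `[0%R, +oo[, continuous h}.
  have cE' : {within `[0%R, +oo[, continuous E} by apply: continuous_subspaceT => t; exact: cE.
  move=> t; apply: cvgD; last exact: cE'.
  apply: cvgB; first exact: (continuous_powR_expR x0).
  by apply: cvgM; [exact: cvg_cst|exact: (continuous_powR_expR y0)].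
pose F t := - (t `^ x * expR (- t)) - 2 * E t.
have dE t : is_derive t (1 : R) E (- (E t / 2)).
  by apply: is_derive_eq (isD_Z M (is_derive_expRN2 t)) _; rewrite /E; ring.
have dF t : 0 < t -> is_derive t (1 : R) F (h t).
  move=> t0; have -> : F = (fun t => - 1 * (t `^ x * expR (- t)) - 2 * E t).
    by apply/funext => s; rewrite /F mulN1r.
  apply: is_derive_eq (isD_B (isD_Z (- 1) (is_derive_powR_expR x t0)) (isD_Z 2 (dE t))) _.
  by rewrite /h; field.
have cF : F t @[t --> 0^'+] --> F 0.
  apply: cvgB; last by apply: cvgM; [exact: cvg_cst|exact: cvg_at_right_filter (cE 0)].
  by apply: cvgN; have := continuous_powR_expR x0; rewrite continuous_within_itvcyP => -[].
have [C' C'0 hC'] := powR_expR_bound x0.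
have lF : F t @[t --> +oo] --> (0 : R).
  rewrite -[X in _ --> X](subr0 0) -{1}oppr0; apply: cvgB; last first.
    rewrite -[X in _ --> X](mulr0 2) -[X in _ * X](mulr0 M).
    by apply: cvgM; [exact: cvg_cst|apply: cvgM; [exact: cvg_cst|exact: cvg_expRN2]].
  apply: cvgN; apply: (@squeeze_cvgr _ _ _ _ (fun=> 0) (fun t => C' * expR (- (t / 2)))).
  - near=> t; have t0 : 0 <= t by near: t; apply: nbhs_pinfty_ge; rewrite num_real.
    by rewrite mulr_ge0 ?powR_ge0 ?expR_ge0 //= hC'.
  - exact: cvg_cst.
  - rewrite -[X in _ --> X](mulr0 C'); apply: cvgM; [exact: cvg_cst|exact: cvg_expRN2].
have Ih : (\int[mu]_(t in `[0%R, +oo[) (h t)%:E = (2 * M)%:E)%E.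
  rewrite (@ge0_continuous_FTC2y _ _ F 0 0) //.
  - rewrite sub0e /F /E mul0r !oppr0 expR0 powR0 ?mul0r ?oppr0 ?sub0r ?mulr1 ?EFinN ?oppeK //.
    by rewrite gt_eqF // (lt_le_trans _ x1).
  - by move=> t t0; case: (dF _ t0).
  - move=> t; rewrite in_itv /= andbT => t0; rewrite derive1E; have := dF _ t0 => hh; exact: derive_val.
have mI (g : R -> R) : measurable_fun setT g -> @measurable_fun _ _ R (\bar R) `[0%R, +oo[ (EFin \o g).
  by move=> mg; apply/measurable_EFinP; exact: measurable_funTS mg.
have mE : measurable_fun setT E by exact: continuous_measurable_fun.
have mf a : measurable_fun setT (f a) := measurable_powR_expR a.
have mh : measurable_fun setT h.
  apply: measurable_funD => //; apply: measurable_funB; first exact: mf.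
  by apply: measurable_funM => //; exact: mf.
have e1 : (\int[mu]_(t in `[0%R, +oo[) ((h t)%:E + (x%:E * (t `^ (x - 1) * expR (- t))%:E)) =
           \int[mu]_(t in `[0%R, +oo[) ((t `^ x * expR (- t))%:E + (M%:E * (expR (- (t / 2)))%:E)))%E.
  by apply: eq_integral => t _; rewrite -!EFinM -!EFinD; congr EFin; rewrite /h /E; ring.
rewrite ge0_integralD // in e1; last 4 first.
- by move=> t; rewrite /= in_itv /= andbT lee_fin; exact: h0.
- exact: mI.
- by move=> t _; rewrite mule_ge0 ?powR_expR_ge0 // lee_fin.
- by apply: measurable_funeM; exact: mI.
rewrite ge0_integralD // in e1; last 4 first.
- by move=> t _; exact: powR_expR_ge0.
- exact: mI.
- by move=> t _; rewrite mule_ge0 // lee_fin ?expR_ge0.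
- by apply: measurable_funeM; apply: mI; apply: continuous_measurable_fun => t; exact: isD_cont (is_derive_expRN2 t).
rewrite !ge0_integralZl_EFin // in e1; last 3 first.
- by apply: mI; apply: continuous_measurable_fun => t; exact: isD_cont (is_derive_expRN2 t).
- by move=> t _; exact: powR_expR_ge0.
- exact: mI.
rewrite Ih integral_expRN2 (Gamma_fin x0) (Gamma_fin y0) subrK -!EFinM -!EFinD in e1.
by case: e1; lra.
Unshelve. all: by end_near. Qed.

(** On [[1, 2]] the integrand is at least [exp (-2)]. *)
Lemma Gamma_gt0 x : 1 <= x -> 0 < Gamma x.
Proof.
move=> x1; have y0 : 0 <= x - 1 by rewrite subr_ge0.
rewrite -lte_fin -[X in Gamma X](subrK 1) -(Gamma_fin y0).
have e0 : 0 < expR (- 2) :> R by exact: expR_gt0.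
apply: (@lt_le_trans _ _ (\int[mu]_(t in `[1%R, 2%R]) (expR (- 2))%:E)%E).
  by rewrite integral_cst //= lebesgue_measure_itv /= lte_fin ltr1n -EFinB -EFinM lte_fin mulr_gt0 //; lra.
apply: (@le_trans _ _ (\int[mu]_(t in `[1%R, 2%R]) ((t : R) `^ (x - 1) * expR (- t))%:E)%E).
  apply: ge0_integral_mono => t; rewrite /= in_itv /= => /andP[t1 t2].
    by rewrite lee_fin ltW.
  rewrite lee_fin -[leLHS]mul1r; apply: ler_pM; rewrite ?expR_ge0 //; last by rewrite ler_expR lerN2.
  by rewrite -[leLHS](powRr0 t); exact: ler_powR.
apply: ge0_subset_integral => //.
- by apply/measurable_EFinP; exact: measurable_funTS (measurable_powR_expR _).
- by move=> t _; exact: powR_expR_ge0.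
- by move=> t /=; rewrite !in_itv /= andbT => /andP[t1 _]; rewrite (le_trans _ t1).
Qed.

Lemma Gamma_poch x n : 1 <= x -> Gamma (x + n%:R) = poch x n * Gamma x.
Proof.
move=> x1; elim: n => [|n IH]; first by rewrite addr0 poch0 mul1r.
have xn : 1 <= x + n%:R by rewrite ler_wpDr.
by rewrite -natr1 addrA GammaS // IH pochS mulrA [_ * poch x n]mulrC.
Qed.

End GammaFunction.

(** * Polynomials annihilated by the Dunkl operator *)

Section ComplexPolynomials.
Variable R : realType.
Implicit Types (f g : R[i] -> R[i]) (z c d db : R[i]) (xy v : R * R).

(** Polynomials in [z] and [conj z], given by closure rules so that smoothness follows by
    induction. *)
Inductive cpoly : (R[i] -> R[i]) -> Prop :=
| cpoly_cst c : cpoly (fun=> c)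
| cpoly_id : cpoly (fun z => z)
| cpoly_conj : cpoly (fun z => conjc z)
| cpolyD f g : cpoly f -> cpoly g -> cpoly (fun z => f z + g z)
| cpolyM f g : cpoly f -> cpoly g -> cpoly (fun z => f z * g z).

Lemma ofCK z : toC (ofC z) = z. Proof. by case: z. Qed.
Lemma toCK xy : ofC (toC xy) = xy. Proof. by case: xy. Qed.

Lemma conjcN z : conjc (- z) = - conjc z. Proof. by case: z. Qed.

Lemma cpolyJ f : cpoly f -> cpoly (fun z => conjc (f z)).
Proof.
elim=> [c|||g h _ cg _ ch|g h _ cg _ ch].
- exact: cpoly_cst.
- exact: cpoly_conj.
- by have := cpoly_id; congr cpoly; apply/funext => z; rewrite conjcK.
- by have := cpolyD cg ch; congr cpoly; apply/funext => z; rewrite conjcD.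
- by have := cpolyM cg ch; congr cpoly; apply/funext => z; rewrite conjcM.
Qed.

(* The real differential of [f] at [z] is [v |-> d * v + db * conj v]. *)
Definition zderiv f z d db := forall v,
  is_derive (ofC z) v (fun xy : R * R => complex.Re (f (toC xy)) : R)
    (complex.Re (d * toC v + db * conjc (toC v))) /\
  is_derive (ofC z) v (fun xy : R * R => complex.Im (f (toC xy)) : R)
    (complex.Im (d * toC v + db * conjc (toC v))).

Lemma is_derive_fst xy v : is_derive xy v (fun u : R * R => u.1 : R) v.1.
Proof.
have h : (h^-1 *: (((fun u : R * R => u.1 : R) \o shift xy) (h *: v) - xy.1)) @[h --> 0^'] --> v.1.
  apply: cvg_near_cst; near=> h; have h0 : h != 0 by near: h; exact: nbhs_dnbhs_neq.
  by rewrite /= addrK /GRing.scale /= mulrA mulVf // mul1r.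
by apply: DeriveDef; [apply/cvg_ex; exists v.1|exact: cvg_lim].
Unshelve. all: by end_near. Qed.

Lemma is_derive_snd xy v : is_derive xy v (fun u : R * R => u.2 : R) v.2.
Proof.
have h : (h^-1 *: (((fun u : R * R => u.2 : R) \o shift xy) (h *: v) - xy.2)) @[h --> 0^'] --> v.2.
  apply: cvg_near_cst; near=> h; have h0 : h != 0 by near: h; exact: nbhs_dnbhs_neq.
  by rewrite /= addrK /GRing.scale /= mulrA mulVf // mul1r.
by apply: DeriveDef; [apply/cvg_ex; exists v.2|exact: cvg_lim].
Unshelve. all: by end_near. Qed.

Lemma zderiv_cst c z : zderiv (fun=> c) z 0 0.
Proof. by move=> v; split; rewrite !mul0r addr0; exact: is_derive_cst. Qed.

Lemma zderiv_id z : zderiv (fun u => u) z 1 0.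
Proof.
move=> v; rewrite mul1r mul0r addr0; split; [exact: is_derive_fst|exact: is_derive_snd].
Qed.

Lemma zderivJ f z d db : zderiv f z d db -> zderiv (fun u => conjc (f u)) z (conjc db) (conjc d).
Proof.
move=> h v; have [h1 h2] := h v; split.
  have -> : (fun xy => complex.Re (conjc (f (toC xy)))) = (fun xy => complex.Re (f (toC xy))).
    by apply/funext => xy; rewrite Re_conj.
  apply: is_derive_eq h1 _; rewrite !(ReD, ReM, Re_conj, Im_conj); ring.
have -> : (fun xy => complex.Im (conjc (f (toC xy)))) = - (fun xy => complex.Im (f (toC xy))).
  by apply/funext => xy; rewrite Im_conj.
by apply: is_derive_eq (is_deriveN h2) _; rewrite !(ImD, ImM, Re_conj, Im_conj); ring.
Qed.

Lemma zderivD f g z d db d' db' : zderiv f z d db -> zderiv g z d' db' ->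
  zderiv (fun u => f u + g u) z (d + d') (db + db').
Proof.
move=> hf hg v; have [f1 f2] := hf v; have [g1 g2] := hg v; split.
  have -> : (fun xy => complex.Re (f (toC xy) + g (toC xy))) =
    (fun xy => complex.Re (f (toC xy))) + (fun xy => complex.Re (g (toC xy))).
    by apply/funext => xy; rewrite ReD.
  by apply: is_derive_eq (is_deriveD f1 g1) _; rewrite !(ReD, ReM, Re_conj, Im_conj, ImD); ring.
have -> : (fun xy => complex.Im (f (toC xy) + g (toC xy))) =
    (fun xy => complex.Im (f (toC xy))) + (fun xy => complex.Im (g (toC xy))).
  by apply/funext => xy; rewrite ImD.
by apply: is_derive_eq (is_deriveD f2 g2) _; rewrite !(ImD, ImM, Re_conj, Im_conj, ReD); ring.
Qed.

Lemma zderivM f g z d db d' db' : zderiv f z d db -> zderiv g z d' db' ->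
  zderiv (fun u => f u * g u) z (d * g z + f z * d') (db * g z + f z * db').
Proof.
move=> hf hg v; have [f1 f2] := hf v; have [g1 g2] := hg v; split.
  have -> : (fun xy => complex.Re (f (toC xy) * g (toC xy))) =
    (fun xy => complex.Re (f (toC xy))) * (fun xy => complex.Re (g (toC xy)))
    - (fun xy => complex.Im (f (toC xy))) * (fun xy => complex.Im (g (toC xy))).
    by apply/funext => xy; rewrite ReM.
  apply: is_derive_eq (is_deriveB (is_deriveM f1 g1) (is_deriveM f2 g2)) _.
  by rewrite /GRing.scale /= !ofCK !(ReD, ReM, Re_conj, Im_conj, ImD, ImM); ring.
have -> : (fun xy => complex.Im (f (toC xy) * g (toC xy))) =
    (fun xy => complex.Re (f (toC xy))) * (fun xy => complex.Im (g (toC xy)))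
    + (fun xy => complex.Im (f (toC xy))) * (fun xy => complex.Re (g (toC xy))).
  by apply/funext => xy; rewrite ImM.
apply: is_derive_eq (is_deriveD (is_deriveM f1 g2) (is_deriveM f2 g1)) _.
by rewrite /GRing.scale /= !ofCK !(ReD, ReM, Re_conj, Im_conj, ImD, ImM); ring.
Qed.

Lemma zderiv_eq f z d db d' db' : zderiv f z d db -> d = d' -> db = db' -> zderiv f z d' db'.
Proof. by move=> h <- <-. Qed.

Lemma zderiv_rderive f z d db v : zderiv f z d db -> rderive v f z = d * toC v + db * conjc (toC v).
Proof.
by move=> /(_ v)[h1 h2]; apply: complex_ext => /=; exact: derive_val.
Qed.

Lemma zderiv_dzbar f z d db : zderiv f z d db -> dzbar f z = db.
Proof.
move=> h; rewrite /dzbar !(zderiv_rderive _ h).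
rewrite -?complexiE.
have -> : toC (1, 0) = 1 :> R[i] by [].
have -> : toC (0, 1) = 'i%C :> R[i] by [].
have -> : conjc 'i%C = - 'i%C :> R[i] by apply: complex_ext => /=; rewrite ?oppr0.
have -> : conjc 1 = 1 :> R[i] by apply: complex_ext => /=; rewrite ?oppr0.
set j := 'i%C; have jj : j * j = -1 by apply: complex_ext; rewrite ?ReM ?ImM /=; ring.
rewrite (_ : _ + _ = d + db + (j * j) * (d - db)); last by ring.
by rewrite jj; field.
Qed.

Lemma cpoly_zderiv f : cpoly f -> exists d db : R[i] -> R[i], [/\ cpoly d, cpoly db & forall z, zderiv f z (d z) (db z)].
Proof.
elim=> [c|||g h cg [d [db [cd cdb hg]]] ch [d' [db' [cd' cdb' hh]]]|g h cg [d [db [cd cdb hg]]] ch [d' [db' [cd' cdb' hh]]]].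
- by exists (fun=> 0), (fun=> 0); split; try exact: cpoly_cst; move=> z; exact: zderiv_cst.
- by exists (fun=> 1), (fun=> 0); split; try exact: cpoly_cst; move=> z; exact: zderiv_id.
- exists (fun=> 0), (fun=> 1); split; try exact: cpoly_cst.
  by move=> z; apply: zderiv_eq (zderivJ (zderiv_id z)) _ _; rewrite ?rmorph0 ?rmorph1.
- exists (fun z => d z + d' z), (fun z => db z + db' z); split; try exact: cpolyD.
  by move=> z; exact: zderivD.
- exists (fun z => d z * h z + g z * d' z), (fun z => db z * h z + g z * db' z); split;
    try (apply: cpolyD; exact: cpolyM).
  by move=> z; exact: zderivM.
Qed.

Lemma cpoly_continuous2 f : cpoly f -> forall xy,
  ((complex.Re (f (toC u)) : R) @[u --> xy] --> (complex.Re (f (toC xy)) : R)) /\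
  ((complex.Im (f (toC u)) : R) @[u --> xy] --> (complex.Im (f (toC xy)) : R)).
Proof.
elim=> [c|||g h _ cg _ ch|g h _ cg _ ch] xy.
- by split; exact: cvg_cst.
- by split; [exact: cvg_fst|exact: cvg_snd].
- split; first exact: cvg_fst.
  by apply: cvgN; exact: cvg_snd.
- have [g1 g2] := cg xy; have [h1 h2] := ch xy; split.
    by under eq_fun do rewrite ReD; rewrite ReD; exact: cvgD.
  by under eq_fun do rewrite ImD; rewrite ImD; exact: cvgD.
- have [g1 g2] := cg xy; have [h1 h2] := ch xy; split.
    under eq_fun do rewrite ReM; rewrite ReM.
    by apply: cvgB; exact: cvgM.
  under eq_fun do rewrite ImM; rewrite ImM.
  by apply: cvgD; exact: cvgM.
Qed.

(** The derivative in direction [v] is the real or imaginary part of another [cpoly], namely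
    [d v + db conj v], so the induction on [k] runs over all such functions. *)
Lemma cpoly_Ck k f (U : set (R * R)) : cpoly f ->
  Ck_on k U (fun xy => complex.Re (f (toC xy))) /\ Ck_on k U (fun xy => complex.Im (f (toC xy))).
Proof.
elim: k f => [|k IH] f cf.
  by split; split => // xy _; have [] := cpoly_continuous2 cf xy.
have [d [db [cd cdb hf]]] := cpoly_zderiv cf.
have cg v : cpoly (fun z => d z * toC v + db z * conjc (toC v)).
  by apply: cpolyD; apply: cpolyM => //; exact: cpoly_cst.
split; split; try by move=> xy _; have [] := cpoly_continuous2 cf xy.
- move=> v _; split; first by move=> xy _; have [[h _] _] := hf (toC xy) v; rewrite toCK in h.
  have [+ _] := IH _ (cg v); congr (Ck_on k U _); apply/funext => xy.
  by have [[_ h] _] := hf (toC xy) v; rewrite toCK in h.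
- move=> v _; split; first by move=> xy _; have [_ [h _]] := hf (toC xy) v; rewrite toCK in h.
  have [_ +] := IH _ (cg v); congr (Ck_on k U _); apply/funext => xy.
  by have [_ [_ h]] := hf (toC xy) v; rewrite toCK in h.
Qed.

Lemma cpoly_cvg f (F : set_system R[i]) (FF : Filter F) z : cpoly f ->
  (u : R[i]^o) @[u --> F] --> (z : R[i]^o) ->
  (f u : R[i]^o) @[u --> F] --> (f z : R[i]^o).
Proof.
move=> cf zF; elim: cf => [c|||g h _ cg _ ch|g h _ cg _ ch].
- exact: cvg_cst.
- exact: zF.
- move/cvgrPdist_lt : zF => h; apply/cvgrPdist_lt => e /h.
  by apply: filterS => u; rewrite -rmorphB normcJ.
- exact: (cvgD cg ch).
- exact: (cvgM cg ch).
Qed.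

End ComplexPolynomials.

(** * The functions phi_n are lambda-analytic *)

Section DunklPolynomials.
Variables (R : realType) (lambda : R).
Hypothesis lambda_ge0 : 0 <= lambda.
Implicit Types (f g : R[i] -> R[i]) (z c : R[i]) (n : nat).

(* [b] extends [(f z - f (conj z)) / (z - conj z)] across the real axis. *)
Definition dunkl_poly f := cpoly f /\ exists d b : R[i] -> R[i],
  [/\ cpoly d, cpoly b, forall z, zderiv f z (d z) (lambda%:C * b z)
    & forall z, (z - conjc z) * b z = f z - f (conjc z)].

Lemma dunkl_polyD f g : dunkl_poly f -> dunkl_poly g -> dunkl_poly (fun z => f z + g z).
Proof.
move=> [cf [d [b [cd cb zf hf]]]] [cg [d' [b' [cd' cb' zg hg]]]].
split; first exact: cpolyD.
exists (fun z => d z + d' z), (fun z => b z + b' z); split; try exact: cpolyD.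
  by move=> z; apply: zderiv_eq (zderivD (zf z) (zg z)) _ _; rewrite ?mulrDr.
by move=> z; rewrite mulrDr hf hg; ring.
Qed.

Lemma dunkl_polyZ c f : dunkl_poly f -> dunkl_poly (fun z => c * f z).
Proof.
move=> [cf [d [b [cd cb zf hf]]]].
split; first by apply: cpolyM => //; exact: cpoly_cst.
exists (fun z => c * d z), (fun z => c * b z); split.
- by apply: cpolyM => //; exact: cpoly_cst.
- by apply: cpolyM => //; exact: cpoly_cst.
- by move=> z; apply: zderiv_eq (zderivM (zderiv_cst c z) (zf z)) _ _; rewrite mul0r add0r // mulrCA.
- by move=> z; rewrite mulrCA hf mulrBr.
Qed.

(** The nonreal point [z + i e / 2] lies in the ball of radius [e]. Properness makes the limit in
    [dunkl_quotient] unique. *)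
Lemma nonreal_proper z : complex.Im z == 0 ->
  ProperFilter (within [set u : R[i]^o | complex.Im u != 0] (nbhs (z : R[i]^o))).
Proof.
move=> /eqP z0; apply: Build_ProperFilter_ex => P; rewrite /within /= => /nbhs_ballP[e /= e0 he].
have er : 0 < complex.Re e /\ e = (complex.Re e)%:C.
  by move: e0; case: (e) => a b; rewrite ltcE /= => /andP[/eqP -> ->].
have [r0 eE] := er; pose u : R[i] := z + (complex.Re e / 2)%:C * 'i%C.
exists u; apply: he; last by rewrite /u ImD z0 ImM /= mulr1 mul0r addr0 add0r gt_eqF // divr_gt0.
rewrite -ball_normE /= /u opprD addrA subrr add0r normrN normrM.
have -> : `|'i%C : R[i]| = 1.
  by rewrite -rnormE (_ : rnorm _ = 1) //; apply/eqP;
     rewrite -(eqrXn2 (n := 2)) ?rnorm_ge0 // sqr_rnorm /= expr0n expr1n add0r.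
rewrite mulr1 -rnormE rnormR ger0_norm ?divr_ge0 ?(ltW r0) // eE ltcR; lra.
Qed.

(** Off the real axis the quotient equals [b]; on it, the limit along nonreal points is [b z] by
    continuity. In both cases it cancels [dzbar f = lambda b]. *)
Lemma dunkl_poly_lambda_analytic f : dunkl_poly f -> lambda_analytic lambda f.
Proof.
move=> [cf [d [b [cd cb zf hf]]]]; have [C1 C2] := cpoly_Ck 2 (@disc2 R) cf.
split=> // z _; rewrite /dunkl_zbar (zderiv_dzbar (zf z)) /dunkl_quotient.
have zn (u : R[i]) : complex.Im u != 0 -> u - conjc u != 0.
  move=> u0; apply/eqP => h; move/eqP: u0; apply.
  by have := congr1 (@complex.Im R) h; rewrite ImD ImN Im_conj opprK /=; lra.
have qE (u : R[i]) : complex.Im u != 0 -> (f u - f (conjc u)) / (u - conjc u) = b u.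
  by move=> u0; rewrite -hf mulrAC mulfV ?mul1r // zn.
case: ifP => z0; last by rewrite qE ?z0 // subrr.
have PF := nonreal_proper z0.
set L := lim _; have -> : L = b z; last by rewrite subrr.
apply: (@cvg_lim R[i]^o) => //.
have h : (b u : R[i]^o) @[u --> within [set u : R[i]^o | complex.Im u != 0] (nbhs (z : R[i]^o))] --> (b z : R[i]^o).
  by apply: cpoly_cvg => //; exact: cvg_within.
apply: cvg_trans h; apply: near_eq_cvg; rewrite near_withinE; near=> u => u0.
by rewrite qE.
Unshelve. all: by end_near. Qed.

Local Notation Phi := (Phi lambda).

Lemma PhiS_div n z : Phi n.+1 z =
  ((n.+1%:R + lambda) / n.+1%:R)%:C * (z * Phi n z) + (lambda / n.+1%:R)%:C * (conjc z * conjc (Phi n z)).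
Proof.
have n0 : n.+1%:R != 0 :> R[i] by rewrite pnatr_eq0.
have E x : n.+1%:R * (x / n.+1%:R)%:C = x%:C :> R[i].
  by rewrite -rc_nat -rcM mulrCA mulfV ?mulr1 // pnatr_eq0.
apply: (mulfI n0); have -> := PhiS lambda_ge0 n z; rewrite -(E (_ + _)) -(E lambda).
by move: (n.+1%:R) => c; ring.
Qed.

(** Induction along [PhiS]. Differentiating [conj z conj (Phi n z)] brings in [conj z conj (d z)];
    Euler's identity for homogeneous functions of degree [n] is proved simultaneously in order to
    eliminate it. *)
Lemma dunkl_poly_Phi_euler n : exists d b : R[i] -> R[i],
  [/\ cpoly (Phi n) /\ cpoly d, cpoly b, forall z, zderiv (Phi n) z (d z) (lambda%:C * b z),
      forall z, (z - conjc z) * b z = Phi n z - conjc (Phi n z)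
    & forall z, z * d z + conjc z * (lambda%:C * b z) = n%:R * Phi n z].
Proof.
elim: n => [|n [d [b [[cP cd] cb zP hP eP]]]].
  have P0 : Phi 0 = (fun=> 1) by apply/funext => z; rewrite Phi0.
  exists (fun=> 0), (fun=> 0); rewrite P0; split; [split|..]; try exact: cpoly_cst.
  - by move=> z; rewrite mulr0; exact: zderiv_cst.
  - by move=> z; rewrite mulr0 rmorph1 subrr.
  - by move=> z; rewrite !mulr0 add0r mul0r.
pose c1 : R[i] := ((n.+1%:R + lambda) / n.+1%:R)%:C; pose c2 : R[i] := (lambda / n.+1%:R)%:C.
pose c3 : R[i] := (n.+1%:R^-1)%:C.
have PE : Phi n.+1 = (fun z => c1 * (z * Phi n z) + c2 * (conjc z * conjc (Phi n z))).
  by apply/funext => z; rewrite PhiS_div.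
have cJ := cpoly_conj R; have cI := cpoly_id R.
have cPJ := cpolyJ cP.
pose d' z := c1 * (Phi n z + z * d z) + c2 * (conjc z * conjc (lambda%:C * b z)).
(* Forced by the product rule: the derivative of [Phi n.+1] in [conj z] with one factor [lambda]
   taken out, which [c2 = c3 * lambda] permits also when [lambda = 0]. *)
pose b' z := c1 * (z * b z) + c3 * (conjc (Phi n z) + conjc z * conjc (d z)).
have cd' : cpoly d'.
  apply: cpolyD; apply: cpolyM; try exact: cpoly_cst.
    by apply: cpolyD => //; exact: cpolyM.
  by apply: cpolyM => //; apply: cpolyJ; apply: cpolyM => //; exact: cpoly_cst.
have cb' : cpoly b'.
  apply: cpolyD; apply: cpolyM; try exact: cpoly_cst; first exact: cpolyM.
  by apply: cpolyD => //; apply: cpolyM => //; exact: cpolyJ.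
have m0 : n.+1%:R != 0 :> R by rewrite pnatr_eq0.
have rcl : conjc lambda%:C = lambda%:C :> R[i] by apply: complex_ext; rewrite /= ?oppr0.
have c3E : c1 = c3 * (n.+1%:R + lambda%:C) /\ c2 = c3 * lambda%:C.
  by rewrite /c1 /c2 /c3 -rc_nat -rcD -!rcM; split; congr (_%:C); rewrite mulrC.
have c3n : c3 * n.+1%:R = 1 by rewrite /c3 -rc_nat -rcM mulVf // rmorph1.
exists d', b'; split.
- split=> //; rewrite PE; apply: cpolyD; apply: cpolyM; try exact: cpoly_cst; exact: cpolyM.
- by [].
- move=> z; rewrite PE; apply: zderiv_eq
    (zderivD (zderivM (zderiv_cst c1 z) (zderivM (zderiv_id z) (zP z)))
             (zderivM (zderiv_cst c2 z) (zderivM (zderivJ (zderiv_id z)) (zderivJ (zP z))))) _ _.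
    by rewrite /d' !rmorph0 !mul0r !add0r mul1r.
  by rewrite /b' !rmorph1 !mul0r !add0r mul1r; case: c3E => _ ->; ring.
- move=> z; have E1 := hP z; have := congr1 conjc E1; have := congr1 conjc (eP z).
  have PJ : conjc (Phi n.+1 z) = c1 * (conjc z * conjc (Phi n z)) + c2 * (z * Phi n z).
    by rewrite -PhiJ PE PhiJ !conjcK.
  rewrite PJ PE /b' !(conjcD, conjcM, conjcN, conjcK) rcl rmorph_nat; case: c3E => -> ->.
  rewrite -(@natr1 _ n); move: E1.
  set P := Phi n z; set Q := conjc P; set zb := conjc z; set B := b z; set Bb := conjc B.
  set D := conjc (d z); set l := lambda%:C; set m := n%:R => E1 E3 E2.
  have {}E3 : zb * D = m * Q - z * (l * Bb) by rewrite -E3 addrK.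
  have {}E2 : (z - zb) * Bb = P - Q by rewrite -[RHS]opprB -E2; ring.
  transitivity (c3 * ((m + 1 + l) * z * ((z - zb) * B) + (z - zb) * Q + (z - zb) * (zb * D))); first by ring.
  rewrite E1 E3.
  transitivity (c3 * ((m + 1 + l) * z * (P - Q) + (z - zb) * Q + (z - zb) * (m * Q) - z * l * ((z - zb) * Bb))); first by ring.
  by rewrite E2; ring.
- move=> z; have E4 := eP z; have := congr1 conjc E4.
  rewrite PE /d' /b' !(conjcD, conjcM, conjcK) rcl rmorph_nat; case: c3E => -> ->.
  rewrite -(@natr1 _ n); move: E4.
  set P := Phi n z; set Q := conjc P; set zb := conjc z; set B := b z; set Bb := conjc B.
  set D := conjc (d z); set l := lambda%:C; set m := n%:R => E4 E3.
  transitivity (c3 * ((m + 1 + l) * z * (P + (z * d z + zb * (l * B))) + l * zb * (Q + (zb * D + z * (l * Bb))))); first by ring.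
  by rewrite E4 E3; ring.
Qed.

Lemma dunkl_poly_phi n : dunkl_poly (phi lambda n).
Proof.
have [d [b [[cP cd] cb zP hP _]]] := dunkl_poly_Phi_euler n.
have -> : phi lambda n = (fun z => (Num.sqrt (gam lambda n)^-1)%:C * Phi n z).
  by apply/funext => z; rewrite phiE.
by apply: dunkl_polyZ; split=> //; exists d, b; split=> // z; rewrite PhiJ.
Qed.

Lemma dunkl_poly_sum N (c : nat -> R[i]) : dunkl_poly (fun z => \sum_(n < N) c n * phi lambda n z).
Proof.
elim: N => [|N IH].
  have -> : (fun z => \sum_(n < 0) c n * phi lambda n z) = (fun z => 0 * phi lambda 0 z).
    by apply/funext => z; rewrite big_ord0 mul0r.
  exact: dunkl_polyZ (dunkl_poly_phi 0).
have -> : (fun z => \sum_(n < N.+1) c n * phi lambda n z) =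
    (fun z => \sum_(n < N) c n * phi lambda n z + c N * phi lambda N z).
  by apply/funext => z; rewrite big_ord_recr.
exact: dunkl_polyD IH (dunkl_polyZ _ (dunkl_poly_phi N)).
Qed.

End DunklPolynomials.

(** * Convergence and growth of the series *)

Section MajorantTest.
Variables (R : realType) (lambda : R) (X : completeNormedModType R[i]) (a : nat -> X).
Variables (A : set R[i]) (b : nat -> R).
Hypothesis cvg_b : cvgn (series b).
Hypothesis ab : forall z n, A z -> rnorm (phi lambda n z *: a n) <= b n.
Implicit Types (z : R[i]) (e : R) (N M : nat).

Local Notation part := (phi_partial lambda a).

Lemma partial_series z : part ^~ z = series (fun n => phi lambda n z *: a n).
Proof. by apply/funext => N; rewrite /phi_partial /series /= big_mkord. Qed.

Lemma majorant_ge0 z n : A z -> 0 <= b n.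
Proof. by move=> Az; exact: le_trans (rnorm_ge0 _) (ab n Az). Qed.

Lemma partial_dist z N M : A z -> (N <= M)%N ->
  rnorm (part M z - part N z) <= limn (series b) - series b N.
Proof.
move=> Az NM.
have -> : part M z - part N z = \sum_(N <= n < M) phi lambda n z *: a n.
  by rewrite /phi_partial -!(big_mkord xpredT (fun n => phi lambda n z *: a n)) (@big_cat_nat _ _ _ N 0%N M) //= [LHS]addrC addKr.
apply: (le_trans (rnorm_sum _ _ _)).
apply: (@le_trans _ _ (\sum_(N <= n < M) b n)); first by apply: ler_sum => n _; exact: ab.
have -> : \sum_(N <= n < M) b n = series b M - series b N.
  by rewrite /series /= (@big_cat_nat _ _ _ N 0%N M) //= [RHS]addrC addKr.
rewrite lerD2r; apply: nondecreasing_cvgn_le => //.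
apply/nondecreasing_seqP => n; rewrite /series /= big_nat_recr //= lerDl.
exact: majorant_ge0 Az.
Qed.

Lemma partial_cvg z : A z -> cvgn (part ^~ z).
Proof.
move=> Az; rewrite partial_series; apply/cauchy_cvgP/cauchy_seriesP => e e0.
have er : 0 < complex.Re e /\ e = (complex.Re e)%:C.
  by move: e0; case: (e) => x y; rewrite ltcE /= => /andP[/eqP -> ->].
have [r0 ->] := er.
have /cauchy_cvgP/cauchy_seriesP/(_ _ r0) := cvg_b; apply: filterS => -[N M] /= h.
rewrite -rnormE ltcR; apply: le_lt_trans h; apply: (le_trans (rnorm_sum _ _ _)).
rewrite ger0_norm; last by apply: sumr_ge0 => n _; exact: majorant_ge0 Az.
by apply: ler_sum => n _; exact: ab.
Qed.

Lemma phi_sum_dist z N : A z ->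
  rnorm (phi_sum lambda a z - part N z) <= limn (series b) - series b N.
Proof.
move=> Az; have /cvgrPdist_lt h := partial_cvg Az.
apply/ler_addgt0Pr => e e0; have e0' : 0 < e%:C by rewrite ltcR.
have [M _ hM] := h _ e0'.
have := hM (maxn M N) (leq_maxl _ _); rewrite /= -rnormE ltcR => h1.
have h2 := partial_dist Az (leq_maxr M N).
rewrite -[X in rnorm X](subrKA (part (maxn M N) z)) addrC.
by apply: (le_trans (rnormD _ _)); apply: lerD => //; exact: ltW.
Qed.

(** Weierstrass test: the remainder of the scalar majorant bounds the distance to the sum on all of
    [A]. *)
Lemma phi_sum_uniform : {uniform A, part @ \oo --> phi_sum lambda a}.
Proof.
move=> P /uniform_nbhs[E [entE EP]].
move: entE; rewrite -entourage_ballE => -[e /= e0 he].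
have er : 0 < complex.Re e /\ e = (complex.Re e)%:C.
  by move: e0; case: (e) => x y; rewrite ltcE /= => /andP[/eqP -> ->].
have [r0 eE] := er.
move/cvgrPdist_lt : cvg_b => /(_ _ r0)[N _ hN]; exists N => // n /= Nn; apply: EP => z Az.
apply: he; rewrite /= -ball_normE /= eE -rnormE ltcR.
apply: (le_lt_trans (phi_sum_dist n Az)); apply: le_lt_trans (hN n Nn); exact: ler_norm.
Qed.

End MajorantTest.

(** * Bergman norms of bounded functions *)

Section BoundedFunctions.
Variables (R : realType) (lambda p : R) (w : R -> R).
Hypothesis lambda_ge0 : 0 <= lambda.
Hypothesis p_gt0 : 0 < p.
Hypothesis w_weight : is_weight w.
Local Notation cmu := (@completed_lebesgue_measure R).
Implicit Types (f : R[i] -> R[i]) (B I : R).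

Local Notation bint f := (\int[(lebesgue_measure \x lebesgue_measure)%E]_(xy in @disc2 R)
     (rnorm (f (toC xy)) `^ p * w (rnorm (toC xy)) * sigma_density lambda xy)%:E)%E.

Lemma sigma_densityE : exists2 cl : R, 0 <= cl &
  forall xy, sigma_density lambda xy = cl * `|xy.2| `^ (2 * lambda).
Proof.
exists (Gamma (lambda + 2) / (Gamma (lambda + 2^-1) * Gamma 2^-1)) => //.
by rewrite divr_ge0 ?mulr_ge0 ?Gamma_ge0.
Qed.

Lemma bergman_integrand_ge0 f (xy : R * R) : disc2 xy ->
  0 <= rnorm (f (toC xy)) `^ p * w (rnorm (toC xy)) * sigma_density lambda xy.
Proof.
move=> xyD; have xy1 : rnorm (toC xy) < 1 by exact: xyD.
have [cl cl0 ->] := sigma_densityE; rewrite !mulr_ge0 ?powR_ge0 // ltW //.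
by apply: weight_gt0 w_weight _ _; rewrite rnorm_ge0.
Qed.

Lemma bergman_norm_le f I : 0 <= I -> (bint f <= I%:E)%E ->
  (bergman_norm lambda w p f <= (I `^ p^-1)%:E)%E.
Proof.
move=> I0 fI; have f0 : (0 <= bint f)%E.
  by apply: integral_ge0 => xy xyD; rewrite lee_fin; exact: bergman_integrand_ge0.
have ff : bint f \is a fin_num by rewrite ge0_fin_numE // (le_lt_trans fI) // ltry.
rewrite /bergman_norm -(fineK ff) poweR_EFin lee_fin.
apply: ge0_ler_powR; rewrite ?nnegrE ?invr_ge0 ?(ltW p_gt0) ?fine_ge0 //.
by rewrite -lee_fin fineK.
Qed.

(** At [z = 0] the disc kernels are 1, so [disc_kernel_integral_le] bounds the mass of [w (|z|)] on
    the disc by the integral of [w]. *)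
Lemma bounded_integral_le : exists2 K : R, 0 <= K & forall f B, 0 <= B ->
  (forall z, rnorm z < 1 -> rnorm (f z) <= B) -> (bint f <= (B `^ p * K)%:E)%E.
Proof.
have [C C0 hC] := @disc_kernel_integral_le R 2 2 (ltr1n _ 2) (ltr1n _ 2).
have [cl cl0 clE] := sigma_densityE.
set W := (\int[cmu]_(s in `[0%R, 1%R[) w s).
have W0 : 0 <= W.
  by apply: Rintegral_ge0 => s; rewrite /= in_itv /= => s01; rewrite ltW // (weight_gt0 w_weight).
exists (2 * (C * cl * W)); first by rewrite !mulr_ge0 // ltW.
move=> f B B0 fB.
have Bp0 : 0 <= cl * B `^ p by rewrite mulr_ge0 ?powR_ge0.
have z1 : rnorm (0 : R[i]) < 1 by rewrite rnorm0.
have := hC w 0 _ 0 (weight_gt0 w_weight) z1 Bp0 (lexx _) => h.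
have k1 xy : disc_kernel 2 0 xy = 1 :> R by rewrite /disc_kernel mul0r subr0 rnorm1 powR1.
apply: (@le_trans _ _ _ _ _ (le_trans _ h)).
  apply: ge0_integral_mono => xy xyD; first by rewrite lee_fin; exact: bergman_integrand_ge0.
  have xy1 : rnorm (toC xy) < 1 by exact: xyD.
  have wxy : 0 < w (rnorm (toC xy)) by apply: weight_gt0 w_weight _ _; rewrite rnorm_ge0.
  rewrite lee_fin clE rmorph0 !k1 mul0r addr0 mulrAC; apply: ler_wpM2r; first exact: ltW.
  have y1 : `|xy.2| `^ (2 * lambda) <= 1.
    rewrite -[leRHS](congr1 (fun g => g (2 * lambda)) (@powR1 R)).
    by apply: ge0_ler_powR; rewrite ?nnegrE ?mulr_ge0 //; exact: le_trans (Im_le_rnorm (toC xy)) (ltW xy1).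
  have fp : rnorm (f (toC xy)) `^ p <= B `^ p.
    by apply: ge0_ler_powR; rewrite ?nnegrE ?rnorm_ge0 ?(ltW p_gt0) // fB.
  rewrite mulrCA -mulrA ler_wpM2l //.
  apply: (@le_trans _ _ (B `^ p * 1)); first by apply: ler_pM; rewrite ?powR_ge0.
  by rewrite ler_wpM2l ?powR_ge0 // lerDl.
have -> : (\int[cmu]_(s in `[0%R, 1%R[) (w s * (C * (cl * B `^ p * (1 - rnorm (0 : R[i]) * s) `^ (1 - 2)
    + 0 * (1 - rnorm (0 : R[i]) * s) `^ (1 - 2))))%:E =
   \int[cmu]_(s in `[0%R, 1%R[) ((C * (cl * B `^ p))%:E * (w s)%:E))%E.
  by apply: eq_integral => s _; rewrite rnorm0 mul0r subr0 powR1 mul0r addr0 mulr1 -EFinM mulrC.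
rewrite weightZ_EFin ?lexx ?ler01 ?mulr_ge0 ?(ltW C0) ?powR_ge0 // -EFinM lee_fin -/W.
by rewrite le_eqVlt; apply/orP; left; apply/eqP; ring.
Qed.

End BoundedFunctions.

(** * From the kernel estimate to the growth of F *)

Section Assembly.
Variables (R : realType) (lambda p q : R) (w : R -> R).
Variables (X : completeNormedModType R[i]) (T : (R[i] -> R[i]) -> X).
Hypothesis lambda_ge0 : 0 <= lambda.
Hypothesis p01 : 0 < p <= 1.
Hypothesis q_gt0 : 0 < q.
Hypothesis w_weight : is_weight w.
Hypothesis T_linear : linear_on (lambda_analytic_poly lambda) T.
Let alpha := (q + 2 * lambda + 1) / p - 2 * lambda - 2.
Let kappa := 2 * lambda * (1 - p).
Implicit Types (z v : R[i]) (n N : nat) (c : nat -> R[i]).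
Let p_gt0 : 0 < p. Proof. by have /andP[] := p01. Qed.

Lemma phi_poly n : lambda_analytic_poly lambda (phi lambda n).
Proof.
exists n.+1, (fun k => if k == n then 1 else 0); apply/funext => z.
rewrite big_ord_recr /= eqxx mul1r big1 ?add0r // => i _.
by rewrite ltn_eqF ?mul0r.
Qed.

Lemma linear_on_sum N c :
  T (fun z => \sum_(n < N) c n * phi lambda n z) = \sum_(n < N) c n *: T (phi lambda n).
Proof.
have P k : lambda_analytic_poly lambda (fun z => \sum_(n < k) c n * phi lambda n z) by exists k, c.
elim: N => [|N IH].
  (* Linearity with [a = 1] and the zero function twice gives [T 0 = T 0 + T 0]. *)
  have := T_linear 1 (P 0) (P 0); rewrite scale1r big_ord0.
  have -> : (fun z => 1 * (\sum_(n < 0) c n * phi lambda n z) + \sum_(n < 0) c n * phi lambda n z)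
    = (fun z => \sum_(n < 0) c n * phi lambda n z).
    by apply/funext => z; rewrite !big_ord0 mulr0 addr0.
  by move=> h; apply: (addIr (T (fun z => \sum_(n < 0) c n * phi lambda n z))); rewrite add0r.
rewrite big_ord_recr /= -IH addrC -(T_linear _ (phi_poly N) (P N)).
by congr T; apply/funext => z; rewrite big_ord_recr /= addrC.
Qed.

Lemma phi_le n z : rnorm (phi lambda n z) <= Num.sqrt (gam lambda n) * rnorm z ^+ n.
Proof.
have g0 := gam_gt0 lambda_ge0 n; have s0 : 0 < Num.sqrt (gam lambda n) by rewrite sqrtr_gt0.
rewrite phiE rnormM rnormR ger0_norm ?sqrtr_ge0 //.
apply: (le_trans (ler_wpM2l (sqrtr_ge0 _) (Phi_le lambda_ge0 n z))).
rewrite mulrA ler_wpM2r ?exprn_ge0 ?rnorm_ge0 // sqrtrV ?(ltW g0) //.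
by rewrite -{2}(sqr_sqrtr (ltW g0)) expr2 mulrA mulVf ?mul1r // gt_eqF.
Qed.

Lemma phi_le_disc n z : rnorm z < 1 -> rnorm (phi lambda n z) <= Num.sqrt (gam lambda n).
Proof.
move=> z1; apply: (le_trans (phi_le n z)); rewrite ler_piMr ?sqrtr_ge0 //.
by rewrite exprn_ile1 ?rnorm_ge0 // ltW.
Qed.

(** The bound on the extension is stated on the Bergman space, so [lambda]-analyticity and a finite
    norm must be known before it is applied to a polynomial. *)
Lemma poly_bergman N c : bergman lambda w p (fun z => \sum_(n < N) c n * phi lambda n z).
Proof.
split; first exact: dunkl_poly_lambda_analytic (dunkl_poly_sum lambda_ge0 N c).
have [K K0 hK] := bounded_integral_le lambda_ge0 p_gt0 w_weight.
pose B := \sum_(n < N) rnorm (c n) * Num.sqrt (gam lambda n).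
have B0 : 0 <= B by apply: sumr_ge0 => n _; rewrite mulr_ge0 ?rnorm_ge0 ?sqrtr_ge0.
have fB z : rnorm z < 1 -> rnorm (\sum_(n < N) c n * phi lambda n z) <= B.
  move=> z1; apply: (le_trans (rnorm_sum _ _ _)); apply: ler_sum => n _.
  by rewrite rnormM ler_wpM2l ?rnorm_ge0 // phi_le_disc.
have I0 : 0 <= B `^ p * K by rewrite mulr_ge0 ?powR_ge0.
by apply: le_lt_trans (bergman_norm_le p_gt0 w_weight I0 (hK _ _ B0 fB)) _; rewrite ltry.
Qed.

Lemma extension_bound : has_bounded_extension lambda w p T ->
  exists2 C : R, 0 <= C & forall N c (I : R), 0 <= I ->
    (\int[(lebesgue_measure \x lebesgue_measure)%E]_(xy in @disc2 R)
      (rnorm (\sum_(n < N) c n * phi lambda n (toC xy)) `^ p * w (rnorm (toC xy))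
       * sigma_density lambda xy)%:E <= I%:E)%E ->
    rnorm (\sum_(n < N) c n *: T (phi lambda n)) <= C * I `^ p^-1.
Proof.
move=> [S [_ ST [C hC]]]; exists `|C| => // N c I I0 fI.
pose f z := \sum_(n < N) c n * phi lambda n z.
have fb : bergman lambda w p f by exact: poly_bergman.
have n0 : (0 <= bergman_norm lambda w p f)%E by exact: poweR_ge0.
have h := bergman_norm_le (f := f) p_gt0 w_weight I0 fI.
rewrite -linear_on_sum -/f -ST; last by exists N, c.
rewrite -lee_fin EFinM; apply: (le_trans (hC f fb)).
apply: (@le_trans _ _ (`|C|%:E * bergman_norm lambda w p f)%E).
  by apply: lee_wpmul2r => //; rewrite lee_fin ler_norm.
by apply: lee_wpmul2l; rewrite ?lee_fin.
Qed.

(** [Gamma (x + n) = (x)_n Gamma x] at [x = lambda + 1] and [x = lambda + alpha + 2], both at least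
    1 because [alpha > -1]. *)
Lemma Fcoef_kcoef n : Fcoef lambda alpha T n = (kcoef lambda alpha n)%:C *: T (phi lambda n).
Proof.
rewrite /Fcoef /kcoef; congr (_%:C *: _).
have a1 := alpha_gtN1 lambda_ge0 p01 q_gt0; rewrite -/alpha in a1.
have x1 : 1 <= lambda + 1 by rewrite lerDr.
have x2 : 1 <= lambda + alpha + 2 by move: a1 lambda_ge0; lra.
have -> : n%:R + lambda + alpha + 2 = lambda + alpha + 2 + n%:R by ring.
have -> : n%:R + lambda + 1 = lambda + 1 + n%:R by ring.
rewrite (Gamma_poch n x2) (Gamma_poch n x1).
have l0 : 0 < lambda + 1 by exact: lt_le_trans x1.
have := Gamma_gt0 x1; have := Gamma_gt0 x2; have := poch_gt0 n l0.
move: (Gamma _) (Gamma _) (poch _ _) (poch _ _) => G1 G2 P1 P2 h1 h2 h3.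
by field; rewrite !gt_eqF.
Qed.

Lemma partial_kernel N z : phi_partial lambda (Fcoef lambda alpha T) N z =
  \sum_(n < N) ((kcoef lambda alpha n)%:C * phi lambda n z) *: T (phi lambda n).
Proof.
by apply: eq_bigr => n _; rewrite Fcoef_kcoef scalerA mulrC.
Qed.

Lemma kernel_sum N z v : dunkl_kernel lambda alpha N z v =
  \sum_(n < N) ((kcoef lambda alpha n)%:C * phi lambda n z) * phi lambda n v.
Proof. by apply: eq_bigr => n _; rewrite -mulrA kapE. Qed.

(** On the disc [phi n] is bounded by [sqrt (gam n)], so the norm of [T (phi n)] is at most a
    constant times [sqrt (gam n)]; a second such factor comes from [phi n z]. *)
Lemma Fcoef_majorant : has_bounded_extension lambda w p T ->
  exists2 C : R, 0 <= C & forall n z r, rnorm z <= r ->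
    rnorm (phi lambda n z *: Fcoef lambda alpha T n)
    <= C * kcoef lambda alpha n * gam lambda n * r ^+ n.
Proof.
move=> hT; have [C C0 hC] := extension_bound hT.
have [K K0 hK] := bounded_integral_le lambda_ge0 p_gt0 w_weight.
have a1 := alpha_gtN1 lambda_ge0 p01 q_gt0; rewrite -/alpha in a1.
exists (C * K `^ p^-1) => [|n z r zr]; first by rewrite mulr_ge0 ?powR_ge0.
have g0 := gam_gt0 lambda_ge0 n; set s := Num.sqrt (gam lambda n).
have s0 : 0 <= s := sqrtr_ge0 _.
have xn : rnorm (T (phi lambda n)) <= C * K `^ p^-1 * s.
  pose c k : R[i] := if k == n then 1 else 0.
  have cE v : \sum_(k < n.+1) c k * phi lambda k v = phi lambda n v.
    rewrite big_ord_recr /= /c eqxx mul1r big1 ?add0r // => i _.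
    by rewrite ltn_eqF ?mul0r.
  have cT : \sum_(k < n.+1) c k *: T (phi lambda k) = T (phi lambda n).
    rewrite big_ord_recr /= /c eqxx scale1r big1 ?add0r // => i _.
    by rewrite ltn_eqF ?scale0r.
  have I0 : 0 <= s `^ p * K by rewrite mulr_ge0 ?powR_ge0.
  have := hC n.+1 c _ I0; rewrite cT => /(_ _) h.
  have {h} := h _; rewrite powRM ?powR_ge0 // -powRrM mulfV ?gt_eqF // powRr1 //.
  rewrite [s * _]mulrC mulrA; apply.
  under eq_integral do rewrite cE.
  by apply: hK => // v v1; exact: phi_le_disc.
rewrite Fcoef_kcoef scalerA rnormZ rnormM rnormR ger0_norm ?kcoef_ge0 //.
have ph : rnorm (phi lambda n z) <= s * r ^+ n.
  apply: (le_trans (phi_le n z)); rewrite ler_wpM2l // lerXn2r ?nnegrE ?rnorm_ge0 //.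
  exact: le_trans (rnorm_ge0 _) zr.
have k0 := kcoef_ge0 lambda_ge0 a1 n.
have r0 : 0 <= r by exact: le_trans (rnorm_ge0 _) zr.
apply: (@le_trans _ _ (s * r ^+ n * kcoef lambda alpha n * (C * K `^ p^-1 * s))).
  apply: ler_pM => //; try exact: rnorm_ge0; first by rewrite mulr_ge0 // rnorm_ge0.
  by apply: ler_wpM2r.
have -> : gam lambda n = s * s by rewrite -expr2 sqr_sqrtr // ltW.
by rewrite le_eqVlt; apply/orP; left; apply/eqP; ring.
Qed.

Lemma cvg_majorant (C r : R) : 0 <= C -> 0 <= r < 1 ->
  cvgn (series (fun n => C * kcoef lambda alpha n * gam lambda n * r ^+ n)).
Proof.
move=> C0 r01; have a1 := alpha_gtN1 lambda_ge0 p01 q_gt0; rewrite -/alpha in a1.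
have sk : slow (kcoef lambda alpha).
  have l0 : 0 < lambda + 1 by rewrite ltr_wpDl.
  have a0 : 0 <= alpha + 1 by move: a1; lra.
  have := slow_poch l0 a0; congr slow; apply/funext => n; rewrite /kcoef.
  by congr (poch _ n / _); ring.
exact: slow_cvg (slowM (slowM (slow_cst C0) sk) (slow_gam lambda_ge0)) r01.
Qed.

(** In the disc of radius [(1 - |z0|) / 2] about [z0], [|z|] stays below the midpoint [r] of [|z0|]
    and 1. *)
Lemma local_majorant z0 : has_bounded_extension lambda w p T -> disc z0 ->
  exists2 b : nat -> R, cvgn (series b) & forall z n,
    disc z /\ rnorm (z - z0) < (1 - rnorm z0) / 2 ->
    rnorm (phi lambda n z *: Fcoef lambda alpha T n) <= b n.
Proof.
move=> hT z01; have [C C0 hC] := Fcoef_majorant hT; set r := (1 + rnorm z0) / 2.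
have z0' := rnorm_ge0 z0; have z1 : rnorm z0 < 1 by exact: z01.
exists (fun n => C * kcoef lambda alpha n * gam lambda n * r ^+ n).
  by apply: cvg_majorant => //; rewrite /r; lra.
move=> z n [_ zz]; apply: hC.
by have := rnormD (z - z0) z0; rewrite subrK /r; move: zz; lra.
Qed.

Lemma series_analytic : has_bounded_extension lambda w p T ->
  vector_lambda_analytic lambda (Fcoef lambda alpha T).
Proof.
move=> hT z0 z01; have [b cb hb] := local_majorant hT z01.
have z1 : rnorm z0 < 1 by exact: z01.
exists ((1 - rnorm z0) / 2); first by rewrite divr_gt0 // subr_gt0.
exact: phi_sum_uniform cb hb.
Qed.

Hypothesis w_cond : exists2 c : R, 0 < c & forall r : R, 0 < r < 1 ->
  \int[completed_lebesgue_measure]_(s in `[0, r]) (w s / (1 - s) `^ q)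
  <= c * ((1 - r) `^ q)^-1 * \int[completed_lebesgue_measure]_(s in `[r, 1[) w s.

(** For arbitrary [e > 0] the index [N] is taken so large, depending on [z], that the remainder of
    the series contributes at most [e] and that [tail] is at most 1; the constant depends on
    neither. *)
Lemma series_growth : has_bounded_extension lambda w p T ->
  exists2 c : R, 0 < c & forall z : R[i], disc z ->
    rnorm (phi_sum lambda (Fcoef lambda alpha T) z) `^ p
    <= c * (rnorm (1 - z ^+ 2) `^ kappa / (1 - rnorm z) `^ ((alpha + 2) * p - 1))
       * \int[completed_lebesgue_measure]_(s in `[Num.sqrt (rnorm z), 1[) w s.
Proof.
move=> hT; have [C C0 hC] := extension_bound hT.
have [C1 C10 [k hC1]] := bergman_kernel_integral_le lambda_ge0 p01 q_gt0 w_weight w_cond.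
(* The 3 is [1 + 2]: once [tail <= 1], the second term of the kernel integral is at most
   [2 V <= 2 Y]. *)
exists (2 `^ p * (C `^ p * C1 * 3) + 1); first by rewrite ltr_wpDl // !mulr_ge0 ?powR_ge0 // ltW.
move=> z zd; have z1 : rnorm z < 1 by exact: zd.
set W := (\int[_]_(s in _) _); set D := rnorm (1 - z ^+ 2); set r := rnorm z in z1 *.
have r0 : 0 <= r := rnorm_ge0 z.
have ka0 : 0 <= kappa := kappa_ge0 lambda_ge0 p01.
have W0 : 0 <= W.
  apply: Rintegral_ge0 => s; rewrite /= in_itv /= => /andP[h s1].
  by rewrite ltW // (weight_gt0 w_weight) // s1 (le_trans _ h) // sqrtr_ge0.
have e0 : 0 < 1 - r by rewrite subr_gt0.
have rD : 1 - r <= D.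
  have := rnormD (1 - z ^+ 2) (z ^+ 2); rewrite subrK rnorm1 rnormX -/r -/D.
  have : r ^+ 2 <= r by rewrite expr2 ler_piMr // ltW.
  lra.
set Y := D `^ kappa * (1 - r) `^ (- (q + kappa)); set V := (1 - r) `^ (- q).
have Y0 : 0 <= Y by rewrite mulr_ge0 ?powR_ge0.
have V0 : 0 <= V := powR_ge0 _ _.
(* [1 - |z| <= |1 - z^2|] turns [(1 - r)^kappa] into [D^kappa], so the term without [|1 - z^2|] is
   dominated by the other. *)
have VY : V <= Y.
  rewrite /Y /V (_ : - q = kappa + - (q + kappa)); last by ring.
  rewrite powRD ?(gt_eqF e0) ?implybT // ler_wpM2r ?powR_ge0 //.
  by apply: ge0_ler_powR; rewrite ?nnegrE ?rnorm_ge0 // ltW.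
have -> : D `^ kappa / (1 - r) `^ ((alpha + 2) * p - 1) = Y.
  rewrite /Y powRN; congr (_ / _ `^ _).
  by rewrite /alpha /kappa; field; rewrite gt_eqF.
apply/ler_addgt0Pr => e egt0.
have k0 : 0 < 2 `^ p :> R by apply: powR_gt0.
(* Chosen so that [2^p e'^p = e]. *)
pose e' := (e / 2 `^ p) `^ p^-1.
have e'0 : 0 < e' by rewrite powR_gt0 // divr_gt0.
have [b cb hb] := local_majorant hT zd.
have zA : disc z /\ rnorm (z - z) < (1 - rnorm z) / 2 by split => //; rewrite subrr rnorm0 divr_gt0.
have /cvgrPdist_lt cF := partial_cvg cb hb zA.
have e'C : 0 < e'%:C by rewrite ltcR.
have [N1 _ hN1] := cF _ e'C.
have /cvgrPdist_lt/(_ _ ltr01)[N2 _ hN2] := tail_cvg lambda_ge0 k z1.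
pose N := maxn N1 N2.
have {hN1} := hN1 N (leq_maxl _ _); rewrite /= -rnormE ltcR => d1.
have {hN2} := hN2 N (leq_maxr _ _); rewrite /= sub0r normrN => t1.
have t0 : 0 <= tail lambda k z N by exact: tail_ge0.
rewrite ger0_norm // in t1.
have tp : tail lambda k z N `^ p <= 1.
  rewrite -[leRHS](congr1 (fun g => g p) (@powR1 R)).
  by apply: ge0_ler_powR; rewrite ?nnegrE ?(ltW p_gt0) // ltW.
pose I := C1 * (Y + (1 + tail lambda k z N `^ p) * V) * W.
have I0 : 0 <= I by rewrite /I !mulr_ge0 ?addr_ge0 ?mulr_ge0 ?addr_ge0 ?powR_ge0 // ltW.
have := hC N (fun n => (kcoef lambda alpha n)%:C * phi lambda n z) I I0.
under eq_integral do rewrite -kernel_sum.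
move=> /(_ (hC1 z N z1)); rewrite -partial_kernel.
set F := phi_sum _ _ z; set S := phi_partial _ _ N z => hS.
have Sp : rnorm S `^ p <= C `^ p * (C1 * (3 * Y) * W).
  apply: (@le_trans _ _ ((C * I `^ p^-1) `^ p)).
    by apply: ge0_ler_powR; rewrite ?nnegrE ?(ltW p_gt0) ?rnorm_ge0 // mulr_ge0 ?powR_ge0.
  rewrite powRM ?powR_ge0 // -powRrM mulVf ?gt_eqF // powRr1 // ler_wpM2l ?powR_ge0 //.
  rewrite /I ler_wpM2r // ler_wpM2l ?(ltW C10) //.
  have : (1 + tail lambda k z N `^ p) * V <= 2 * Y by apply: ler_pM => //; [rewrite addr_ge0 ?powR_ge0|lra].
  by lra.
have dp : rnorm (F - S) `^ p <= e / 2 `^ p.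
  have <- : e' `^ p = e / 2 `^ p.
    by rewrite /e' -powRrM mulVf ?gt_eqF // powRr1 // divr_ge0 // ltW.
  have d1' : rnorm (F - S) <= e' by exact: ltW.
  by apply: ge0_ler_powR => //; rewrite ?nnegrE ?rnorm_ge0 // ltW.
have FS : rnorm F `^ p <= 2 `^ p * (rnorm S `^ p + rnorm (F - S) `^ p).
  apply: le_trans (powRD_le (rnorm_ge0 _) (rnorm_ge0 _) (ltW p_gt0)).
  apply: ge0_ler_powR; rewrite ?nnegrE ?(ltW p_gt0) ?addr_ge0 ?rnorm_ge0 //.
  by have := rnormD S (F - S); rewrite addrC subrK.
apply: (le_trans FS); apply: (le_trans (ler_wpM2l (ltW k0) (lerD Sp dp))).
rewrite mulrDr [2 `^ p * (e / _)]mulrC divfK ?gt_eqF // lerD2r.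
have YW : 0 <= Y * W by rewrite mulr_ge0.
rewrite -subr_ge0 (_ : _ - _ = Y * W) //; ring.
Qed.

End Assembly.

Theorem theorem4p2 (R : realType) (lambda p q : R) (w : R -> R)
    (X : completeNormedModType R[i]) (T : (R[i] -> R[i]) -> X)
    (lambda_ge0 : 0 <= lambda)
    (p0_le_p : 2 * lambda / (2 * lambda + 1) <= p)
    (p_gt0 : 0 < p) (p_le1 : p <= 1) (q_gt0 : 0 < q)
    (w_weight : is_weight w)
    (w_cond : exists2 c : R, 0 < c & forall r : R, 0 < r < 1 ->
       \int[completed_lebesgue_measure]_(s in `[0, r]) (w s / (1 - s) `^ q)
       <= c * ((1 - r) `^ q)^-1
          * \int[completed_lebesgue_measure]_(s in `[r, 1[) w s)
    (T_linear : linear_on (lambda_analytic_poly lambda) T) :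
  let alpha := (q + 2 * lambda + 1) / p - 2 * lambda - 2 in
  let F := phi_sum lambda (Fcoef lambda alpha T) in
  has_bounded_extension lambda w p T ->
  vector_lambda_analytic lambda (Fcoef lambda alpha T) /\
  exists2 c : R, 0 < c & forall z : R[i], disc z ->
    rnorm (F z) `^ p
    <= c * (rnorm (1 - z ^+ 2) `^ (2 * lambda * (1 - p))
            / (1 - rnorm z) `^ ((alpha + 2) * p - 1))
       * \int[completed_lebesgue_measure]_(s in `[Num.sqrt (rnorm z), 1[) w s.
Proof.
move=> alpha F hT; have p01 : 0 < p <= 1 by rewrite p_gt0.
split; first exact: (series_analytic lambda_ge0 p01 q_gt0 w_weight T_linear hT).
exact: (series_growth lambda_ge0 p01 q_gt0 w_weight T_linear w_cond hT).
Qed.
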